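(* Let $\nu>0$ and let $u^0\in H^8(\mathbb T^2)$ be real-valued with mean zero. For $\tau>0$ let $u^{n+1}=S_L(\tau)S_N(\tau)u^n$, $n\ge 0$. Let $u$ be the exact solution of the Cahn-Hilliard equation $$\partial_tu=\Delta(-\nu\Delta u+u^3-u)\ \text{ on }(0,\infty)\times\mathbb T^2,\qquad u|_{t=0}=u^0.$$ Let $\tau_*=\tau_*(\|u^0\|_{H^1},\nu)>0$ be the uniform-stability threshold described in the context, and let $0<\tau<\tau_*$. Then for any $T>0$, $$\sup_{n\ge 1,\ n\tau\le T}\|u^n-u(n\tau,\cdot)\|_{L^2(\mathbb T^2)}\le C\cdot\tau,$$ where $C>0$ depends only on $(\nu,\|u^0\|_{H^8},T)$.
   Context: $\mathbb T^2=[-\pi,\pi]^2=\mathbb R^2/2\pi\mathbb Z^2$ is the $2\pi$-periodic torus and $H^s(\mathbb T^2)$ is the usual $L^2$-based Sobolev space. For $\tau>0$, $S_L(\tau)=e^{-\tau\nu\Delta^2}$ is the Fourier multiplier with symbol $e^{-\tau\nu|k|^4}$, $k\in\mathbb Z^2$, and $S_N(\tau)w=w+\tau\Delta(w^3-w)$. Uniform-stability threshold: fix functions $\tau_*(\cdot,\cdot)>0$ and $A_1(\cdot,\cdot,\cdot)<\infty$ with the following property: for every $\nu>0$, every integer $k_0\ge1$, every real-valued mean-zero $u^0\in H^{k_0}(\mathbb T^2)$ and every $0<\tau<\tau_*(\|u^0\|_{H^1},\nu)$, the iterates $u^{n+1}=S_L(\tau)S_N(\tau)u^n$ ($n\ge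 0$) satisfy $\sup_{n\ge0}\|u^n\|_{H^{k_0}}\le A_1(\|u^0\|_{H^{k_0}},\nu,k_0)$. (Such functions exist.) The constant $\tau_*$ in the claim is this $\tau_*(\|u^0\|_{H^1},\nu)$. *)

(* Defs.v *)
From HB Require Import structures.
From mathcomp Require Import all_boot all_order all_algebra.
From mathcomp Require Import all_classical all_reals all_analysis.
From mathcomp Require Import complex.

Set Implicit Arguments.
Unset Strict Implicit.
Unset Printing Implicit Defensive.

Import Order.TTheory GRing.Theory Num.Theory.
Import numFieldNormedType.Exports.

Local Open Scope classical_set_scope.
Local Open Scope complex_scope.
Local Open Scope ring_scope.

(* Functions on the torus are functions on R * R that are 2 pi-periodic in each
   variable; integrals are taken over the cell [-pi, pi]^2. *)
Section Torus.
Variable R : realType.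
Implicit Types (f w : R * R -> R) (k : int * int) (c : int * int -> R[i]).

Local Notation lebesgue2 := (@lebesgue_measure R \x @lebesgue_measure R)%E.

Definition cell : set (R * R) := `[- pi, pi] `*` `[- pi, pi].

Definition periodic2 f :=
  forall x y, f (x + pi *+ 2, y) = f (x, y) /\ f (x, y + pi *+ 2) = f (x, y).

Definition L2norm f : \bar R := ('N[lebesgue2]_2%:E [EFin \o (f \_ cell)])%E.

Definition L2torus f :=
  [/\ periodic2 f, measurable_fun setT f & (L2norm f < +oo)%E].

Definition mean_zero f := (\int[lebesgue2]_(z in cell) f z)%R = 0.

Definition dotk k (z : R * R) : R := k.1%:~R * z.1 + k.2%:~R * z.2.
Definition sqnorm k : R := k.1%:~R ^+ 2 + k.2%:~R ^+ 2.

(* (2 pi)^-2 \int f(z) e^{- i k.z} dz, for real-valued f *)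
Definition fourier f k : R[i] :=
  (((pi *+ 2) ^- 2)%:C *
   ((\int[lebesgue2]_(z in cell) (f z * cos (dotk k z)))
    -i* (\int[lebesgue2]_(z in cell) (f z * sin (dotk k z)))))%R.

(* Squared Sobolev norm; the factor (2 pi)^2 makes the H^0 norm the L^2 norm. *)
Definition sobolev_sqnorm (s : nat) f : \bar R :=
  (\esum_(k in [set: int * int])
     ((pi *+ 2) ^+ 2 * (1 + sqnorm k) ^+ s * ComplexField.Normc.normc (fourier f k) ^+ 2)%:E)%E.

Definition sobolev (s : nat) f := L2torus f /\ (sobolev_sqnorm s f < +oo)%E.

(* Meaningful only when [sobolev s f] holds. *)
Definition sobolev_norm (s : nat) f : R := Num.sqrt (fine (sobolev_sqnorm s f)).

(* Periodic distributions are given by their Fourier coefficients, on which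
   Fourier multipliers act pointwise. *)
Definition lap_mult c k : R[i] := (- sqnorm k)%:C * c k.

Definition SL (nu tau : R) c k : R[i] := (expR (- (tau * nu * sqnorm k ^+ 2)))%:C * c k.

(* S_N w is only a distribution when w is merely in H^1, whence the codomain. *)
Definition SN (tau : R) w k : R[i] :=
  fourier w k + tau%:C * lap_mult (fourier (fun z => w z ^+ 3 - w z)) k.

(* The equation determines U n.+1 up to a null set: the Fourier coefficients
   characterize an element of L^2. *)
Definition splitting_iterates (nu tau : R) (u0 : R * R -> R)
    (U : nat -> R * R -> R) :=
  U 0%N = u0 /\
  forall n, L2torus (U n.+1) /\ fourier (U n.+1) = SL nu tau (SN tau (U n)).

Definition uniform_stability (tau_star : R -> R -> R) (A1 : R -> R -> nat -> R) :=
  (forall a nu, 0 <= a -> 0 < nu -> 0 < tau_star a nu) /\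
  forall (nu : R) (k0 : nat) (u0 : R * R -> R) (tau : R) (U : nat -> R * R -> R),
    0 < nu -> (1 <= k0)%N -> sobolev k0 u0 -> mean_zero u0 ->
    0 < tau -> tau < tau_star (sobolev_norm 1 u0) nu ->
    splitting_iterates nu tau u0 U ->
    forall n, sobolev k0 (U n) /\
              sobolev_norm k0 (U n) <= A1 (sobolev_norm k0 u0) nu k0.

Definition e1 : R * R := (1, 0).
Definition e2 : R * R := (0, 1).

Definition laplacian f (z : R * R) : R := 'D_e1 ('D_e1 f) z + 'D_e2 ('D_e2 f) z.

Definition continuous_pos_time (v : R -> R * R -> R) :=
  forall (t : R) (z : R * R), 0 < t ->
    {for (t, z), continuous (fun p : R * (R * R) => v p.1 p.2)}.

(* All space derivatives of order at most n exist and are jointly continuous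
   on (0, oo) x R^2. *)
Fixpoint space_C (n : nat) (v : R -> R * R -> R) : Prop :=
  continuous_pos_time v /\
  match n with
  | 0 => True
  | n'.+1 =>
    [/\ forall t z, 0 < t -> derivable (v t) z e1 /\ derivable (v t) z e2,
        space_C n' (fun t => 'D_e1 (v t)) &
        space_C n' (fun t => 'D_e2 (v t))]
  end.

Definition time_C1 (v : R -> R * R -> R) :=
  (forall t z, 0 < t -> derivable (fun s => v s z) t 1) /\
  continuous_pos_time (fun t z => derive1 (fun s => v s z) t).

(* Classical solution, continuous up to t = 0: this class contains the solution
   issued from any H^8 datum, and has at most one solution for each datum. The
   datum is prescribed almost everywhere, u0 being an element of an L^2 class. *)
Definition CH_solution (nu : R) (u0 : R * R -> R) (u : R -> R * R -> R) :=
  [/\ [/\ forall t, 0 <= t -> periodic2 (u t),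
          {within [set p : R * (R * R) | 0 <= p.1],
            continuous (fun p : R * (R * R) => u p.1 p.2)},
          space_C 4 u & time_C1 u],
      forall t z, 0 < t ->
        derive1 (fun s => u s z) t =
        laplacian (fun x => - nu * laplacian (u t) x + u t x ^+ 3 - u t x) z &
      {ae lebesgue2, forall z, u 0 z = u0 z}].

End Torus.

(* Main.v *)
(* Fourier series are handled as absolutely convergent real sums
   sum_k a_k cos(k.z) + b_k sin(k.z).  Since sum_k (1 + |k|^2)^(-2) is finite,
   the H^8 bound of the stability hypothesis gives
   sum_k (1 + |k|^2)^3 |c_k| <= A for the coefficients c_k of every iterate u^n,
   and the convolution inequality gives a bound of the same kind for f(u^n),
   where f(x) = x^3 - x.
   On one time step, w(s) = S_L(s) S_N(s) u^n joins u^n to u^(n+1) and solves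
   d_s w = Delta(- nu Delta w + G) with G(s) = S_L(s) f(u^n); the weighted sums
   bound w and grad w uniformly and give G - f(w) = O(tau).
   Let e = w - u.  In the L^2 energy estimate for e, the gradient of
   f(w) - f(u) is written 3 u^2 grad e + 3 e (w + u) grad w - grad e; the terms
   containing u form perfect squares with the good term u^2 |grad e|^2, so that
   d_s |e|^2 <= K |e|^2 + |G - f(w)|^2 / nu, where K depends on the bounds for
   w and grad w only.  No a priori bound on the exact solution is needed, and
   Gronwall's inequality over the n steps concludes. *)

From HB Require Import structures.
Require Import Defs.
From mathcomp Require Import all_boot all_order all_algebra.
From mathcomp Require Import all_classical all_reals all_analysis.
From mathcomp Require Import measurable_realfun complex ring lra.

Set Implicit Arguments.
Unset Strict Implicit.
Unset Printing Implicit Defensive.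

Import Order.TTheory GRing.Theory Num.Theory.
Import numFieldNormedType.Exports.

Local Open Scope classical_set_scope.
Local Open Scope ring_scope.

(** * Sums over the lattice and integrals over the cell *)

Section LatticeSum.
Context (R : realType).
Implicit Types (f g : int * int -> R).

(** An iterate is only an L^2 class pinned down by its Fourier coefficients, whereas the energy
    estimate needs derivatives. The bridge is Fourier inversion: a class with summable coefficients
    agrees almost everywhere with its continuous Fourier series. This rests on completeness of the
    trigonometric system, obtained without kernels: for a trigonometric polynomial t with values in
    [0, 1], the polynomials (1 - t^n)^(n 2^n) converge to the indicator of {t < 1/2}, so
    orthogonality to all trigonometric functions survives cutting to half-planes, hence to all Borel
    sets. The exponents come from the interpolant. Each Delta costs one weight 1 + |k|^2, and d_s w
    contains Delta^2 applied to s Delta f(u^n), whence three weights on the coefficients of f(u^n);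
    the inequality w^3 |c| <= (w^8 |c|^2 + w^(-2)) / 2 turns three weights into H^8. The exact
    solution is differentiable in time for t > 0 only, with no bound on the derivative near 0; so
    each Gronwall step uses continuity on the closed interval and derivatives in its interior. *)

Lemma lattice_enum_subproof : exists e : nat -> int * int, bijective e.
Proof.
have : ([set: int * int] #= [set: nat])%card.
  apply: eq_card_nat; first exact: countableP.
  move=> fin; apply: infinite_nat; pose h (n : nat) := (Posz n, Posz n).
  rewrite (_ : [set: nat] = h @^-1` [set: int * int])//.
  by apply: finite_preimage => // m n _ _ [].
by move=> /card_set_bijP[f]; rewrite setTT_bijective => -[e fK eK]; exists e; exists f.
Qed.

Definition lattice_enum : nat -> int * int := sval (cid lattice_enum_subproof).

Lemma lattice_enum_bij : bijective lattice_enum.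
Proof. exact: (svalP (cid lattice_enum_subproof)). Qed.

(* A signed sum over Z^2 is an integral for the counting measure of nat, so that
   the theorems on integrals depending on a parameter apply to it. *)
Definition lsum f : R := (\int[counting]_(n in [set: nat]) f (lattice_enum n))%R.

Definition lnorm f : \bar R := (\esum_(k in [set: int * int]) `|f k|%:E)%E.

Definition lsummable f := (lnorm f < +oo)%E.

Lemma lnorm_ge0 f : (0 <= lnorm f)%E.
Proof. by apply: esum_ge0 => k _; rewrite lee_fin. Qed.

Lemma lnormE f :
  lnorm f = (\int[counting]_(n in [set: nat]) `|(f (lattice_enum n))%:E|)%E.
Proof.
rewrite ge0_integral_count// nneseries_esumT//.
rewrite /lnorm (reindex_esum [set: nat] _ lattice_enum)//.
by rewrite setTT_bijective; exact: lattice_enum_bij.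
Qed.

Lemma lsummableE f :
  lsummable f = counting.-integrable [set: nat] (EFin \o (f \o lattice_enum)) :> Prop.
Proof.
rewrite /lsummable lnormE; apply/propext; split=> [h|/integrableP[]//].
by apply/integrableP; split.
Qed.

Lemma fine_lnorm f : lsummable f -> (fine (lnorm f))%:E = lnorm f.
Proof. by move=> h; rewrite fineK// ge0_fin_numE// lnorm_ge0. Qed.

Lemma lsum_abs f : lsum (fun k => `|f k|) = fine (lnorm f).
Proof. by rewrite lnormE. Qed.

Lemma le_lnorm f g : (forall k, `|f k| <= `|g k|) -> (lnorm f <= lnorm g)%E.
Proof. by move=> fg; apply: le_esum => k _; rewrite lee_fin. Qed.

Lemma le_lsummable f g : (forall k, `|f k| <= `|g k|) -> lsummable g -> lsummable f.
Proof. by move=> /le_lnorm; exact: le_lt_trans. Qed.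

Lemma lsummable_le f g : (forall k, `|f k| <= g k) -> lsummable g -> lsummable f.
Proof. by move=> fg; apply: le_lsummable => k; rewrite (le_trans (fg k))// ler_norm. Qed.

Lemma lsummableD f g : lsummable f -> lsummable g -> lsummable (fun k => f k + g k).
Proof.
by rewrite !lsummableE => hf hg; exact: (integrableD _ hf hg).
Qed.

Lemma lsummableZ c f : lsummable f -> lsummable (fun k => c * f k).
Proof.
by rewrite !lsummableE => hf; exact: (integrableZl _ c hf).
Qed.

Lemma lsummable_abs f : lsummable f -> lsummable (fun k => `|f k|).
Proof. by apply: le_lsummable => k; rewrite normr_id. Qed.

Lemma lsummableN f : lsummable f -> lsummable (fun k => - f k).
Proof. by apply: le_lsummable => k; rewrite normrN. Qed.

Lemma lsummableB f g : lsummable f -> lsummable g -> lsummable (fun k => f k - g k).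
Proof. by move=> hf hg; apply: lsummableD => //; exact: lsummableN. Qed.

Lemma lsumD f g : lsummable f -> lsummable g ->
  lsum (fun k => f k + g k) = lsum f + lsum g.
Proof. by rewrite !lsummableE => hf hg; rewrite /lsum RintegralD. Qed.

Lemma lsumB f g : lsummable f -> lsummable g ->
  lsum (fun k => f k - g k) = lsum f - lsum g.
Proof. by rewrite !lsummableE => hf hg; rewrite /lsum RintegralB. Qed.

Lemma lsumZ c f : lsummable f -> lsum (fun k => c * f k) = c * lsum f.
Proof. by rewrite !lsummableE => hf; rewrite /lsum RintegralZl. Qed.

Lemma le_lsum f g : lsummable f -> lsummable g -> (forall k, f k <= g k) ->
  lsum f <= lsum g.
Proof. by rewrite !lsummableE => hf hg fg; apply: le_Rintegral => // n _; exact: fg. Qed.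

Lemma eq_lsum f g : f =1 g -> lsum f = lsum g.
Proof. by move=> fg; congr lsum; exact/funext. Qed.

Lemma lsum_ge0 f : (forall k, 0 <= f k) -> 0 <= lsum f.
Proof. by move=> f0; apply: Rintegral_ge0 => n _; exact: f0. Qed.

Lemma normr_lsum f : lsummable f -> `|lsum f| <= lsum (fun k => `|f k|).
Proof. by rewrite lsummableE => hf; exact: le_normr_Rintegral. Qed.

Lemma normr_lsum_le f g : lsummable g -> (forall k, `|f k| <= g k) ->
  `|lsum f| <= lsum g.
Proof.
move=> sg fg; have sf := lsummable_le fg sg.
by rewrite (le_trans (normr_lsum sf))// le_lsum//; exact: lsummable_abs.
Qed.

Lemma ge0_lsum_cvg f : (forall k, 0 <= f k) -> lsummable f ->
  (fun N => \sum_(0 <= n < N) f (lattice_enum n)) @ \oo --> lsum f.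
Proof.
move=> f0 sf; have sf' : summable [set: nat] (EFin \o (f \o lattice_enum)).
  by move: sf; rewrite /lsummable lnormE ge0_integral_count// nneseries_esumT.
have sfT : summable xpredT (EFin \o (f \o lattice_enum)).
  by rewrite /summable (_ : (fun _ => _) = setT)//; apply/seteqP; split.
have f0' i : xpredT i -> (0 <= (EFin \o (f \o lattice_enum)) i)%E.
  by move=> _; rewrite lee_fin; exact: f0.
have cv := summable_cvg f0' sfT.
have E := summable_nneseries_lim f0' sfT.
have <- : lim ((fun N => \sum_(0 <= n < N) f (lattice_enum n)) @ \oo) = lsum f.
  rewrite /lsum /Rintegral ge0_integral_count; first exact: (esym (congr1 fine E)).
  by move=> k; rewrite lee_fin; exact: f0.
exact: cv.
Qed.

(** The decomposition f = (f + |f|) - |f| reduces the claim to nonnegative terms, where partial sums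
    of the enumeration are monotone. *)
Lemma lsum_cvg f : lsummable f ->
  (fun N => \sum_(0 <= n < N) f (lattice_enum n)) @ \oo --> lsum f.
Proof.
move=> sf; have sa := lsummable_abs sf; have sfa := lsummableD sf sa.
have -> : lsum f = lsum (fun k => f k + `|f k|) - lsum (fun k => `|f k|).
  by rewrite lsumD// addrK.
rewrite (_ : (fun N => _) = (fun N => \sum_(0 <= n < N) (f (lattice_enum n) +
    `|f (lattice_enum n)|) - \sum_(0 <= n < N) `|f (lattice_enum n)|)); last first.
  by apply/funext => N; rewrite big_split/= addrK.
apply: cvgB; apply: (@ge0_lsum_cvg (fun k => _)) => // k.
by have := ler_norm (- f k); rewrite normrN; lra.
Qed.


(** Differentiation under the integral sign for the counting measure. A single summable majorant of
    the derivatives, valid on an open interval around the point, is what the later series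
    provide. *)
Lemma lsum_is_derive (F dF : R -> int * int -> R) (g : int * int -> R) (a u v : R) :
  u < a < v -> (forall x, u < x < v -> lsummable (F x)) ->
  (forall x k, u < x < v -> is_derive x 1 (F ^~ k) (dF x k)) ->
  lsummable g -> (forall x k, u < x < v -> `|dF x k| <= g k) ->
  is_derive a 1 (fun x => lsum (F x)) (lsum (dF a)).
Proof.
move=> uav sF dFE sg dFg.
have Iuv x : `]u, v[%classic x <-> u < x < v by rewrite /= in_itv.
pose G n := g (lattice_enum n); pose f x n := F x (lattice_enum n).
have Ia : `]u, v[%classic a by apply/Iuv.
have intf x : `]u, v[%classic x -> counting.-integrable [set: nat] (EFin \o f x).
  by move=> /Iuv/sF; rewrite lsummableE.
have df x n : `]u, v[%classic x -> [set: nat] n -> derivable (f ^~ n) x 1.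
  by move=> /Iuv xuv _; have [] := dFE _ (lattice_enum n) xuv.
have dfE x n : `]u, v[%classic x -> partial1of2 f x n = dF x (lattice_enum n).
  by move=> /Iuv xuv; rewrite partial1of2E; have [_] := dFE _ (lattice_enum n) xuv.
have G0 n : 0 <= G n by rewrite (le_trans _ (dFg a _ uav)).
have iG : counting.-integrable [set: nat] (EFin \o G) by move: sg; rewrite lsummableE.
have dfG x n : `]u, v[%classic x -> [set: nat] n -> `|partial1of2 f x n| <= G n.
  by move=> xuv _; rewrite dfE//; apply: dFg; exact/Iuv.
apply: DeriveDef.
  exact: (derivable_under_integral measurableT Ia intf df G0 iG dfG).
rewrite -derive1E.
rewrite (differentiation_under_integral measurableT Ia intf df G0 iG dfG).
by apply: eq_Rintegral => n _; exact: dfE.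
Qed.

Lemma lsum_continuous (F : R -> int * int -> R) (g : int * int -> R) (a u v : R) :
  u < a < v -> (forall x k, u < x < v -> `|F x k| <= g k) -> lsummable g ->
  (forall x k, u < x < v -> {for x, continuous (F ^~ k)}) ->
  {for a, continuous (fun x => lsum (F x))}.
Proof.
move=> uav Fg sg cF.
have Iuv x : `]u, v[%classic x <-> u < x < v by rewrite /= in_itv.
pose G n := g (lattice_enum n); pose f x n := F x (lattice_enum n).
have intf x : `]u, v[%classic x -> counting.-integrable [set: nat] (EFin \o f x).
  move=> /Iuv xuv; have : lsummable (F x) by apply: lsummable_le sg => k; exact: Fg.
  by rewrite lsummableE.
have iG : counting.-integrable [set: nat] (EFin \o G) by move: sg; rewrite lsummableE.
apply: (@continuity_under_integral _ _ _ counting f _ measurableT u v intf _ G iG).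
- by apply: aeW => n _ x /set_mem /Iuv xuv; exact: cF.
- by move=> x /Iuv xuv; apply: aeW => n _; exact: Fg.
- by apply/mem_set/Iuv.
Qed.

End LatticeSum.

Notation lebesgue2 R := (@lebesgue_measure R \x @lebesgue_measure R)%E.

Section CellIntegral.
Context (R : realType).
Implicit Types (f g : R * R -> R).
Local Notation leb2 := (lebesgue2 R).
Local Notation cell := (@cell R).

Definition cint f : R := (\int[leb2]_(z in cell) f z)%R.
Definition cintegrable f := leb2.-integrable cell (EFin \o f).

Lemma measurable_cell : measurable (cell : set (measurableTypeR R * measurableTypeR R)).
Proof. by apply: measurableX; exact: measurable_itv. Qed.

Lemma cell_measure : leb2 cell = ((pi *+ 2) ^+ 2)%:E.
Proof.
rewrite /cell product_measure1E//= lebesgue_measure_itv/= lte_fin gtrN ?pi_gt0//.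
by rewrite -EFinB -EFinM opprK expr2 mulr2n.
Qed.

Lemma cell_measure_lty : (leb2 cell < +oo)%E.
Proof. by rewrite cell_measure ltry. Qed.

(** Measurability refers to the product sigma-algebra, not to the Borel sets of the plane; an open
    set is a countable union of boxes with rational corners. *)
Lemma open_measurable2 (U : set (R * R)) :
  open U -> measurable (U : set (measurableTypeR R * measurableTypeR R)).
Proof.
move=> oU.
pose box (q : (rat * rat) * (rat * rat)) : set (R * R) :=
  `]ratr q.1.1, ratr q.1.2[ `*` `]ratr q.2.1, ratr q.2.2[.
have -> : U = \bigcup_(q in [set q | box q `<=` U]) box q.
  apply/seteqP; split=> [z Uz|z [q] /= + ]; last exact.
  have : nbhs z U by apply: open_nbhs_nbhs; split.
  move=> [[A B] /= [+ + ABU]].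
  move=> /nbhs_ballP[e1 /= e10 Ae] /nbhs_ballP[e2 /= e20 Be].
  have inb (x e : R) : 0 < e -> exists q : rat * rat,
      x - e < ratr q.1 < x /\ x < ratr q.2 < x + e.
    move=> e0; have [p1] := @rat_in_itvoo R (x - e) x ltac:(by rewrite ltrBlDr ltrDl).
    have [p2] := @rat_in_itvoo R x (x + e) ltac:(by rewrite ltrDl).
    by rewrite !in_itv /= => h1 h2; exists (p1, p2).
  have [q1 [/andP[q1a q1b] /andP[q1c q1d]]] := inb z.1 _ e10.
  have [q2 [/andP[q2a q2b] /andP[q2c q2d]]] := inb z.2 _ e20.
  exists (q1, q2); last by split; rewrite /= in_itv/= ?q1b ?q2b.
  move=> y [/=]; rewrite !in_itv/= => /andP[y1 y2] /andP[y3 y4].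
  apply: ABU; split => /=; [apply: Ae|apply: Be]; rewrite /ball/= ltr_norml; lra.
rewrite bigcup_mkcond; apply: countable_bigcupT_measurable => [|q].
  exact: countableP.
by case: ifP => // _; apply: measurableX; exact: measurable_itv.
Qed.

Lemma continuous_measurable2 f :
  continuous f -> measurable_fun [set: measurableTypeR R * measurableTypeR R] f.
Proof.
move=> cf; apply: (measurability _ (RGenOpens.measurableE R)).
move=> _ [_ [a [b ->] <-]]; rewrite setTI; apply: open_measurable2.
by move/continuousP : cf; apply; exact: interval_open.
Qed.

Lemma bounded_cintegrable f M :
  measurable_fun (cell : set (measurableTypeR R * measurableTypeR R)) f ->
  (forall z, cell z -> `|f z| <= M) -> cintegrable f.
Proof.
move=> mf fM; apply: measurable_bounded_integrable => //.
- exact: measurable_cell.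
- exact: cell_measure_lty.
- exists M; split; first exact: num_real.
  by move=> x Mx z cz; exact: le_trans (fM z cz) (ltW Mx).
Qed.

Lemma compact_cell : compact cell.
Proof. by apply: compact_setX; exact: segment_compact. Qed.

Lemma continuous_cell_bounded f : continuous f ->
  exists M, forall z, cell z -> `|f z| <= M.
Proof.
move=> cf; have /compact_bounded[M [_ fM]] :=
  continuous_compact (continuous_subspaceT cf) compact_cell.
exists (M + 1) => z cz; apply: (fM (M + 1)); first by rewrite ltrDl.
by exists z.
Qed.

Lemma continuous_cintegrable f : continuous f -> cintegrable f.
Proof.
move=> cf; have [M fM] := continuous_cell_bounded cf.
by apply: bounded_cintegrable fM; apply: measurable_funTS; exact: continuous_measurable2.
Qed.

Lemma cintD f g : cintegrable f -> cintegrable g ->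
  cint (fun z => f z + g z) = cint f + cint g.
Proof. by move=> hf hg; rewrite /cint RintegralD//; exact: measurable_cell. Qed.

Lemma cintB f g : cintegrable f -> cintegrable g ->
  cint (fun z => f z - g z) = cint f - cint g.
Proof. by move=> hf hg; rewrite /cint RintegralB//; exact: measurable_cell. Qed.

Lemma cintZ c f : cintegrable f -> cint (fun z => c * f z) = c * cint f.
Proof. by move=> hf; rewrite /cint RintegralZl//; exact: measurable_cell. Qed.

Lemma cintegrableD f g : cintegrable f -> cintegrable g -> cintegrable (fun z => f z + g z).
Proof. by move=> hf hg; apply: integrableD hf hg; exact: measurable_cell. Qed.

Lemma cintegrableB f g : cintegrable f -> cintegrable g -> cintegrable (fun z => f z - g z).
Proof. by move=> hf hg; apply: integrableB hf hg; exact: measurable_cell. Qed.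

Lemma cintegrableZ c f : cintegrable f -> cintegrable (fun z => c * f z).
Proof. by move=> hf; apply: (integrableZl _ c hf); exact: measurable_cell. Qed.

Lemma eq_cint f g : (forall z, cell z -> f z = g z) -> cint f = cint g.
Proof. by move=> fg; apply: eq_Rintegral => z /set_mem /fg. Qed.

Lemma le_cint f g : cintegrable f -> cintegrable g -> (forall z, cell z -> f z <= g z) ->
  cint f <= cint g.
Proof. by move=> hf hg fg; apply: le_Rintegral => //; exact: measurable_cell. Qed.

Lemma normr_cint f : cintegrable f -> `|cint f| <= cint (fun z => `|f z|).
Proof. by move=> hf; apply: le_normr_Rintegral => //; exact: measurable_cell. Qed.

Lemma cint_cst (c : R) : cint (fun=> c) = c * (pi *+ 2) ^+ 2.
Proof.
rewrite /cint (Rintegral_cst _ measurable_cell); congr (_ * _).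
exact: (congr1 fine cell_measure).
Qed.

Lemma is_derive_e1 f z l : is_derive z (e1 R) f l ->
  is_derive z.1 1 (fun x => f (x, z.2)) l.
Proof.
case: z => a b /=.
have E h : f (h *: e1 R + (a, b)) = f (h *: 1 + a, b).
  by congr f; congr pair; rewrite /= ?mulr0 ?add0r// /GRing.scale/= mulr0 add0r.
have EF : (fun h => h^-1 *: (f (h *: e1 R + (a, b)) - f (a, b))) =
    (fun h => h^-1 *: ((fun x => f (x, b)) (h *: 1 + a) - f (a, b))).
  by apply/funext => h; rewrite E.
move=> [h1 h2]; split.
  by move: h1; rewrite /derivable EF.
by rewrite -h2 /derive EF.
Qed.

Lemma is_derive_e2 f z l : is_derive z (e2 R) f l ->
  is_derive z.2 1 (fun y => f (z.1, y)) l.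
Proof.
case: z => a b /=.
have E h : f (h *: e2 R + (a, b)) = f (a, h *: 1 + b).
  by congr f; congr pair; rewrite /= ?mulr0 ?add0r// /GRing.scale/= mulr0 add0r.
have EF : (fun h => h^-1 *: (f (h *: e2 R + (a, b)) - f (a, b))) =
    (fun h => h^-1 *: ((fun y => f (a, y)) (h *: 1 + b) - f (a, b))).
  by apply/funext => h; rewrite E.
move=> [h1 h2]; split.
  by move: h1; rewrite /derivable EF.
by rewrite -h2 /derive EF.
Qed.

(** By the fundamental theorem of calculus the integral is F(pi) - F(-pi), and these values agree by
    periodicity. *)
Lemma itv_pi_period (F f : R -> R) : (forall x : R, is_derive x 1 F (f x)) -> continuous f ->
  (forall x, F (x + pi *+ 2) = F x) ->
  (\int[@lebesgue_measure R]_(x in `[(- pi)%R, pi]) (f x)%:E = 0)%E.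
Proof.
move=> dF cf perF.
have cF : continuous F.
  by move=> x; apply: differentiable_continuous; apply/derivable1_diffP; have [] := dF x.
rewrite (@continuous_FTC2 _ f F).
- have -> : F pi = F (- pi) by rewrite -(perF (- pi)); congr F; rewrite mulr2n addKr.
  by rewrite subee.
- by have := pi_gt0 R; lra.
- exact: continuous_subspaceT.
- split.
  + by move=> x _; have [] := dF x.
  + exact/cvg_at_right_filter/cF.
  + exact/cvg_at_left_filter/cF.
- by move=> x _; rewrite derive1E; have [] := dF x.
Qed.

Lemma pair_continuous1 (b : R) : continuous (fun x : R => (x, b)).
Proof. by move=> x; apply: (@cvg_pair _ _ _ _ (nbhs x) (nbhs b)); [exact: cvg_id|exact: cvg_cst]. Qed.

Lemma pair_continuous2 (a : R) : continuous (fun y : R => (a, y)).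
Proof. by move=> x; apply: (@cvg_pair _ _ _ _ (nbhs a) (nbhs x)); [exact: cvg_cst|exact: cvg_id]. Qed.

Lemma cint_fubini1 f : cintegrable f ->
  (forall y, `[(- pi)%R, pi]%classic y ->
    (\int[@lebesgue_measure R]_(x in `[(- pi)%R, pi]) (f (x, y))%:E = 0)%E) ->
  cint f = 0.
Proof.
move=> hf h0; rewrite /cint Rintegral_mkcond /Rintegral.
have mf : leb2.-integrable setT (EFin \o (f \_ cell)).
  by rewrite -restrict_EFin; exact: (iffLR (integrable_mkcond _ measurable_cell) hf).
rewrite -integral21_prod_meas1//.
rewrite integral0_eq// => y _; rewrite /fubini_G.
case: (pselect (`[(- pi)%R, pi]%classic y)) => [yI|yI].
  rewrite -[RHS](h0 y yI) [RHS]integral_mkcond; apply: eq_integral => x _.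
  rewrite /= !patchE /cell; case: ifPn => xI; case: ifPn => xJ //; exfalso.
    by move: xI xJ => /set_mem[/= xI _]; rewrite mem_set.
  by move: xJ xI => /set_mem /= xJ; rewrite mem_set.
rewrite integral0_eq// => x _; rewrite /= patchE; case: ifPn => // /set_mem[_ /= yJ].
by case: yI.
Qed.

Lemma cint_fubini2 f : cintegrable f ->
  (forall x, `[(- pi)%R, pi]%classic x ->
    (\int[@lebesgue_measure R]_(y in `[(- pi)%R, pi]) (f (x, y))%:E = 0)%E) ->
  cint f = 0.
Proof.
move=> hf h0; rewrite /cint Rintegral_mkcond /Rintegral.
have mf : leb2.-integrable setT (EFin \o (f \_ cell)).
  by rewrite -restrict_EFin; exact: (iffLR (integrable_mkcond _ measurable_cell) hf).
rewrite -integral12_prod_meas1//.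
rewrite integral0_eq// => x _; rewrite /fubini_F.
case: (pselect (`[(- pi)%R, pi]%classic x)) => [xI|xI].
  rewrite -[RHS](h0 x xI) [RHS]integral_mkcond; apply: eq_integral => y _.
  rewrite /= !patchE /cell; case: ifPn => yI; case: ifPn => yJ //; exfalso.
    by move: yI yJ => /set_mem[/= _ yI]; rewrite mem_set.
  by move: yJ yI => /set_mem /= yJ; rewrite mem_set.
rewrite integral0_eq// => y _; rewrite /= patchE; case: ifPn => // /set_mem[/= xJ _].
by case: xI.
Qed.

(** Fubini reduces the integral to the one-dimensional case on each horizontal line. With [cint_D2]
    this is the divergence theorem on the torus, and every integration by parts below is an instance
    of it. *)
Lemma cint_D1 f f1 : (forall z, is_derive z (e1 R) f (f1 z)) -> continuous f1 ->
  periodic2 f -> cint f1 = 0.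
Proof.
move=> df cf1 pf; apply: cint_fubini1 => [|y _]; first exact: continuous_cintegrable.
apply: (@itv_pi_period (fun x => f (x, y))) => [x|x|x].
- exact: (is_derive_e1 (df (x, y))).
- by apply: continuous_comp; [exact: pair_continuous1|exact: cf1].
- exact: (pf x y).1.
Qed.

Lemma cint_D2 f f2 : (forall z, is_derive z (e2 R) f (f2 z)) -> continuous f2 ->
  periodic2 f -> cint f2 = 0.
Proof.
move=> df cf2 pf; apply: cint_fubini2 => [|x _]; first exact: continuous_cintegrable.
apply: (@itv_pi_period (fun y => f (x, y))) => [y|y|y].
- exact: (is_derive_e2 (df (x, y))).
- by apply: continuous_comp; [exact: pair_continuous2|exact: cf2].
- exact: (pf x y).2.
Qed.

Lemma ae_impl (P Q : R * R -> Prop) : (forall z, P z -> Q z) ->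
  {ae leb2, forall z, P z} -> {ae leb2, forall z, Q z}.
Proof.
move=> PQ; have F := @ae_filter_ringOfSetsType _ _ R
  (leb2 : {measure set (measurableTypeR R * measurableTypeR R)%type -> \bar R}).
by apply: (@filterS _ _ F); exact: PQ.
Qed.

Lemma ae_cell_eq f g : {ae leb2, forall z, cell z -> f z = g z} ->
  measurable_fun (cell : set (measurableTypeR R * measurableTypeR R)) f ->
  measurable_fun (cell : set (measurableTypeR R * measurableTypeR R)) g ->
  cint f = cint g.
Proof.
move=> fg mf mg; rewrite /cint /Rintegral; congr fine.
apply: ae_eq_integral; first exact: measurable_cell.
- exact/measurable_EFinP.
- exact/measurable_EFinP.
by apply: ae_impl fg => z + cz => /(_ cz) ->.
Qed.

Lemma cint_cvg (f_ : nat -> R * R -> R) (f g : R * R -> R) :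
  (forall n, cintegrable (f_ n)) ->
  (forall z, cell z -> f_ ^~ z @ \oo --> f z) -> cintegrable g ->
  (forall n z, cell z -> `|f_ n z| <= g z) ->
  cintegrable f /\ cint (f_ n) @[n --> \oo] --> cint f.
Proof.
move=> if_ ff ig fg.
have mf_ n : measurable_fun (cell : set (measurableTypeR R * measurableTypeR R))
    (fun z => (f_ n z)%:E).
  by have /integrableP[] := if_ n.
have ff' : forall z, cell z -> (fun n => (f_ n z)%:E) @ \oo --> (f z)%:E.
  move=> z cz; apply: cvg_EFin; first exact: nearW.
  exact: ff.
have iff : cintegrable f.
  apply/integrableP; split; first exact: (emeasurable_fun_cvg _ _ mf_ ff').
  case/integrableP : (ig) => _; apply: le_lt_trans.
  have fgz z : cell z -> `|f z| <= g z.
    move=> cz; have cf : `|f_ n z| @[n --> \oo] --> `|f z| by apply: cvg_norm; exact: ff.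
    rewrite -(cvg_lim _ cf)//; apply: limr_le; first by apply/cvg_ex; exists `|f z|.
    by apply: nearW => n; exact: fg.
  apply: ge0_le_integral; first exact: measurable_cell.
  - by [].
  - by apply: measurableT_comp => //; exact: (emeasurable_fun_cvg _ _ mf_ ff').
  - by apply: measurableT_comp => //; case/integrableP : ig.
  - by move=> z cz /=; rewrite lee_fin (le_trans (fgz z cz))// ler_norm.
split=> //; apply: fine_cvg; rewrite /cint /Rintegral fineK; last first.
  by apply: integrable_fin_num => //; exact: measurable_cell.
apply: (@dominated_cvg _ _ _ _ _ measurable_cell (fun n z => (f_ n z)%:E)
  (fun z => (f z)%:E) (fun z => (g z)%:E)) => //.
Qed.

Lemma ge0_partial_lsum (f : int * int -> R) N : (forall k, 0 <= f k) -> lsummable f ->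
  \sum_(0 <= n < N) f (lattice_enum n) <= lsum f.
Proof.
move=> f0 sf; have cf := lsum_cvg sf; rewrite -(cvg_lim _ cf)//.
apply: nondecreasing_cvgn_le; first by apply: nondecreasing_series => n _ _; exact: f0.
by apply/cvg_ex; exists (lsum f).
Qed.

(* Termwise integration of a series dominated by a summable sequence times a
   fixed integrable function. *)
Lemma cint_lsum (F : int * int -> R * R -> R) (M : int * int -> R) (h : R * R -> R) :
  (forall k, cintegrable (F k)) -> cintegrable h -> lsummable M ->
  (forall k z, cell z -> `|F k z| <= M k * `|h z|) ->
  cint (fun z => lsum (F ^~ z)) = lsum (fun k => cint (F k)).
Proof.
move=> iF ih sM FM.
have sF z : cell z -> lsummable (F ^~ z).
  move=> cz; apply: (@lsummable_le _ _ (fun k => `|h z| * M k)); last exact: lsummableZ.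
  by move=> k; rewrite mulrC FM.
pose P N z := \sum_(0 <= n < N) F (lattice_enum n) z.
have iP N : cintegrable (P N).
  elim: N => [|N IH].
    rewrite /P (_ : (fun z => _) = cst 0); last by apply/funext=> z; rewrite big_nil.
    by apply: continuous_cintegrable => z; exact: cvg_cst.
  rewrite (_ : P N.+1 = fun z => P N z + F (lattice_enum N) z).
    exact: cintegrableD.
  by apply/funext => z; rewrite /P big_nat_recr.
have cP N : cint (P N) = \sum_(0 <= n < N) cint (F (lattice_enum n)).
  elim: N => [|N IH].
    rewrite big_nil -(mul0r ((pi *+ 2) ^+ 2)) -cint_cst; apply: eq_cint => z _.
    by rewrite /P big_nil.
  rewrite big_nat_recr//= -IH -cintD//; apply: eq_cint => z _.
  by rewrite /P big_nat_recr.
have sI : lsummable (fun k => cint (F k)).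
  apply: (@lsummable_le _ _ (fun k => cint (fun z => `|h z|) * M k)).
    move=> k; rewrite (le_trans (normr_cint (iF k)))// mulrC -cintZ; last first.
      exact: (integrable_norm ih).
    apply: le_cint; [exact: (integrable_norm (iF k))| |exact: FM].
    by apply: cintegrableZ; exact: (integrable_norm ih).
  exact: lsummableZ.
have L1 : cint (P N) @[N --> \oo] --> lsum (fun k => cint (F k)).
  rewrite (_ : (fun N => _) = (fun N => \sum_(0 <= n < N) cint (F (lattice_enum n)))).
    exact: (@lsum_cvg _ (fun k => cint (F k))).
  by apply/funext => N; exact: cP.
suff L2 : cint (P N) @[N --> \oo] --> cint (fun z => lsum (F ^~ z)).
  exact: (cvg_unique _ L2 L1).
pose S := lsum (fun k => `|M k|).
have PS N z : cell z -> `|P N z| <= S * `|h z|.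
  move=> cz; rewrite (le_trans (ler_norm_sum _ _ _))//.
  rewrite (@le_trans _ _ (\sum_(0 <= n < N) `|M (lattice_enum n)| * `|h z|))//.
    by apply: ler_sum => n _; rewrite (le_trans (FM _ _ cz))// ler_wpM2r// ler_norm.
  rewrite -mulr_suml ler_wpM2r//.
  by apply: (@ge0_partial_lsum (fun k => `|M k|)) => //; exact: lsummable_abs.
have hg : cintegrable (fun z => S * `|h z|).
  by apply: cintegrableZ; exact: (integrable_norm ih).
have cPz z : cell z -> P ^~ z @ \oo --> lsum (F ^~ z).
  by move=> cz; exact: (lsum_cvg (sF z cz)).
exact: (cint_cvg iP cPz hg PS).2.
Qed.

End CellIntegral.

(** * Trigonometric series *)

Section Synthesis.
Context (R : realType).
Implicit Types (a b : int * int -> R) (z : R * R).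

Definition weight (k : int * int) : R := 1 + sqnorm R k.

Lemma weightE k : weight k = 1 + sqnorm R k. Proof. by []. Qed.

Definition wsummable p a := lsummable (fun k => weight k ^+ p * a k).

(** The sum runs over the whole lattice, so k and -k both contribute. For even [a] and odd [b] the
    two terms are equal, which supplies the usual factor 2 of real Fourier series; the coefficients
    can then be taken with the same normalization at k = 0 as elsewhere. *)
Definition synth a b z : R :=
  lsum (fun k => a k * cos (dotk k z) + b k * sin (dotk k z)).

Lemma sqnorm_ge0 k : 0 <= sqnorm R k.
Proof. by rewrite addr_ge0// sqr_ge0. Qed.

Lemma weight_ge1 k : 1 <= weight k.
Proof. by rewrite lerDl sqnorm_ge0. Qed.

Lemma weight_gt0 k : 0 < weight k.
Proof. by rewrite (lt_le_trans _ (weight_ge1 k)). Qed.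

Lemma normr_fst_le_weight k : `|k.1%:~R| <= weight k :> R.
Proof.
rewrite /weight /sqnorm; set x := k.1%:~R; set y := k.2%:~R.
have := sqr_ge0 (x - 1); have := sqr_ge0 (x + 1); have := sqr_ge0 y.
by have [] := ler0P x; nra.
Qed.

Lemma normr_snd_le_weight k : `|k.2%:~R| <= weight k :> R.
Proof.
rewrite /weight /sqnorm; set x := k.1%:~R; set y := k.2%:~R.
have := sqr_ge0 (y - 1); have := sqr_ge0 (y + 1); have := sqr_ge0 x.
by have [] := ler0P y; nra.
Qed.

Lemma wsummable_dom p q (m : int * int -> R) a :
  (forall k, weight k ^+ p * `|m k| <= weight k ^+ q) -> wsummable q a ->
  wsummable p (fun k => m k * a k).
Proof.
move=> mq; apply: le_lsummable => k; rewrite !normrM !normrX.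
by rewrite (gtr0_norm (weight_gt0 k)) mulrA ler_wpM2r.
Qed.

Lemma wsummableW p q a : (p <= q)%N -> wsummable q a -> wsummable p a.
Proof.
move=> pq; apply: le_lsummable => k; rewrite !normrM !normrX.
by rewrite (gtr0_norm (weight_gt0 k)) ler_wpM2r// ler_weXn2l// weight_ge1.
Qed.

Lemma wsummable0 a : wsummable 0 a -> lsummable a.
Proof. by apply: le_lsummable => k; rewrite expr0 mul1r. Qed.

Lemma wsummable_lsummable p a : wsummable p a -> lsummable a.
Proof. by move=> h; apply: wsummable0; exact: wsummableW h. Qed.

Lemma wsummableD p a b : wsummable p a -> wsummable p b -> wsummable p (fun k => a k + b k).
Proof.
move=> ha hb; apply: (le_lsummable _ (lsummableD ha hb)) => k.
by rewrite mulrDr.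
Qed.

Lemma synth_term_le a b z k :
  `|a k * cos (dotk k z) + b k * sin (dotk k z)| <= `|a k| + `|b k|.
Proof.
rewrite (le_trans (ler_normD _ _))// !normrM lerD//.
  by rewrite ler_piMr// cos_max.
by rewrite ler_piMr// sin_max.
Qed.

Lemma synth_summable a b z : lsummable a -> lsummable b ->
  lsummable (fun k => a k * cos (dotk k z) + b k * sin (dotk k z)).
Proof.
move=> sa sb; apply: (lsummable_le (synth_term_le a b z)).
by apply: lsummableD; exact: lsummable_abs.
Qed.

Lemma normr_synth_le a b (g : int * int -> R) z :
  (forall k, `|a k| + `|b k| <= g k) -> lsummable g -> `|synth a b z| <= lsum g.
Proof.
move=> abg sg; apply: normr_lsum_le => // k.
by rewrite (le_trans (synth_term_le a b z k)).
Qed.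

Lemma synthB a b a' b' z : lsummable a -> lsummable b -> lsummable a' -> lsummable b' ->
  synth a b z - synth a' b' z = synth (fun k => a k - a' k) (fun k => b k - b' k) z.
Proof.
move=> sa sb sa' sb'; rewrite /synth -lsumB; [|exact: synth_summable..].
by apply: eq_lsum => k; ring.
Qed.

Lemma cosDint (x : R) (m : int) : cos (x + (pi *+ 2) * m%:~R) = cos x.
Proof.
case: m => n; first by rewrite -pmulrn mulr_natr (periodicn (@cosD2pi R)).
rewrite NegzE mulrNz -pmulrn mulrN mulr_natr.
by rewrite -[in RHS](subrK ((pi *+ 2) *+ n.+1) x) (periodicn (@cosD2pi R)).
Qed.

Lemma sinDint (x : R) (m : int) : sin (x + (pi *+ 2) * m%:~R) = sin x.
Proof.
case: m => n; first by rewrite -pmulrn mulr_natr (periodicn (@sinD2pi R)).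
rewrite NegzE mulrNz -pmulrn mulrN mulr_natr.
by rewrite -[in RHS](subrK ((pi *+ 2) *+ n.+1) x) (periodicn (@sinD2pi R)).
Qed.

Lemma dotk_period1 k x y : dotk k (x + pi *+ 2, y) = dotk k (x, y) + (pi *+ 2) * k.1%:~R :> R.
Proof. by rewrite /dotk/=; ring. Qed.

Lemma dotk_period2 k x y : dotk k (x, y + pi *+ 2) = dotk k (x, y) + (pi *+ 2) * k.2%:~R :> R.
Proof. by rewrite /dotk/=; ring. Qed.

Lemma synth_periodic a b : periodic2 (synth a b).
Proof.
move=> x y; split; apply: eq_lsum => k.
  by rewrite dotk_period1 cosDint sinDint.
by rewrite dotk_period2 cosDint sinDint.
Qed.

Lemma is_derive_line (f : R * R -> R) z v l :
  is_derive (0 : R) 1 (fun h => f (h *: v + z)) l -> is_derive z v f l.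
Proof.
have E : (fun h : R => h^-1 *: (f (h *: v + z) - f z)) =
    (fun h => h^-1 *: ((fun h => f (h *: v + z)) (h *: 1 + 0) - f (0 *: v + z))).
  by apply/funext => h; rewrite scale0r add0r addr0 [h *: 1]mulr1.
move=> [h1 h2]; split.
  by rewrite /derivable E.
by rewrite /derive E.
Qed.

Lemma is_derive_trig (p q m c x : R) :
  is_derive x 1 (fun h => p * cos (h * m + c) + q * sin (h * m + c))
    (m * q * cos (x * m + c) + (- (m * p)) * sin (x * m + c)).
Proof.
have d1 : is_derive x 1 (fun h : R => h * m + c) m.
  by apply: is_derive_eq; rewrite scaler0 add0r addr0 /GRing.scale/= mulr1.
have dc : is_derive x 1 (cos \o (fun h : R => h * m + c)) (- sin (x * m + c) * m).
  exact: is_derive1_comp.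
have ds : is_derive x 1 (sin \o (fun h : R => h * m + c)) (cos (x * m + c) * m).
  exact: is_derive1_comp.
have D : is_derive x 1 (p *: (cos \o (fun h : R => h * m + c)) +
   q *: (sin \o (fun h : R => h * m + c)))
   (p *: (- sin (x * m + c) * m) + q *: (cos (x * m + c) * m)).
  by apply: is_deriveD.
by refine (is_derive_eq D _); rewrite /GRing.scale/=; ring.
Qed.

(** On the line h -> h v + z each term is a trigonometric function of h times m k, so
    differentiation multiplies by m k and exchanges the cosine and sine families, with one change of
    sign. Summability of the new coefficients is the majorant for termwise differentiation. *)
Lemma synth_is_derive a b z v (m : int * int -> R) :
  (forall k h, dotk k (h *: v + z) = h * m k + dotk k z) ->
  lsummable a -> lsummable b ->
  lsummable (fun k => m k * a k) -> lsummable (fun k => m k * b k) ->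
  is_derive z v (synth a b) (synth (fun k => m k * b k) (fun k => - (m k * a k)) z).
Proof.
move=> dm sa sb sma smb; apply: is_derive_line.
have -> : (fun h : R => synth a b (h *: v + z)) = fun h => lsum (fun k =>
   a k * cos (h * m k + dotk k z) + b k * sin (h * m k + dotk k z)).
  by apply/funext => h; apply: eq_lsum => k; rewrite dm.
pose F h k := a k * cos (h * m k + dotk k z) + b k * sin (h * m k + dotk k z).
pose dF h k := m k * b k * cos (h * m k + dotk k z) +
  (- (m k * a k)) * sin (h * m k + dotk k z).
have -> : synth (fun k => m k * b k) (fun k => - (m k * a k)) z = lsum (dF 0).
  by apply: eq_lsum => k; rewrite /dF mul0r add0r.
have F_le h k p q : `|p * cos (h * m k + dotk k z) + q * sin (h * m k + dotk k z)| <=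
    `|p| + `|q|.
  rewrite (le_trans (ler_normD _ _))// !normrM lerD//.
    by rewrite ler_piMr// cos_max.
  by rewrite ler_piMr// sin_max.
apply: (@lsum_is_derive R F dF (fun k => `|m k * b k| + `|m k * a k|) 0 (-1) 1).
- lra.
- move=> h _; apply: (lsummable_le (fun k => F_le h k _ _)).
  by apply: lsummableD; exact: lsummable_abs.
- by move=> h k _; exact: is_derive_trig.
- by apply: lsummableD; exact: lsummable_abs.
- by move=> h k _; rewrite (le_trans (F_le _ _ _ _))// normrN.
Qed.

Lemma synth_is_derive1 a b z : lsummable a -> lsummable b ->
  lsummable (fun k => k.1%:~R * a k) -> lsummable (fun k => k.1%:~R * b k) ->
  is_derive z (e1 R) (synth a b)
    (synth (fun k => k.1%:~R * b k) (fun k => - (k.1%:~R * a k)) z).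
Proof.
apply: (@synth_is_derive a b z (e1 R) (fun k => k.1%:~R)) => k h.
by rewrite /dotk/= /GRing.scale/=; ring.
Qed.

Lemma synth_is_derive2 a b z : lsummable a -> lsummable b ->
  lsummable (fun k => k.2%:~R * a k) -> lsummable (fun k => k.2%:~R * b k) ->
  is_derive z (e2 R) (synth a b)
    (synth (fun k => k.2%:~R * b k) (fun k => - (k.2%:~R * a k)) z).
Proof.
apply: (@synth_is_derive a b z (e2 R) (fun k => k.2%:~R)) => k h.
by rewrite /dotk/= /GRing.scale/=; ring.
Qed.

Lemma cos_lipschitz (x y : R) : `|cos x - cos y| <= `|x - y|.
Proof.
wlog xy : x y / x <= y.
  by move=> h; have [/h//|/ltW/h] := leP x y; rewrite distrC (distrC y).
have dcos (t : R) : is_derive t 1 cos (- sin t) by exact: is_derive_cos.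
rewrite distrC (distrC x); have [t _ ->] := MVT_segment xy (fun t _ => dcos t)
  (continuous_subspaceT (@continuous_cos R)).
by rewrite normrM normrN ler_piMl// sin_max.
Qed.

Lemma sin_lipschitz (x y : R) : `|sin x - sin y| <= `|x - y|.
Proof.
rewrite -!cosBpihalf (le_trans (cos_lipschitz _ _))//.
by rewrite (_ : x - pi / 2 - (y - pi / 2) = x - y)//; ring.
Qed.

Lemma dotk_lipschitz k z z0 : `|dotk k z - dotk k z0| <= 2 * weight k * `|z - z0|.
Proof.
have n1 : `|z.1 - z0.1| <= `|z - z0| by rewrite prod_normE le_max lexx.
have n2 : `|z.2 - z0.2| <= `|z - z0| by rewrite prod_normE le_max lexx orbT.
have -> : dotk k z - dotk k z0 = k.1%:~R * (z.1 - z0.1) + k.2%:~R * (z.2 - z0.2).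
  by rewrite /dotk; ring.
rewrite (le_trans (ler_normD _ _))// !normrM.
rewrite (_ : 2 * _ * _ = weight k * `|z - z0| + weight k * `|z - z0|); last by ring.
apply: lerD; apply: ler_pM => //.
  exact: normr_fst_le_weight.
exact: normr_snd_le_weight.
Qed.

(* The modulus of continuity is dominated by an absolutely convergent series in
   one real parameter. *)
Lemma synth_continuous a b : lsummable a -> lsummable b -> continuous (synth a b).
Proof.
move=> sa sb z0.
pose g k : R := `|a k| + `|b k|.
have sg : lsummable g by apply: lsummableD; exact: lsummable_abs.
(* The Lipschitz bound makes each term vanish with r, but its coefficients [weight k * g k] need not
   be summable; the trivial bound 2 gives the summable majorant. *)
pose F (r : R) k : R := g k * Num.min 2 (2 * weight k * `|r|).
have g0 k : 0 <= g k by rewrite addr_ge0.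
have m0 (r : R) k : 0 <= Num.min 2 (2 * weight k * `|r|).
  by rewrite le_min ler0n mulr_ge0// mulr_ge0// ltW// weight_gt0.
have Fg r k : `|F r k| <= 2 * g k.
  by rewrite /F ger0_norm ?mulr_ge0// (mulrC 2 (g k)) ler_wpM2l// ge_min lexx.
have cF : {for (0 : R), continuous (fun r => lsum (F r))}.
  apply: (@lsum_continuous R F (fun k => 2 * g k) 0 (-1) 1); first by lra.
  - by move=> r k _; exact: Fg.
  - exact: lsummableZ.
  - move=> r k _; rewrite /F.
    apply: (@cvgM _ _ _ _ (fun=> g k)); first exact: cvg_cst.
    apply: (@continuous_min R R (fun=> 2) (fun x => 2 * weight k * `|x|) r).
      exact: cvg_cst.
    apply: (@cvgM _ _ _ _ (fun=> 2 * weight k)); first exact: cvg_cst.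
    exact: norm_continuous.
have F0 : lsum (F 0) = 0.
  rewrite (_ : F 0 = fun k => 0 * g k); last first.
    by apply/funext => k; rewrite /F normr0 mulr0 mul0r min_r ?mulr0// ler0n.
  by rewrite lsumZ// mul0r.
have le_F z : `|synth a b z0 - synth a b z| <= lsum (F `|z - z0|).
  rewrite /synth -lsumB; [|exact: synth_summable..].
  apply: normr_lsum_le => [|k].
    by apply: (lsummable_le (Fg _)); exact: lsummableZ.
  have trigle (t : R -> R) : (forall x, `|t x| <= 1) ->
      (forall x y, `|t x - t y| <= `|x - y|) ->
      `|t (dotk k z0) - t (dotk k z)| <= Num.min 2 (2 * weight k * Num.norm `|z - z0|).
    move=> t1 tl; rewrite le_min normr_id; apply/andP; split.
      by rewrite (le_trans (ler_normB _ _))// -[2](natrD _ 1 1) lerD.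
    by rewrite distrC (le_trans (tl _ _))// dotk_lipschitz.
  rewrite (_ : _ - _ = a k * (cos (dotk k z0) - cos (dotk k z)) +
     b k * (sin (dotk k z0) - sin (dotk k z))); last by ring.
  rewrite (le_trans (ler_normD _ _))// !normrM /F /g mulrDl lerD// ler_wpM2l//.
    by apply: trigle; [exact: cos_max|exact: cos_lipschitz].
  by apply: trigle; [exact: sin_max|exact: sin_lipschitz].
have cG : {for z0, continuous ((fun r => lsum (F r)) \o (fun z => `|z - z0|))}.
  apply: continuous_comp; last by rewrite subrr normr0; exact: cF.
  apply: (@continuous_comp _ _ _ (fun z => z - z0)); last exact: norm_continuous.
  by apply: cvgB; [exact: cvg_id|exact: cvg_cst].
apply/cvgrPdist_lt => e e0.
move/cvgrPdist_lt : cG => /(_ _ e0); apply: filterS => z /=.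
rewrite subrr normr0 F0 sub0r normrN; apply: le_lt_trans.
by rewrite (le_trans (le_F z))// ler_norm.
Qed.
End Synthesis.

(** * Fourier coefficients and orthogonality relations *)

Section FourierCoefficients.
Context (R : realType).
Implicit Types (f g : R * R -> R) (k l : int * int) (z : R * R).
Local Notation cell := (@cell R).
Local Notation RR := (measurableTypeR R * measurableTypeR R)%type.

(** [fcos f] and [- fsin f] are the real and imaginary parts of [fourier f]; working with the two
    real families keeps every series real. *)
Definition fcos f k : R := ((pi *+ 2) ^- 2) * cint (fun z => f z * cos (dotk k z)).
Definition fsin f k : R := ((pi *+ 2) ^- 2) * cint (fun z => f z * sin (dotk k z)).

Lemma dotkD k l z : dotk (k + l) z = dotk k z + dotk l z.
Proof. by rewrite /dotk /= !intrD; ring. Qed.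

Lemma dotkB k l z : dotk (k - l) z = dotk k z - dotk l z.
Proof. by rewrite /dotk /= !intrB; ring. Qed.

Lemma dotkN k z : dotk (- k) z = - dotk k z.
Proof. by rewrite /dotk /= !mulrNz; ring. Qed.

Lemma dotk0 z : dotk 0 z = 0.
Proof. by rewrite /dotk /= !mul0r addr0. Qed.

Lemma coscos (x y : R) : cos x * cos y = 2^-1 * (cos (x - y) + cos (x + y)).
Proof. by rewrite cosB cosD; field. Qed.

Lemma sinsin (x y : R) : sin x * sin y = 2^-1 * (cos (x - y) - cos (x + y)).
Proof. by rewrite cosB cosD; field. Qed.

Lemma sincos (x y : R) : sin x * cos y = 2^-1 * (sin (x + y) + sin (x - y)).
Proof. by rewrite sinB sinD; field. Qed.

Lemma cossin (x y : R) : cos x * sin y = 2^-1 * (sin (x + y) - sin (x - y)).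
Proof. by rewrite sinB sinD; field. Qed.

Lemma dotk_continuous k : continuous (dotk k : R * R -> R).
Proof.
move=> z; apply: cvgD; apply: cvgM; [exact: cvg_cst|exact: cvg_fst|exact: cvg_cst|exact: cvg_snd].
Qed.

Lemma cosk_continuous k : continuous (fun z : R * R => cos (dotk k z)).
Proof. by move=> z; apply: continuous_comp; [exact: dotk_continuous|exact: continuous_cos]. Qed.

Lemma sink_continuous k : continuous (fun z : R * R => sin (dotk k z)).
Proof. by move=> z; apply: continuous_comp; [exact: dotk_continuous|exact: continuous_sin]. Qed.

Lemma periodic2_trig k (p q : R) :
  periodic2 (fun z : R * R => p * cos (dotk k z) + q * sin (dotk k z)).
Proof.
move=> x y; split.
  by rewrite dotk_period1 cosDint sinDint.
by rewrite dotk_period2 cosDint sinDint.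
Qed.

Lemma is_derive_trigk k v (m : R) z (p q : R) :
  (forall h, dotk k (h *: v + z) = h * m + dotk k z) ->
  is_derive z v (fun z => p * cos (dotk k z) + q * sin (dotk k z))
    (m * q * cos (dotk k z) + (- (m * p)) * sin (dotk k z)).
Proof.
move=> dm; apply: is_derive_line.
have := is_derive_trig p q m (dotk k z) 0; rewrite mul0r add0r.
rewrite (_ : (fun h => _) = fun h : R =>
  p * cos (dotk k (h *: v + z)) + q * sin (dotk k (h *: v + z)))//.
by apply/funext => h; rewrite dm.
Qed.

Lemma trigk_continuous k (p q : R) :
  continuous (fun z : R * R => p * cos (dotk k z) + q * sin (dotk k z)).
Proof.
move=> z; apply: cvgD; apply: cvgM; try exact: cvg_cst.
  exact: cosk_continuous.
exact: sink_continuous.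
Qed.

(** Some component of k is nonzero; dividing by it yields a periodic antiderivative in the
    corresponding variable. *)
Lemma cint_trigk k (p q : R) : k != 0 ->
  cint (fun z => p * cos (dotk k z) + q * sin (dotk k z)) = 0.
Proof.
move=> k0; case: (eqVneq k.1 0) => [k1|k1].
  have k2 : k.2%:~R != 0 :> R.
    by rewrite intr_eq0; apply: contra k0; case: k k1 => /= a b -> /eqP ->.
  pose P := - (q / k.2%:~R); pose Q := p / k.2%:~R.
  apply: (@cint_D2 _ (fun z => P * cos (dotk k z) + Q * sin (dotk k z))).
  - move=> z; have dm h : dotk k (h *: e2 R + z) = h * k.2%:~R + dotk k z.
      by rewrite /dotk/= /GRing.scale/=; ring.
    refine (is_derive_eq (is_derive_trigk P Q dm) _).
    by rewrite /P /Q; field.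
  - exact: trigk_continuous.
  - exact: periodic2_trig.
have k1' : k.1%:~R != 0 :> R by rewrite intr_eq0.
pose P := - (q / k.1%:~R); pose Q := p / k.1%:~R.
apply: (@cint_D1 _ (fun z => P * cos (dotk k z) + Q * sin (dotk k z))).
- move=> z; have dm h : dotk k (h *: e1 R + z) = h * k.1%:~R + dotk k z.
    by rewrite /dotk/= /GRing.scale/=; ring.
  refine (is_derive_eq (is_derive_trigk P Q dm) _).
  by rewrite /P /Q; field.
- exact: trigk_continuous.
- exact: periodic2_trig.
Qed.

Lemma cint_cosk k : cint (fun z => cos (dotk k z)) = (k == 0)%:R * (pi *+ 2) ^+ 2.
Proof.
case: (eqVneq k 0) => [->|k0].
  by rewrite -cint_cst; apply: eq_cint => z _; rewrite dotk0 cos0.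
rewrite mul0r -[RHS](cint_trigk 1 0 k0); apply: eq_cint => z _; ring.
Qed.

Lemma cint_sink k : cint (fun z : R * R => sin (dotk k z)) = 0.
Proof.
case: (eqVneq k 0) => [->|k0].
  by rewrite -[RHS](mul0r ((pi *+ 2) ^+ 2)) -cint_cst; apply: eq_cint => z _; rewrite dotk0 sin0.
by rewrite -[RHS](cint_trigk 0 1 k0); apply: eq_cint => z _; ring.
Qed.

Lemma lsum_delta (c : int * int -> R) k :
  lsummable (fun l => c l * (l == k)%:R) /\ lsum (fun l => c l * (l == k)%:R) = c k.
Proof.
pose D l : R := (l == k)%:R.
have nD : lnorm D = 1%E.
  rewrite /lnorm -(@esum_set1 R _ k (fun=> 1%E))// [RHS]esum_mkcond.
  apply: eq_esum => l _; rewrite /D normr_nat; case: eqVneq => [->|lk].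
    by rewrite mem_set.
  by rewrite memNset// => /eqP; rewrite (negbTE lk).
have sD : lsummable D by rewrite /lsummable nD ltry.
have E : (fun l => c l * (l == k)%:R) = (fun l => c k * D l).
  by apply/funext => l; rewrite /D; case: eqVneq => [->//|]; rewrite !mulr0.
rewrite E; split; first exact: lsummableZ.
rewrite lsumZ// (_ : lsum D = 1) ?mulr1//.
rewrite -[RHS]/(fine 1%E) -nD -lsum_abs; apply: eq_lsum => l.
by rewrite /D normr_nat.
Qed.

Lemma pi2_neq0 : (pi *+ 2) ^+ 2 != 0 :> R.
Proof. by rewrite expf_eq0/= mulrn_eq0/= gt_eqF ?pi_gt0. Qed.

Lemma cint_synth_mul (a b : int * int -> R) g : lsummable a -> lsummable b -> cintegrable g ->
  measurable_fun (cell : set RR) g ->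
  cint (fun z => synth a b z * g z) =
  lsum (fun l => a l * cint (fun z => g z * cos (dotk l z)) +
                 b l * cint (fun z => g z * sin (dotk l z))).
Proof.
move=> sa sb ig mg.
have itrig (t : R * R -> R) : continuous t -> (forall z, `|t z| <= 1) ->
    cintegrable (fun z => g z * t z).
  move=> ct t1; apply: (le_integrable _ _ _ ig); first exact: measurable_cell.
    by apply/measurable_EFinP; apply: measurable_funM => //;
      apply: measurable_funTS; exact: continuous_measurable2.
  by move=> z _ /=; rewrite lee_fin normrM ler_piMr.
have ic k : cintegrable (fun z => g z * cos (dotk k z)).
  by apply: itrig; [exact: cosk_continuous|move=> z; exact: cos_max].
have is_ k : cintegrable (fun z => g z * sin (dotk k z)).
  by apply: itrig; [exact: sink_continuous|move=> z; exact: sin_max].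
pose F l z := a l * (g z * cos (dotk l z)) + b l * (g z * sin (dotk l z)).
rewrite (_ : lsum _ = lsum (fun l => cint (F l))); last first.
  apply: eq_lsum => l; rewrite /F cintD ?cintZ//; exact: cintegrableZ.
rewrite -(@cint_lsum _ F (fun k => `|a k| + `|b k|) g)//.
- apply: eq_cint => z _; rewrite /synth mulrC -lsumZ; last exact: synth_summable.
  by apply: eq_lsum => k; rewrite /F; ring.
- by move=> k; apply: cintegrableD; exact: cintegrableZ.
- by apply: lsummableD; exact: lsummable_abs.
- move=> k z _; rewrite /F (_ : _ + _ = (a k * cos (dotk k z) + b k * sin (dotk k z)) * g z).
    by rewrite normrM ler_wpM2r// synth_term_le.
  by ring.
Qed.

(** Product-to-sum formulas leave only the terms l = k and l = -k, each with factor 1/2, and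
    evenness makes them equal. At k = 0 the two indicators coincide and still add up to 1, so no
    case distinction is needed. *)
Lemma fcos_synth a b k : lsummable a -> lsummable b ->
  (forall k, a (- k) = a k) -> fcos (synth a b) k = a k.
Proof.
move=> sa sb ae; rewrite /fcos cint_synth_mul//; last 2 first.
- exact/continuous_cintegrable/cosk_continuous.
- by apply: measurable_funTS; apply: continuous_measurable2; exact: cosk_continuous.
have c l : cint (fun z : R * R => cos (dotk k z) * cos (dotk l z)) =
    2^-1 * (pi *+ 2) ^+ 2 * ((l == k)%:R + (l == - k)%:R).
  rewrite (@eq_cint _ _ (fun z => 2^-1 * (cos (dotk (k - l) z) + cos (dotk (k + l) z)))).
    rewrite cintZ ?cintD ?cint_cosk.
    - rewrite subr_eq0 eq_sym (addrC k) addr_eq0; ring.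
    - exact/continuous_cintegrable/cosk_continuous.
    - exact/continuous_cintegrable/cosk_continuous.
    - by apply: cintegrableD; exact/continuous_cintegrable/cosk_continuous.
  by move=> z _; rewrite coscos dotkB dotkD.
have s l : cint (fun z : R * R => cos (dotk k z) * sin (dotk l z)) = 0.
  rewrite (@eq_cint _ _ (fun z => 2^-1 * (sin (dotk (k + l) z) - sin (dotk (k - l) z)))).
    rewrite cintZ ?cintB ?cint_sink ?subrr ?mulr0//.
    - exact/continuous_cintegrable/sink_continuous.
    - exact/continuous_cintegrable/sink_continuous.
    - by apply: cintegrableB; exact/continuous_cintegrable/sink_continuous.
  by move=> z _; rewrite cossin dotkB dotkD.
rewrite (@eq_lsum _ _ (fun l => 2^-1 * (pi *+ 2) ^+ 2 * (a l * (l == k)%:R + a l * (l == - k)%:R))).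
  have [s1 e1] := lsum_delta a k; have [s2 e2] := lsum_delta a (- k).
  rewrite lsumZ; last exact: lsummableD.
  rewrite lsumD// e1 e2 ae; move: pi2_neq0; generalize ((pi *+ 2) ^+ 2 : R) => Q Q0.
  by field.
by move=> l; rewrite c s; ring.
Qed.

Lemma fsin_synth a b k : lsummable a -> lsummable b ->
  (forall k, b (- k) = - b k) -> fsin (synth a b) k = b k.
Proof.
move=> sa sb ae; rewrite /fsin cint_synth_mul//; last 2 first.
- exact/continuous_cintegrable/sink_continuous.
- by apply: measurable_funTS; apply: continuous_measurable2; exact: sink_continuous.
have c l : cint (fun z : R * R => sin (dotk k z) * sin (dotk l z)) =
    2^-1 * (pi *+ 2) ^+ 2 * ((l == k)%:R - (l == - k)%:R).
  rewrite (@eq_cint _ _ (fun z => 2^-1 * (cos (dotk (k - l) z) - cos (dotk (k + l) z)))).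
    rewrite cintZ ?cintB ?cint_cosk.
    - rewrite subr_eq0 eq_sym (addrC k) addr_eq0; ring.
    - exact/continuous_cintegrable/cosk_continuous.
    - exact/continuous_cintegrable/cosk_continuous.
    - by apply: cintegrableB; exact/continuous_cintegrable/cosk_continuous.
  by move=> z _; rewrite sinsin dotkB dotkD.
have s l : cint (fun z : R * R => sin (dotk k z) * cos (dotk l z)) = 0.
  rewrite (@eq_cint _ _ (fun z => 2^-1 * (sin (dotk (k + l) z) + sin (dotk (k - l) z)))).
    rewrite cintZ ?cintD ?cint_sink ?addr0 ?mulr0//.
    - exact/continuous_cintegrable/sink_continuous.
    - exact/continuous_cintegrable/sink_continuous.
    - by apply: cintegrableD; exact/continuous_cintegrable/sink_continuous.
  by move=> z _; rewrite sincos dotkB dotkD.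
rewrite (@eq_lsum _ _ (fun l => 2^-1 * (pi *+ 2) ^+ 2 * (b l * (l == k)%:R - b l * (l == - k)%:R))).
  have [s1 e1] := lsum_delta b k; have [s2 e2] := lsum_delta b (- k).
  rewrite lsumZ; last exact: lsummableB.
  rewrite lsumB// e1 e2 ae; move: pi2_neq0; generalize ((pi *+ 2) ^+ 2 : R) => Q Q0.
  by field.
by move=> l; rewrite c s; ring.
Qed.

End FourierCoefficients.

(** * Completeness of the trigonometric system *)

Section StepApproximation.
Context (R : realType).

Lemma bernoulli_le (x : R) n : -1 <= x -> 1 + n%:R * x <= (1 + x) ^+ n.
Proof.
move=> x1; elim: n => [|n IH]; first by rewrite mul0r addr0 expr0.
rewrite exprS (le_trans _ (ler_wpM2l _ IH))//; last by lra.
by rewrite -natr1; have := sqr_ge0 x; have := ler0n R n; nra.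
Qed.

(** Bernoulli's inequality gives (1 - x)^n (1 + n x) <= (1 - x)^n (1 + x)^n = (1 - x^2)^n <= 1. *)
Lemma onem_expr_le (x : R) n : 0 <= x <= 1 -> (1 - x) ^+ n <= (1 + n%:R * x)^-1.
Proof.
move=> /andP[x0 x1].
have p : 0 < 1 + n%:R * x by rewrite ltr_pwDl// mulr_ge0.
rewrite -[leRHS]mul1r ler_pdivlMr//.
have q : 0 <= (1 - x) ^+ n by rewrite exprn_ge0// subr_ge0.
rewrite (le_trans (ler_wpM2l q (bernoulli_le n _)))//; first by lra.
by rewrite -exprMn exprn_ile1//; nra.
Qed.

(** With y the square root of x, n x^n = (n y^n) y^n, where n y^n is bounded and y^n tends to 0. *)
Lemma cvg_mulrn_expr (x : R) : 0 <= x < 1 -> (fun n => n%:R * x ^+ n) @ \oo --> (0 : R).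
Proof.
move=> /andP[x0 x1]; pose y := Num.sqrt x.
have y0 : 0 <= y by exact: sqrtr_ge0.
have yx : y ^+ 2 = x by rewrite sqr_sqrtr.
have y1 : y < 1 by rewrite -(@ltr_pXn2r _ 2)// ?nnegrE// yx expr1n.
have ub n : n%:R * y ^+ n <= (1 - y)^-1.
  have s0 : 0 < 1 - y by rewrite subr_gt0.
  have := @onem_expr_le (1 - y) n; rewrite subKr => h.
  have {}h : y ^+ n <= (1 + n%:R * (1 - y))^-1 by apply: h; lra.
  rewrite (le_trans (ler_wpM2l _ h))// ler_pdivrMr; last by rewrite ltr_pwDl// mulr_ge0// ltW.
  by rewrite mulrDr mulr1 mulrCA mulVf ?gt_eqF// mulr1 lerDr invr_ge0 ltW.
have cy : (fun n => (1 - y)^-1 * y ^+ n) @ \oo --> (0 : R).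
  rewrite -[X in _ --> X](mulr0 (1 - y)^-1); apply: cvgMr => //.
  by apply: cvg_expr; rewrite ger0_norm.
apply: (@squeeze_cvgr _ _ _ _ (fun=> 0) _ _ _ _ _ cy); last exact: cvg_cst.
apply: nearW => n; rewrite mulr_ge0 ?exprn_ge0//= -yx -exprM mulnC exprM expr2 mulrA.
by rewrite ler_wpM2r ?exprn_ge0.
Qed.

(* The Brosowski-Deutsch polynomials; the extra factor n in the exponent makes
   them tend to 0 at t = 1/2 as well. *)
Definition step_poly (n : nat) (t : R) : R := (1 - t ^+ n) ^+ (n * 2 ^ n).

Lemma step_poly_itv n t : 0 <= t <= 1 -> 0 <= step_poly n t <= 1.
Proof.
move=> /andP[t0 t1]; rewrite /step_poly.
have h1 : 0 <= t ^+ n by rewrite exprn_ge0.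
have h2 : t ^+ n <= 1 by rewrite exprn_ile1.
by rewrite exprn_ge0 ?exprn_ile1//; lra.
Qed.

(** Below 1/2, Bernoulli's inequality bounds the polynomial from below by 1 - n (2 t)^n. From 1/2
    on, [onem_expr_le] bounds it from above by 1 / (1 + n (2 t)^n) <= 1 / (n + 1). *)
Lemma cvg_step_poly (t : R) : 0 <= t <= 1 -> (step_poly ^~ t) @ \oo --> ((t < 2^-1)%R%:R : R).
Proof.
move=> t01; have /andP[t0 t1] := t01.
have tn n : 0 <= t ^+ n <= 1 by rewrite exprn_ge0//= exprn_ile1.
have mE n : (n * 2 ^ n)%:R * t ^+ n = n%:R * (2 * t) ^+ n :> R.
  by rewrite natrM natrX exprMn mulrA.
have [th|th] := ltP t 2^-1.
  apply: (@squeeze_cvgr _ _ _ _ (fun n => 1 - n%:R * (2 * t) ^+ n) (fun=> 1)).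
  - apply: nearW => n; have /andP[_ ->] := step_poly_itv n t01; rewrite andbT.
    rewrite -mE /step_poly -mulrN; apply: bernoulli_le.
    by have := tn n; lra.
  - rewrite -[X in _ --> X]subr0; apply: cvgB; first exact: cvg_cst.
    by apply: cvg_mulrn_expr; lra.
  - exact: cvg_cst.
apply: (@squeeze_cvgr _ _ _ _ (fun=> 0) (fun n => (n.+1%:R)^-1)).
- apply: nearW => n; have /andP[-> _] := step_poly_itv n t01 => /=.
  rewrite /step_poly (le_trans (onem_expr_le _ (tn n)))// mE lef_pV2 ?posrE//.
    by rewrite -natr1 addrC lerD2l ler_peMr// exprn_ege1//; lra.
  by rewrite ltr_pwDl// mulr_ge0// exprn_ge0//; lra.
- exact: cvg_cst.
- exact: cvg_harmonic.
Qed.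

End StepApproximation.

(** * Multipliers that preserve orthogonality to the trigonometric system *)

Section Completeness.
Context (R : realType) (d : R * R -> R).
Implicit Types (p q : R * R -> R) (k l : int * int) (z : R * R).
Local Notation cell := (@cell R).
Local Notation leb2 := (lebesgue2 R).
Local Notation RR := (measurableTypeR R * measurableTypeR R)%type.

Hypothesis id : cintegrable d.
Hypothesis dcos : forall k, cint (fun z => d z * cos (dotk k z)) = 0.
Hypothesis dsin : forall k, cint (fun z => d z * sin (dotk k z)) = 0.

Let mfun p := measurable_fun (cell : set RR) p.

Lemma measurable_d : measurable_fun (cell : set RR) d.
Proof. by have /integrableP[/measurable_EFinP] := id. Qed.

Lemma cintegrable_mul_bounded p M : mfun p -> (forall z, cell z -> `|p z| <= M) ->
  cintegrable (fun z => d z * p z).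
Proof.
move=> mp pM; have iMd := cintegrableZ M id.
apply: (le_integrable _ _ _ iMd); first exact: measurable_cell.
  by apply/measurable_EFinP; apply: measurable_funM => //; exact: measurable_d.
move=> z cz /=; rewrite lee_fin !normrM mulrC ler_wpM2r//.
by rewrite (le_trans (pM z cz))// ler_norm.
Qed.

(** These multipliers form a vector space, stable under multiplication by trigonometric functions
    and under bounded pointwise limits. That is enough to climb from the constant 1 to indicator
    functions; boundedness is part of the definition so that dominated convergence applies with a
    multiple of |d|. *)
Definition annihilated p : Prop :=
  [/\ mfun p, (exists M, forall z, cell z -> `|p z| <= M),
      (forall k, cint (fun z => d z * p z * cos (dotk k z)) = 0) &
      (forall k, cint (fun z => d z * p z * sin (dotk k z)) = 0)].

Lemma mfun_cosk k : mfun (fun z => cos (dotk k z)).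
Proof. by apply: measurable_funTS; apply: continuous_measurable2; exact: cosk_continuous. Qed.

Lemma mfun_sink k : mfun (fun z => sin (dotk k z)).
Proof. by apply: measurable_funTS; apply: continuous_measurable2; exact: sink_continuous. Qed.

Lemma cintegrable_mul_trig p (t : R * R -> R) M : mfun p -> (forall z, cell z -> `|p z| <= M) ->
  mfun t -> (forall z, `|t z| <= 1) -> cintegrable (fun z => d z * p z * t z).
Proof.
move=> mp pM mt t1; rewrite (_ : (fun z => _) = fun z => d z * (p z * t z)).
  apply: (@cintegrable_mul_bounded _ M); first exact: measurable_funM.
  by move=> z cz; rewrite normrM (le_trans _ (pM z cz))// ler_piMr.
by apply/funext => z; rewrite mulrA.
Qed.

Lemma annihilated1 : annihilated (fun=> 1).
Proof.
split; first exact: measurable_cst.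
- by exists 1 => z _; rewrite normr1.
- by move=> k; under eq_fun do rewrite mulr1; exact: dcos.
- by move=> k; under eq_fun do rewrite mulr1; exact: dsin.
Qed.

Lemma annihilated_lin p q (c : R) : annihilated p -> annihilated q ->
  annihilated (fun z => p z + c * q z).
Proof.
move=> [mp [Mp pM] p1 p2] [mq [Mq qM] q1 q2].
have ip t : mfun t -> (forall z, `|t z| <= 1) -> cintegrable (fun z => d z * p z * t z).
  by move=> mt t1; exact: (cintegrable_mul_trig mp pM).
have iq t : mfun t -> (forall z, `|t z| <= 1) -> cintegrable (fun z => c * (d z * q z * t z)).
  by move=> mt t1; apply: cintegrableZ; exact: (cintegrable_mul_trig mq qM).
have E t : mfun t -> (forall z, `|t z| <= 1) ->
    cint (fun z => d z * (p z + c * q z) * t z) =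
    cint (fun z => d z * p z * t z) + c * cint (fun z => d z * q z * t z).
  move=> mt t1; rewrite -cintZ; last exact: (cintegrable_mul_trig mq qM).
  rewrite -cintD; [|exact: ip|exact: iq].
  by apply: eq_cint => z _; ring.
split.
- by apply: measurable_funD => //; apply: measurable_funM => //; exact: measurable_cst.
- exists (Mp + `|c| * Mq) => z cz; rewrite (le_trans (ler_normD _ _))// lerD//; first exact: pM.
  by rewrite normrM ler_wpM2l// qM.
- move=> k; rewrite E ?p1 ?q1 ?mulr0 ?addr0//; first exact: mfun_cosk.
  by move=> z; exact: cos_max.
- move=> k; rewrite E ?p2 ?q2 ?mulr0 ?addr0//; first exact: mfun_sink.
  by move=> z; exact: sin_max.
Qed.

(** The product of two trigonometric functions is a combination of those of frequencies l - k and l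
    + k, against which [d * p] already integrates to 0. *)
Lemma annihilated_cosk p l : annihilated p -> annihilated (fun z => p z * cos (dotk l z)).
Proof.
move=> [mp [Mp pM] p1 p2].
have ic k : cintegrable (fun z => d z * p z * cos (dotk k z)).
  by apply: (cintegrable_mul_trig mp pM); [exact: mfun_cosk|move=> z; exact: cos_max].
have is_ k : cintegrable (fun z => d z * p z * sin (dotk k z)).
  by apply: (cintegrable_mul_trig mp pM); [exact: mfun_sink|move=> z; exact: sin_max].
split.
- by apply: measurable_funM => //; exact: mfun_cosk.
- by exists Mp => z cz; rewrite normrM (le_trans _ (pM z cz))// ler_piMr// cos_max.
- move=> k; rewrite (@eq_cint _ _ (fun z => 2^-1 * (d z * p z * cos (dotk (l - k) z) +
      d z * p z * cos (dotk (l + k) z)))).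
    by rewrite cintZ ?cintD ?p1 ?addr0 ?mulr0//; exact: cintegrableD.
  by move=> z _; rewrite mulrA -mulrA coscos dotkB dotkD; ring.
- move=> k; rewrite (@eq_cint _ _ (fun z => 2^-1 * (d z * p z * sin (dotk (l + k) z) -
      d z * p z * sin (dotk (l - k) z)))).
    by rewrite cintZ ?cintB ?p2 ?subr0 ?mulr0//; exact: cintegrableB.
  by move=> z _; rewrite mulrA -mulrA cossin dotkB dotkD; ring.
Qed.

Lemma annihilated_sink p l : annihilated p -> annihilated (fun z => p z * sin (dotk l z)).
Proof.
move=> [mp [Mp pM] p1 p2].
have ic k : cintegrable (fun z => d z * p z * cos (dotk k z)).
  by apply: (cintegrable_mul_trig mp pM); [exact: mfun_cosk|move=> z; exact: cos_max].
have is_ k : cintegrable (fun z => d z * p z * sin (dotk k z)).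
  by apply: (cintegrable_mul_trig mp pM); [exact: mfun_sink|move=> z; exact: sin_max].
split.
- by apply: measurable_funM => //; exact: mfun_sink.
- by exists Mp => z cz; rewrite normrM (le_trans _ (pM z cz))// ler_piMr// sin_max.
- move=> k; rewrite (@eq_cint _ _ (fun z => 2^-1 * (d z * p z * sin (dotk (l + k) z) +
      d z * p z * sin (dotk (l - k) z)))).
    by rewrite cintZ ?cintD ?p2 ?addr0 ?mulr0//; exact: cintegrableD.
  by move=> z _; rewrite mulrA -mulrA sincos dotkB dotkD; ring.
- move=> k; rewrite (@eq_cint _ _ (fun z => 2^-1 * (d z * p z * cos (dotk (l - k) z) -
      d z * p z * cos (dotk (l + k) z)))).
    by rewrite cintZ ?cintB ?p1 ?subr0 ?mulr0//; exact: cintegrableB.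
  by move=> z _; rewrite mulrA -mulrA sinsin dotkB dotkD; ring.
Qed.

Lemma annihilated_cvg (p_ : nat -> R * R -> R) p M :
  (forall n, annihilated (p_ n)) -> (forall n z, cell z -> `|p_ n z| <= M) ->
  (forall z, cell z -> p_ ^~ z @ \oo --> p z) -> annihilated p.
Proof.
move=> ap pM pp.
have pM' z : cell z -> `|p z| <= M.
  move=> cz; have cf : `|p_ n z| @[n --> \oo] --> `|p z| by apply: cvg_norm; exact: pp.
  rewrite -(cvg_lim _ cf)//; apply: limr_le; first by apply/cvg_ex; exists `|p z|.
  by apply: nearW => n; exact: pM.
have E t : mfun t -> (forall z, `|t z| <= 1) ->
    (forall n, cint (fun z => d z * p_ n z * t z) = 0) ->
    cint (fun z => d z * p z * t z) = 0.
  move=> mt t1 h.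
  have ipn n : cintegrable (fun z => d z * p_ n z * t z).
    by have [mp _ _ _] := ap n; exact: (cintegrable_mul_trig mp (pM n)).
  have cpn z : cell z -> (fun n => d z * p_ n z * t z) @ \oo --> d z * p z * t z.
    move=> cz; apply: cvgM; last exact: cvg_cst.
    by apply: cvgM; [exact: cvg_cst|exact: pp].
  have ig : cintegrable (fun z => M * `|d z|).
    by apply: cintegrableZ; exact: (integrable_norm id).
  have bd n z : cell z -> `|d z * p_ n z * t z| <= M * `|d z|.
    move=> cz; rewrite !normrM (le_trans (ler_piMr _ (t1 z)))//.
    by rewrite mulrC ler_wpM2r// pM.
  have [_] := cint_cvg ipn cpn ig bd.
  rewrite (_ : (fun n => _) = fun=> 0); last by apply/funext => n; exact: h.
  by move=> h0; apply/esym; apply: (cvg_unique _ _ h0) => //; exact: cvg_cst.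
split.
- apply: (@measurable_fun_cvg _ _ _ (cell : set RR) p_) => //.
  by move=> n; have [] := ap n.
- by exists M.
- move=> k; apply: E; [exact: mfun_cosk|by move=> z; exact: cos_max|].
  by move=> n; have [] := ap n.
- move=> k; apply: E; [exact: mfun_sink|by move=> z; exact: sin_max|].
  by move=> n; have [] := ap n.
Qed.

Lemma annihilated_eq p q : (forall z, cell z -> p z = q z) -> annihilated p -> annihilated q.
Proof.
move=> pq ap; have [_ [M pM] _ _] := ap.
apply: (@annihilated_cvg (fun=> p) q M) => // z cz.
by rewrite -pq//; exact: cvg_cst.
Qed.

Lemma annihilated_ae p q M : mfun q -> (forall z, cell z -> `|q z| <= M) ->
  {ae leb2, forall z, cell z -> p z = q z} -> annihilated p -> annihilated q.
Proof.
move=> mq qM pq [mp [Mp pM] p1 p2]; split => //; first by exists M.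
- move=> k; rewrite -(p1 k); apply: ae_cell_eq.
  + by apply: ae_impl pq => z + cz => /(_ cz) ->.
  + by apply: measurable_funM; [apply: measurable_funM => //; exact: measurable_d|exact: mfun_cosk].
  + by apply: measurable_funM; [apply: measurable_funM => //; exact: measurable_d|exact: mfun_cosk].
- move=> k; rewrite -(p2 k); apply: ae_cell_eq.
  + by apply: ae_impl pq => z + cz => /(_ cz) ->.
  + by apply: measurable_funM; [apply: measurable_funM => //; exact: measurable_d|exact: mfun_sink].
  + by apply: measurable_funM; [apply: measurable_funM => //; exact: measurable_d|exact: mfun_sink].
Qed.

End Completeness.

(** * From half-planes to all measurable sets *)

Section Selectors.
Context (R : realType) (d : R * R -> R).
Implicit Types (p q : R * R -> R) (k l : int * int) (z : R * R).
Local Notation cell := (@cell R).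
Local Notation leb2 := (lebesgue2 R).
Local Notation RR := (measurableTypeR R * measurableTypeR R)%type.

Hypothesis id : cintegrable d.

(** Each [step_poly n] of t is a polynomial in a trigonometric polynomial, so multiplication by it
    is allowed; [cvg_step_poly] identifies the bounded limit as the indicator of {t < 1/2}. *)
Lemma annihilated_step p e (c0 c1 c2 : R) :
  let t z := c0 + c1 * cos (dotk e z) + c2 * sin (dotk e z) in
  (forall z, 0 <= t z <= 1) -> annihilated d p ->
  annihilated d (fun z => p z * (t z < 2^-1)%R%:R).
Proof.
move=> t t01 ap.
have at_ q : annihilated d q -> annihilated d (fun z => q z * t z).
  move=> aq.
  have h1 := annihilated_lin id (c0 - 1) aq aq.
  have h2 := annihilated_lin id c1 h1 (annihilated_cosk id e aq).
  have h3 := annihilated_lin id c2 h2 (annihilated_sink id e aq).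
  by apply: (annihilated_eq id _ h3) => z _; rewrite /t; ring.
have atn q n : annihilated d q -> annihilated d (fun z => q z * t z ^+ n).
  move=> aq; elim: n => [|n IH].
    by apply: (annihilated_eq id _ aq) => z _; rewrite expr0 mulr1.
  by apply: (annihilated_eq id _ (at_ _ IH)) => z _; rewrite exprSr mulrA.
have a1t q n : annihilated d q -> annihilated d (fun z => q z * (1 - t z ^+ n)).
  move=> aq; have := annihilated_lin id (-1) aq (atn q n aq).
  by apply: annihilated_eq => // z _; ring.
have as_ n : annihilated d (fun z => p z * step_poly n (t z)).
  rewrite /step_poly; elim: (n * 2 ^ n)%N => [|m IH].
    by apply: (annihilated_eq id _ ap) => z _; rewrite expr0 mulr1.
  by apply: (annihilated_eq id _ (a1t _ n IH)) => z _; rewrite exprSr mulrA.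
have [_ [M pM] _ _] := ap.
apply: (annihilated_cvg id (M := M) as_) => [n z cz|z cz].
  have /andP[s0 s1] := step_poly_itv n (t01 z).
  by rewrite normrM (le_trans _ (pM z cz))// ler_piMr// ger0_norm.
by apply: cvgM; [exact: cvg_cst|exact: cvg_step_poly].
Qed.

(* A set is a selector if cutting to it preserves orthogonality to all
   trigonometric functions.  Half-planes are, because [step_poly] of a
   trigonometric polynomial converges to their indicator function. *)
Definition selector (A : set (R * R)) := measurable (A : set RR) /\
  forall p, annihilated d p -> annihilated d (fun z => p z * \1_A z).

Lemma selectorC A : selector A -> selector (~` A).
Proof.
move=> [mA sA]; split; first exact: measurableC.
move=> p ap; have := annihilated_lin id (-1) ap (sA p ap).
apply: annihilated_eq => // z _; rewrite indicC/= !indicE.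
by case: (z \in A); rewrite /=; ring.
Qed.

Lemma selectorI A B : selector A -> selector B -> selector (A `&` B).
Proof.
move=> [mA sA] [mB sB]; split; first exact: measurableI.
move=> p ap; apply: (annihilated_eq id _ (sB _ (sA _ ap))) => z _.
by rewrite indicI /= mulrA.
Qed.

Lemma selectorT : selector setT.
Proof.
split; first exact: measurableT.
by move=> p ap; apply: (annihilated_eq id _ ap) => z _; rewrite indicT mulr1.
Qed.

(** At each point the indicators of the finite intersections are eventually constant, and all the
    products are bounded by the bound of p. *)
Lemma selector_bigcap (F : nat -> set (R * R)) : (forall n, selector (F n)) ->
  selector (\bigcap_n F n).
Proof.
move=> sF; split; first by apply: bigcap_measurable => // n _; exact: (sF n).1.
move=> p ap; have [_ [M pM] _ _] := ap.
pose D N := \big[setI/setT]_(0 <= n < N) F n.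
have sD N : selector (D N).
  rewrite /D; elim: N => [|N IH]; first by rewrite big_nil; exact: selectorT.
  by rewrite big_nat_recr//=; exact: selectorI.
apply: (annihilated_cvg id (M := M) (fun n => (sD n).2 _ ap)) => [n z cz|z cz].
  rewrite normrM (le_trans _ (pM z cz))// ler_piMr// indicE.
  by case: (_ \in _); rewrite ?normr0 ?normr1.
apply: cvgM; first exact: cvg_cst.
have DP N : D N z <-> forall n, (n < N)%N -> F n z.
  elim: N => [|N IH]; first by rewrite /D big_nil; split.
  rewrite /D big_nat_recr//=; split=> [[/IH h hN] n|h].
    by rewrite ltnS leq_eqVlt => /predU1P[->//|/h].
  by split; [apply/IH => n nN; apply: h; rewrite ltnS ltnW|exact: h].
apply: cvg_near_cst.
have [h|/existsNP[n0 /not_implyP[_ hn0]]] := pselect (forall n, True -> F n z).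
  apply: nearW => N; rewrite !indicE (mem_set (A := \bigcap_n F n))//.
  by rewrite mem_set//; apply/DP => n _; exact: h.
exists n0.+1 => // N /= n0N; rewrite !indicE !memNset//.
  by move=> h; apply: hn0; exact: (h n0).
by move=> /DP h; apply: hn0; exact: h.
Qed.

(** Two cuts can be performed one after the other, so selectors are stable under intersection from
    the outset and no monotone class argument is required. *)
Lemma selector_sigma_algebra : sigma_algebra setT selector.
Proof.
split.
- by rewrite -setCT; apply: selectorC; exact: selectorT.
- by move=> A sA; rewrite setTD; exact: selectorC.
- move=> F sF; rewrite -[X in selector X]setCK setC_bigcup.
  by apply: selectorC; apply: selector_bigcap => n; exact: selectorC.
Qed.

Lemma cos_lt_arc (y r : R) : 0 < r <= pi -> `|y| < r -> cos r < cos y.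
Proof.
move=> /andP[r0 rpi] yr; rewrite -(cos_norm y) ltr_cos//.
  by rewrite in_itv/= normr_ge0/=; lra.
by rewrite in_itv/=; lra.
Qed.

(** Beyond pi the reflection |y| -> 2 pi - |y| preserves the cosine and returns to [r, pi], where
    the cosine decreases. *)
Lemma cos_ge_arc (y r : R) : 0 < r <= pi -> r <= `|y| <= pi *+ 2 - r -> cos y <= cos r.
Proof.
move=> /andP[r0 rpi] /andP[yr y2]; rewrite -(cos_norm y).
have mono (u : R) : r <= u <= pi -> cos u <= cos r.
  move=> /andP[ru upi]; rewrite leNgt; apply/negP => h.
  have : u < r by move: h; rewrite ltr_cos// in_itv/=; lra.
  lra.
have [ypi|ypi] := leP `|y| pi; first by apply: mono; lra.
rewrite (_ : cos `|y| = cos (pi *+ 2 - `|y|)).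
  by apply: mono; rewrite mulr2n in y2 *; lra.
by rewrite -[RHS]cosN opprB -[in RHS](mulr1 (pi *+ 2)) -mulrN -[X in _ + _ * - X]/(1%:~R)
     -mulrNz cosDint.
Qed.

(** For x in [-pi, pi) the values in (x, pi) form an arc of the circle with midpoint m and
    half-length r, described by cos (t - m) > cos r; division by 4 keeps the resulting polynomial in
    [0, 1]. Values from -pi to x stay at distance between r and 2 pi - r from m. The value pi is
    excluded almost everywhere because the circle does not distinguish it from -pi. *)
Lemma selector_halfplane e (x : R) :
  (forall z, cell z -> - pi <= dotk e z <= pi) ->
  {ae leb2, forall z, dotk e z != pi} ->
  selector [set z | x < dotk e z].
Proof.
move=> ce ne.
have mx : measurable ([set z | x < dotk e z] : set RR).
  have := open_measurable2 (_ : open (dotk e @^-1` `]x, +oo[)).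
  rewrite set_itvoy; apply.
  by have /continuousP := @dotk_continuous R e; apply; exact: open_gt.
split => // p ap; have [mp [M pM] _ _] := ap.
have ind1 A z : `|p z * \1_A z| <= `|p z|.
  rewrite normrM ler_piMr// indicE.
  by case: (_ \in _); rewrite ?normr0 ?normr1.
have mind : measurable_fun (cell : set RR) (fun z => p z * \1_[set z | x < dotk e z] z).
  exact: measurable_funM.
have [xpi|pix] := ltP x pi; last first.
  have := annihilated_lin id (-1) ap ap; apply: annihilated_eq => // z cz.
  rewrite indicE memNset /=; first by ring.
  by apply/negP; rewrite -leNgt (le_trans _ pix)//; have /andP[] := ce z cz.
have [xNpi|Npix] := ltP x (- pi).
  apply: (annihilated_eq id _ ap) => z cz; rewrite indicE mem_set ?mulr1//=.
  by rewrite (lt_le_trans xNpi)//; have /andP[] := ce z cz.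
(* On the cell, 1/2 - (cos (t - m) - cos r) / 4 < 1/2 if and only if x < t < pi. *)
pose m := (x + pi) / 2; pose r := (pi - x) / 2.
have rpi : 0 < r <= pi by rewrite /r; lra.
pose c0 := 2^-1 + cos r / 4; pose c1 := - (cos m / 4); pose c2 := - (sin m / 4).
have tE z : c0 + c1 * cos (dotk e z) + c2 * sin (dotk e z) =
    2^-1 - (cos (dotk e z - m) - cos r) / 4.
  by rewrite /c0 /c1 /c2 cosB; field.
have t01 z : 0 <= c0 + c1 * cos (dotk e z) + c2 * sin (dotk e z) <= 1.
  rewrite tE; have := cos_le1 r; have := cos_geN1 r.
  by have := cos_le1 (dotk e z - m); have := cos_geN1 (dotk e z - m); lra.
apply: (annihilated_ae id (M := M) mind _ _ (annihilated_step t01 ap)).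
  by move=> z cz; rewrite (le_trans (ind1 _ z))// pM.
apply: ae_impl ne => z zpi cz; congr (p z * _); rewrite tE indicE.
have /andP[z1 z2] := ce z cz.
have {zpi z2}z2 : dotk e z < pi by rewrite lt_neqAle zpi.
have [xz|xz] := ltP x (dotk e z).
  rewrite mem_set//= (_ : _ < _ = true)//.
  suff : cos r < cos (dotk e z - m) by lra.
  by apply: cos_lt_arc => //; rewrite ltr_norml /m /r; lra.
rewrite memNset/=; last by apply/negP; rewrite -leNgt.
rewrite (_ : _ < _ = false)//; apply/negbTE; rewrite -leNgt.
suff : cos (dotk e z - m) <= cos r by lra.
apply: cos_ge_arc => //; rewrite ler0_norm; last by rewrite /m; lra.
by rewrite /m /r (mulr2n pi); lra.
Qed.

Lemma negligible_vline : {ae leb2, forall z : R * R, z.1 != pi}.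
Proof.
exists ([set pi] `*` setT); split.
- by apply: measurableX; [exact: measurable_set1|exact: measurableT].
- by rewrite [LHS]product_measure1E//= lebesgue_measure_set1 mul0e.
- by move=> [x y] /= /negP; rewrite negbK => /eqP ->.
Qed.

Lemma negligible_hline : {ae leb2, forall z : R * R, z.2 != pi}.
Proof.
exists (setT `*` [set pi]); split.
- by apply: measurableX; [exact: measurableT|exact: measurable_set1].
- by rewrite [LHS]product_measure1E//= lebesgue_measure_set1 mule0.
- by move=> [x y] /= /negP; rewrite negbK => /eqP ->.
Qed.

Lemma selector_preimage (g : R * R -> R) : (forall x, selector [set z | x < g z]) ->
  forall B : set (measurableTypeR R), measurable B -> selector (g @^-1` B).
Proof.
move=> sg B mB; suff : (@ocitv R).-sigma.-measurable `<=` [set B | selector (g @^-1` B)].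
  by apply.
rewrite RGenOInfty.measurableE; apply: smallest_sub.
  have [s0 sC sU] := selector_sigma_algebra; split.
  - by rewrite /= preimage_set0.
  - by move=> A /= /sC; rewrite !setTD preimage_setC.
  - by move=> F /= /sU; rewrite preimage_bigcup.
by move=> A [x ->] /=; rewrite preimage_itvoy.
Qed.

Lemma selector_measurable (A : set RR) : measurable A -> selector A.
Proof.
move=> mA; suff : (@measurable _ RR) `<=` selector by apply.
rewrite measurable_prod_measurableType; apply: smallest_sub.
  exact: selector_sigma_algebra.
move=> _ [B mB] [C mC] <-.
rewrite (_ : B `*` C = (fst @^-1` B) `&` (snd @^-1` C))//.
apply: selectorI.
- apply: selector_preimage mB => x.
  have E z : dotk (1, 0) z = z.1 by rewrite /dotk/= mul1r mul0r addr0.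
  rewrite (_ : [set z | _] = [set z | x < dotk (1, 0) z]).
    apply: selector_halfplane => [z [/=]|].
      by rewrite E in_itv/=.
    by apply: ae_impl negligible_vline => z; rewrite E.
  by apply/seteqP; split=> z /=; rewrite E.
- apply: selector_preimage mC => x.
  have E z : dotk (0, 1) z = z.2 by rewrite /dotk/= mul1r mul0r add0r.
  rewrite (_ : [set z | _] = [set z | x < dotk (0, 1) z]).
    apply: selector_halfplane => [z [/= _]|].
      by rewrite E in_itv/=.
    by apply: ae_impl negligible_hline => z; rewrite E.
  by apply/seteqP; split=> z /=; rewrite E.
Qed.

(** The constant 1 is an admissible multiplier, hence so is the indicator of any measurable E;
    frequency 0 then says that the integral of d over E vanishes. An integrable function with this
    property for all E in the cell is 0 almost everywhere. *)
Lemma fourier_complete :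
  (forall k, cint (fun z => d z * cos (dotk k z)) = 0) ->
  (forall k, cint (fun z => d z * sin (dotk k z)) = 0) ->
  {ae leb2, forall z, cell z -> d z = 0}.
Proof.
move=> dcos dsin.
have h : forall E : set RR, E `<=` cell -> measurable E ->
    (\int[leb2]_(z in E) (EFin \o d) z = \int[leb2]_(z in E) (cst 0) z)%E.
  move=> E Ec mE.
  have [_ _ /(_ 0) h _] := (selector_measurable mE).2 _ (annihilated1 dcos dsin).
  have iE : leb2.-integrable E (EFin \o d).
    by apply: integrableS id => //; exact: measurable_cell.
  rewrite integral0 -[LHS]fineK; last exact: integrable_fin_num.
  congr EFin; rewrite -[RHS]h /cint.
  rewrite -[LHS]/(Rintegral leb2 E d) -[in LHS](setIidr Ec) Rintegral_mkcondr.
  apply: eq_Rintegral => z _; rewrite dotk0 cos0 mulr1 mul1r patchE indicE.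
  by case: (z \in E); rewrite ?mulr1 ?mulr0.
have := integral_ae_eq (@measurable_cell R) id (@measurable_cst _ _ _ _ _ _) h.
by apply: ae_impl => z + cz => /(_ cz) [].
Qed.

End Selectors.

(** * Weighted absolutely convergent Fourier series *)

Section WienerAlgebra.
Context (R : realType).
Implicit Types (f g h : R * R -> R) (k l : int * int) (z : R * R).
Local Notation cell := (@cell R).
Local Notation leb2 := (lebesgue2 R).
Local Notation RR := (measurableTypeR R * measurableTypeR R)%type.
Local Notation weight := (@weight R).

Lemma fcosN f k : fcos f (- k) = fcos f k.
Proof. by rewrite /fcos; congr (_ * cint _); apply/funext => z; rewrite dotkN cosN. Qed.

Lemma cintegrable_trig f (t : R * R -> R) : cintegrable f -> continuous t ->
  (forall z, `|t z| <= 1) -> cintegrable (fun z => f z * t z).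
Proof.
move=> jf ct t1; apply: (cintegrable_mul_bounded jf (M := 1)) => //.
by apply: measurable_funTS; exact: continuous_measurable2.
Qed.

Lemma cintegrable_cosk f k : cintegrable f -> cintegrable (fun z => f z * cos (dotk k z)).
Proof.
by move=> jf; apply: cintegrable_trig => //; [exact: cosk_continuous|move=> z; exact: cos_max].
Qed.

Lemma cintegrable_sink f k : cintegrable f -> cintegrable (fun z => f z * sin (dotk k z)).
Proof.
by move=> jf; apply: cintegrable_trig => //; [exact: sink_continuous|move=> z; exact: sin_max].
Qed.

Lemma fsinN f k : cintegrable f -> fsin f (- k) = - fsin f k.
Proof.
move=> jf; rewrite /fsin (@eq_cint _ _ (fun z => -1 * (f z * sin (dotk k z)))).
  by rewrite cintZ; [ring|exact: cintegrable_sink].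
by move=> z _; rewrite dotkN sinN; ring.
Qed.

Lemma esum_exchange (a : int * int -> int * int -> \bar R) : (forall k l, (0 <= a k l)%E) ->
  (\esum_(k in [set: int * int]) \esum_(l in [set: int * int]) a k l =
   \esum_(l in [set: int * int]) \esum_(k in [set: int * int]) a k l)%E.
Proof.
move=> a0; rewrite !esum_esum//.
rewrite (reindex_esum ([set: int * int] `*`` (fun=> [set: int * int])) _ (fun x => (x.2, x.1)))//.
split=> //=.
- by move=> [i1 i2] [j1 j2] /= _ _ [] -> ->.
- by move=> [i1 i2] _ /=; exists (i2, i1).
Qed.

Lemma lnorm_shift (c : int * int -> R) l :
  lnorm (fun k => c (k - l)) = lnorm c /\ lnorm (fun k => c (k + l)) = lnorm c.
Proof.
rewrite /lnorm; split; apply/esym.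
- rewrite (reindex_esum [set: int * int] _ (fun k => k - l))//.
  rewrite setTT_bijective; exists (fun k => k + l) => k; [exact: subrK|exact: addrK].
- rewrite (reindex_esum [set: int * int] _ (fun k => k + l))//.
  rewrite setTT_bijective; exists (fun k => k - l) => k; [exact: addrK|exact: subrK].
Qed.

Lemma le_lsum_term (c : int * int -> R) k : (forall k, 0 <= c k) -> lsummable c -> c k <= lsum c.
Proof.
move=> c0 sc; have [s1 e1] := lsum_delta c k; rewrite -[leLHS]e1.
by apply: le_lsum => // l; case: (l == k); rewrite ?mulr1 ?mulr0.
Qed.

(** Peetre's inequality. It is what makes the weighted coefficient norms submultiplicative up to a
    constant. *)
Lemma weight_submul k l : weight (k + l) <= 2 * weight k * weight l.
Proof.
rewrite !weightE /sqnorm /= !intrD.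
set a := k.1%:~R; set b := k.2%:~R; set a' := l.1%:~R; set b' := l.2%:~R.
have h1 := sqr_ge0 (a - a'); have h2 := sqr_ge0 (b - b').
have h3 := sqr_ge0 (a * a'); have h4 := sqr_ge0 (a * b').
have h5 := sqr_ge0 (b * a'); have h6 := sqr_ge0 (b * b'); nra.
Qed.

Definition fcoef f k : R := `|fcos f k| + `|fsin f k|.

Lemma fcoef_ge0 f k : 0 <= fcoef f k.
Proof. by rewrite addr_ge0. Qed.


Lemma sqr_cintegrable f : L2torus f -> cintegrable (fun z => f z ^+ 2).
Proof.
move=> [_ mf nf].
have mfc : measurable_fun (cell : set RR) (fun z => (f z ^+ 2)%:E).
  by apply/measurable_EFinP; apply: measurable_funX; exact: measurable_funTS.
apply/integrableP; split=> //.
have : (L2norm f `^ 2 < +oo)%E by exact: poweR_lty.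
rewrite /L2norm poweR_Lnorm//; apply: le_lt_trans.
rewrite [leLHS]integral_mkcond le_eqVlt; apply/orP; left; apply/eqP.
apply: eq_integral => z _; rewrite /= !patchE; case: ifP => // _.
  by rewrite powR_mulrn// real_normK ?num_real// ger0_norm// sqr_ge0.
by rewrite [in RHS]/point/= normr0 powR0.
Qed.

Lemma L2torus_cintegrable f : L2torus f -> cintegrable f.
Proof.
move=> Lf; have [_ mf _] := Lf; have i2 := sqr_cintegrable Lf.
have i1 : cintegrable (fun=> 1 : R) by apply: continuous_cintegrable => z; exact: cvg_cst.
apply: (le_integrable _ _ _ (cintegrableD i1 i2)); first exact: measurable_cell.
  by apply/measurable_EFinP; exact: measurable_funTS.
move=> z _ /=; rewrite lee_fin [leRHS]ger0_norm ?addr_ge0 ?sqr_ge0//.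
have := sqr_ge0 (f z - 1); have := sqr_ge0 (f z + 1); have := sqr_ge0 (f z).
by have [] := ler0P (f z); nra.
Qed.

(** The series converges to a continuous function with the same coefficients as f, by parity of
    [fcos f] and [fsin f]; completeness applies to the difference. *)
Lemma fourier_inversion f : cintegrable f -> lsummable (fcos f) -> lsummable (fsin f) ->
  {ae leb2, forall z, cell z -> f z = synth (fcos f) (fsin f) z}.
Proof.
move=> jf sc ss; pose S := synth (fcos f) (fsin f).
have cS : continuous S by exact: synth_continuous.
have jS : cintegrable S by exact: continuous_cintegrable.
have C0 : (pi *+ 2) ^- 2 != 0 :> R by rewrite invr_neq0// pi2_neq0.
have : {ae leb2, forall z, cell z -> f z - S z = 0}.
  apply: fourier_complete; first exact: cintegrableB.
  - move=> k; rewrite (@eq_cint _ _ (fun z => f z * cos (dotk k z) - S z * cos (dotk k z))).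
      rewrite cintB; [|exact: cintegrable_cosk..].
      apply/eqP; rewrite subr_eq0; apply/eqP; apply: (mulfI C0).
      by rewrite -/(fcos f k) -/(fcos S k) fcos_synth// => l; exact: fcosN.
    by move=> z _; rewrite mulrBl.
  - move=> k; rewrite (@eq_cint _ _ (fun z => f z * sin (dotk k z) - S z * sin (dotk k z))).
      rewrite cintB; [|exact: cintegrable_sink..].
      apply/eqP; rewrite subr_eq0; apply/eqP; apply: (mulfI C0).
      by rewrite -/(fsin f k) -/(fsin S k) fsin_synth// => l; exact: fsinN.
    by move=> z _; rewrite mulrBl.
by apply: ae_impl => z h cz; apply/eqP; rewrite -subr_eq0; apply/eqP; exact: h.
Qed.

(** The convolution formula in real form: product-to-sum identities produce both frequencies k - l
    and k + l, with a factor 1/2. The cosine and sine coefficients of the product each account for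
    one half of the right-hand side. *)
Lemma fcoef_mul_le a b h k : lsummable a -> lsummable b -> continuous h ->
  lsummable (fcoef h) ->
  fcoef (fun z => synth a b z * h z) k <=
  lsum (fun l => (`|a l| + `|b l|) * (fcoef h (k - l) + fcoef h (k + l))).
Proof.
move=> sa sb ch sh.
have jh : cintegrable h by exact: continuous_cintegrable.
pose N l := `|a l| + `|b l|.
have sN : lsummable N by apply: lsummableD; exact: lsummable_abs.
pose H l := fcoef h (k - l) + fcoef h (k + l).
have H0 l : 0 <= H l by rewrite addr_ge0// fcoef_ge0.
have sNH : lsummable (fun l => N l * H l).
  apply: (@lsummable_le _ _ (fun l => (lsum (fcoef h) + lsum (fcoef h)) * N l)); last exact: lsummableZ.
  move=> l; rewrite normrM ger0_norm ?addr_ge0// mulrC ger0_norm//.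
  by rewrite ler_wpM2r ?addr_ge0// lerD//; apply: le_lsum_term => // ?; exact: fcoef_ge0.
pose C : R := (pi *+ 2) ^- 2.
have E1 l : C * cint (fun z => h z * cos (dotk k z) * cos (dotk l z)) =
    2^-1 * (fcos h (k - l) + fcos h (k + l)).
  rewrite /fcos -mulrDr mulrCA; congr (_ * _).
  rewrite -cintD; [|exact: cintegrable_cosk..]; rewrite -cintZ; last first.
    by apply: cintegrableD; exact: cintegrable_cosk.
  by apply: eq_cint => z _; rewrite -mulrA coscos dotkB dotkD; ring.
have E2 l : C * cint (fun z => h z * cos (dotk k z) * sin (dotk l z)) =
    2^-1 * (fsin h (k + l) - fsin h (k - l)).
  rewrite /fsin -mulrBr mulrCA; congr (_ * _).
  rewrite -cintB; [|exact: cintegrable_sink..]; rewrite -cintZ; last first.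
    by apply: cintegrableB; exact: cintegrable_sink.
  by apply: eq_cint => z _; rewrite -mulrA cossin dotkB dotkD; ring.
have E3 l : C * cint (fun z => h z * sin (dotk k z) * cos (dotk l z)) =
    2^-1 * (fsin h (k + l) + fsin h (k - l)).
  rewrite /fsin -mulrDr mulrCA; congr (_ * _).
  rewrite -cintD; [|exact: cintegrable_sink..]; rewrite -cintZ; last first.
    by apply: cintegrableD; exact: cintegrable_sink.
  by apply: eq_cint => z _; rewrite -mulrA sincos dotkB dotkD; ring.
have E4 l : C * cint (fun z => h z * sin (dotk k z) * sin (dotk l z)) =
    2^-1 * (fcos h (k - l) - fcos h (k + l)).
  rewrite /fcos -mulrBr mulrCA; congr (_ * _).
  rewrite -cintB; [|exact: cintegrable_cosk..]; rewrite -cintZ; last first.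
    by apply: cintegrableB; exact: cintegrable_cosk.
  by apply: eq_cint => z _; rewrite -mulrA sinsin dotkB dotkD; ring.
have half (x y : R) l : `|x| <= 2^-1 * H l -> `|y| <= 2^-1 * H l ->
    `|a l * x + b l * y| <= 2^-1 * (N l * H l).
  move=> hx hy; rewrite (le_trans (ler_normD _ _))// !normrM mulrCA mulrDl lerD//;
    exact: ler_wpM2l.
have bnd (x y : R) l : `|x| <= fcoef h (k - l) -> `|y| <= fcoef h (k + l) ->
    `|2^-1 * (x + y)| <= 2^-1 * H l.
  move=> hx hy; rewrite normrM ger0_norm ?invr_ge0// ler_wpM2l ?invr_ge0//.
  by rewrite (le_trans (ler_normD _ _))// lerD.
have lec m : `|fcos h m| <= fcoef h m by rewrite lerDl.
have les m : `|fsin h m| <= fcoef h m by rewrite lerDr.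
have mg (t : R * R -> R) : continuous t -> measurable_fun (cell : set RR) (fun z => h z * t z).
  move=> ct; apply: measurable_funTS; apply: continuous_measurable2 => z.
  by apply: cvgM; [exact: ch|exact: ct].
have sNH2 : lsummable (fun l => 2^-1 * (N l * H l)) by exact: lsummableZ.
have key (t : R * R -> R) (x y : int * int -> R) : continuous t -> (forall z, `|t z| <= 1) ->
    (forall l, C * cint (fun z => h z * t z * cos (dotk l z)) = x l) ->
    (forall l, C * cint (fun z => h z * t z * sin (dotk l z)) = y l) ->
    (forall l, `|x l| <= 2^-1 * H l) -> (forall l, `|y l| <= 2^-1 * H l) ->
    `|C * cint (fun z => synth a b z * h z * t z)| <= 2^-1 * lsum (fun l => N l * H l).
  move=> ct t1 ex ey hx hy.
  rewrite (@eq_cint _ _ (fun z => synth a b z * (h z * t z))); last first.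
    by move=> z _; rewrite mulrA.
  rewrite cint_synth_mul//; [|exact: cintegrable_trig|exact: mg].
  have Yle l : `|a l * x l + b l * y l| <= 2^-1 * (N l * H l) by exact: half.
  have sY := lsummable_le Yle sNH2.
  rewrite (@eq_lsum _ _ (fun l => C^-1 * (a l * x l + b l * y l))).
    rewrite lsumZ// mulrA mulfV ?mul1r ?invr_neq0 ?pi2_neq0// -lsumZ//.
    exact: normr_lsum_le.
  move=> l; rewrite -ex -ey; field.
  by rewrite /C invr_neq0// pi2_neq0.
rewrite /fcoef -[lsum _]mul1r [X in X * _](_ : _ = 2^-1 + 2^-1 :> R); last by field.
rewrite mulrDl lerD//.
- apply: (key _ _ _ (@cosk_continuous R k) (fun z => cos_max _) E1 E2) => l.
    by apply: bnd; [exact: lec|exact: lec].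
  by rewrite addrC; apply: bnd; [rewrite normrN; exact: les|exact: les].
- apply: (key _ _ _ (@sink_continuous R k) (fun z => sin_max _) E3 E4) => l.
    by rewrite addrC; apply: bnd; [exact: les|exact: les].
  by apply: bnd; [exact: lec|rewrite normrN; exact: lec].
Qed.

Definition wnorm p (c : int * int -> R) : \bar R := lnorm (fun k => weight k ^+ p * c k).

Lemma weight_expr_ge0 p k : 0 <= weight k ^+ p.
Proof. by rewrite exprn_ge0// ltW// weight_gt0. Qed.

Lemma weight_expr_le p k l : weight (k + l) ^+ p <= 2 ^+ p * (weight k ^+ p * weight l ^+ p).
Proof.
rewrite -!exprMn mulrA lerXn2r// ?nnegrE ?weight_submul//; first exact/ltW/weight_gt0.
by rewrite !mulr_ge0// ltW// weight_gt0.
Qed.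

(** Young's inequality for the convolution bound of [fcoef_mul_le], after the weight is distributed
    over the two factors at the price of 2^p. Summing over k first, both shifted copies have the
    same norm, which accounts for one more factor 2. *)
Lemma wnorm_mul_le p a b h (A B : R) : continuous h ->
  (wnorm p (fun k => `|a k| + `|b k|)%R <= A%:E)%E -> (wnorm p (fcoef h) <= B%:E)%E ->
  (wnorm p (fcoef (fun z => synth a b z * h z)%R) <= (2 ^+ p.+1 * A * B)%:E)%E.
Proof.
move=> ch hA hB; pose N k := `|a k| + `|b k|.
have N0 k : 0 <= N k by rewrite addr_ge0.
have wN : wsummable p N by exact: le_lt_trans hA (ltry _).
have wh : wsummable p (fcoef h) by exact: le_lt_trans hB (ltry _).
have sN := wsummable_lsummable wN.
have sa : lsummable a by apply: (lsummable_le _ sN) => k; rewrite lerDl.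
have sb : lsummable b by apply: (lsummable_le _ sN) => k; rewrite lerDr.
have sh := wsummable_lsummable wh.
pose WN k := weight k ^+ p * N k; pose WH k := weight k ^+ p * fcoef h k.
have WN0 k : 0 <= WN k by rewrite mulr_ge0// weight_expr_ge0.
have WH0 k : 0 <= WH k by rewrite mulr_ge0// ?weight_expr_ge0// fcoef_ge0.
pose H k l := WN l * (WH (k - l) + WH (k + l)).
have H0 k l : 0 <= H k l by rewrite mulr_ge0// addr_ge0.
have step1 k : ((`|weight k ^+ p * fcoef (fun z => synth a b z * h z)%R k|)%:E <=
    \esum_(l in [set: int * int]) (2 ^+ p * H k l)%:E)%E.
  rewrite ger0_norm ?mulr_ge0 ?weight_expr_ge0 ?fcoef_ge0//.
  have sF := fcoef_mul_le k sa sb ch sh.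
  pose F l := N l * (fcoef h (k - l) + fcoef h (k + l)).
  have F0 l : 0 <= F l by rewrite mulr_ge0// addr_ge0// fcoef_ge0.
  have sFs : lsummable F.
    apply: (@lsummable_le _ _ (fun l => (lsum (fcoef h) + lsum (fcoef h)) * N l)); last exact: lsummableZ.
    move=> l; rewrite ger0_norm// /F (mulrC (N l)) ler_wpM2r//.
    by apply: lerD; apply: le_lsum_term => // ?; exact: fcoef_ge0.
  apply: (@le_trans _ _ (lnorm (fun l => weight k ^+ p * F l))).
    rewrite -fine_lnorm; last exact: lsummableZ.
    rewrite lee_fin -lsum_abs (@eq_lsum _ _ (fun l => weight k ^+ p * F l)).
      by rewrite lsumZ// ler_wpM2l// weight_expr_ge0.
    by move=> l; rewrite ger0_norm// mulr_ge0// weight_expr_ge0.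
  apply: le_esum => l _; rewrite lee_fin (ger0_norm (mulr_ge0 (weight_expr_ge0 _ _) (F0 l))).
  rewrite /H /F /WN /WH.
  (* The frequency k is split as (k - l) + l and as (k + l) + (-l), and the weight is even. *)
  have hw1 := weight_expr_le p (k - l) l; rewrite subrK in hw1.
  have hw2 := weight_expr_le p (k + l) (- l); rewrite addrK in hw2.
  have ew : weight (- l) = weight l by rewrite !weightE /sqnorm /= !mulrNz !sqrrN.
  rewrite ew in hw2; move: (fcoef_ge0 h (k - l)) (fcoef_ge0 h (k + l)) (N0 l) hw1 hw2.
  move: (fcoef h (k - l)) (fcoef h (k + l)) (N l) (weight k ^+ p) => X Y n w X0 Y0 n0 hw1 hw2.
  have h1 := ler_wpM2r (mulr_ge0 n0 X0) hw1.
  have h2 := ler_wpM2r (mulr_ge0 n0 Y0) hw2.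
  rewrite (_ : w * _ = w * (n * X) + w * (n * Y)); last by ring.
  rewrite (le_trans (lerD h1 h2))// le_eqVlt; apply/orP; left; apply/eqP; ring.
rewrite /wnorm {1}/lnorm (le_trans (le_esum (fun k _ => step1 k)))//.
rewrite esum_exchange; last by move=> k l; rewrite lee_fin mulr_ge0// exprn_ge0.
have sWH : lsummable WH by [].
have sWN : lsummable WN by [].
have lsum_eq (c : int * int -> R) : (forall k, 0 <= c k) -> lsummable c -> lnorm c = (lsum c)%:E.
  move=> c0 sc; rewrite -fine_lnorm// -lsum_abs; congr EFin; apply: eq_lsum => k.
  by rewrite ger0_norm.
have step2 l : (\esum_(k in [set: int * int]) (2 ^+ p * H k l)%:E =
    (2 ^+ p.+1 * lsum WH * WN l)%:E)%E.
  have [m1 m2] := lnorm_shift WH l.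
  have s1 : lsummable (fun k => WH (k - l)) by rewrite /lsummable m1.
  have s2 : lsummable (fun k => WH (k + l)) by rewrite /lsummable m2.
  have e1 : lsum (fun k => WH (k - l)) = lsum WH.
    have E1 := lsum_eq (fun k => WH (k - l)) (fun k => WH0 (k - l)) s1.
    exact: EFin_inj (etrans (esym E1) (etrans m1 (lsum_eq WH WH0 sWH))).
  have e2 : lsum (fun k => WH (k + l)) = lsum WH.
    have E2 := lsum_eq (fun k => WH (k + l)) (fun k => WH0 (k + l)) s2.
    exact: EFin_inj (etrans (esym E2) (etrans m2 (lsum_eq WH WH0 sWH))).
  have c0 k : 0 <= 2 ^+ p * WN l * (WH (k - l) + WH (k + l)).
    by apply: mulr_ge0; [apply: mulr_ge0 => //; exact: exprn_ge0|exact: addr_ge0].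
  transitivity (lnorm (fun k => 2 ^+ p * WN l * (WH (k - l) + WH (k + l)))).
    apply: eq_esum => k _; rewrite ger0_norm; first by congr EFin; rewrite /H; ring.
    exact: c0.
  have s12 := lsummableD s1 s2.
  rewrite (lsum_eq _ c0 (lsummableZ _ s12)) (lsumZ _ s12) (lsumD s1 s2) e1 e2.
  by congr EFin; rewrite exprS; ring.
rewrite (eq_esum (fun l _ => step2 l)).
have lWH0 : 0 <= lsum WH by exact: lsum_ge0.
have c0 l : 0 <= 2 ^+ p.+1 * lsum WH * WN l.
  by apply: mulr_ge0 => //; apply: mulr_ge0 => //; exact: exprn_ge0.
rewrite (_ : esum _ _ = lnorm (fun l => 2 ^+ p.+1 * lsum WH * WN l)); last first.
  by apply: eq_esum => l _; rewrite ger0_norm.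
have lA : lsum WN <= A by rewrite -lee_fin -lsum_eq.
have lB : lsum WH <= B by rewrite -lee_fin -lsum_eq.
rewrite lsum_eq//; last exact: lsummableZ.
rewrite lsumZ// lee_fin -!mulrA ler_wpM2l ?exprn_ge0// mulrC ler_pM//; exact: lsum_ge0.
Qed.

End WienerAlgebra.

(** * Energy inequality *)

Section EnergyInequality.
Context (R : realType).
Implicit Types (f g : R * R -> R) (z : R * R).
Local Notation cell := (@cell R).

Lemma periodic2M f g : periodic2 f -> periodic2 g -> periodic2 (fun z => f z * g z).
Proof. by move=> pf pg x y; rewrite !(pf x y).1 !(pf x y).2 !(pg x y).1 !(pg x y).2. Qed.

Lemma periodic2D f g : periodic2 f -> periodic2 g -> periodic2 (fun z => f z + g z).
Proof. by move=> pf pg x y; rewrite !(pf x y).1 !(pf x y).2 !(pg x y).1 !(pg x y).2. Qed.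

Lemma periodic2B f g : periodic2 f -> periodic2 g -> periodic2 (fun z => f z - g z).
Proof. by move=> pf pg x y; rewrite !(pf x y).1 !(pf x y).2 !(pg x y).1 !(pg x y).2. Qed.

Lemma periodic2X f n : periodic2 f -> periodic2 (fun z => f z ^+ n).
Proof. by move=> pf x y; rewrite !(pf x y).1 !(pf x y).2. Qed.

Lemma is_derive_mul f g (z v : R * R) (df dg : R) : is_derive z v f df -> is_derive z v g dg ->
  is_derive z v (fun z => f z * g z) (df * g z + f z * dg).
Proof.
move=> hf hg; refine (is_derive_eq (is_deriveM hf hg) _).
by rewrite /GRing.scale/=; ring.
Qed.

Lemma is_derive_add f g (z v : R * R) (df dg : R) : is_derive z v f df -> is_derive z v g dg ->
  is_derive z v (fun z => f z + g z) (df + dg).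
Proof. by move=> hf hg; exact: is_deriveD. Qed.

Lemma is_derive_sub f g (z v : R * R) (df dg : R) : is_derive z v f df -> is_derive z v g dg ->
  is_derive z v (fun z => f z - g z) (df - dg).
Proof. by move=> hf hg; exact: is_deriveB. Qed.

Lemma is_derive_cube f (z v : R * R) (df : R) : is_derive z v f df ->
  is_derive z v (fun z => f z ^+ 3) (3 * f z ^+ 2 * df).
Proof.
move=> hf; have h := is_derive_mul hf (is_derive_mul hf hf).
have -> : (fun z => f z ^+ 3) = fun z => f z * (f z * f z).
  by apply/funext => y; ring.
by refine (is_derive_eq h _); ring.
Qed.

(** Here d stands for the Laplacian of e = w - u, and the products with w1 - u1 and w2 - u2 for grad
    F . grad e with F = w^3 - u^3 + e. The nonlinearity has -e where F has +e: the change of sign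
    gains an extra -|grad e|^2, which absorbs the terms in e w grad w, and costs -2 e d instead of
    -e d, which the dissipation nu d^2 absorbs. The two directions double the constants 3/4 and
    9/4. *)
Lemma energy_pointwise (nu W w u w1 u1 w2 u2 d rho q : R) : 0 < nu -> 0 <= W ->
  `|w| <= W -> `|w1| <= W -> `|w2| <= W ->
  q = - nu * d + (w ^+ 3 - w) - (u ^+ 3 - u) + rho ->
  q * d - (w ^+ 3 - u ^+ 3 + (w - u)) * d
   - (3 * w ^+ 2 * w1 - 3 * u ^+ 2 * u1 + (w1 - u1)) * (w1 - u1)
   - (3 * w ^+ 2 * w2 - 3 * u ^+ 2 * u2 + (w2 - u2)) * (w2 - u2) <=
  (3 / 2 * W ^+ 2 + 9 / 2 * W ^+ 4 + 2 / nu) * (w - u) ^+ 2 + (2 * nu)^-1 * rho ^+ 2.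
Proof.
move=> nu0 W0 hw hw1 hw2 ->.
pose e := w - u.
have grad (x y : R) : `|x| <= W ->
    - ((3 * w ^+ 2 * x - 3 * u ^+ 2 * y + (x - y)) * (x - y)) <=
    (3 / 4 * W ^+ 2 + 9 / 4 * W ^+ 4) * e ^+ 2.
  move=> hx.
  (* With x and y the partial derivatives of w and u, the cross term is 3 e (u + w) x (x - y). The
     first square pairs its u part with 3 u^2 (x - y)^2, the second its w part with the extra (x -
     y)^2. *)
  have s1 := sqr_ge0 (u * (x - y) + 2^-1 * e * x).
  have s2 := sqr_ge0 ((x - y) + 3 / 2 * e * w * x).
  have x2 : x ^+ 2 <= W ^+ 2 by rewrite -[x ^+ 2]real_normK ?num_real// lerXn2r// nnegrE.
  have w2' : w ^+ 2 <= W ^+ 2 by rewrite -[w ^+ 2]real_normK ?num_real// lerXn2r// nnegrE.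
  have t1 : e ^+ 2 * x ^+ 2 <= e ^+ 2 * W ^+ 2 by rewrite ler_wpM2l// sqr_ge0.
  have t2 : e ^+ 2 * (w ^+ 2 * x ^+ 2) <= e ^+ 2 * W ^+ 4.
    by rewrite ler_wpM2l ?sqr_ge0// [leRHS](exprD _ 2 2) ler_pM// sqr_ge0.
  apply: (@le_trans _ _ (3 / 4 * (e ^+ 2 * x ^+ 2) + 9 / 4 * (e ^+ 2 * (w ^+ 2 * x ^+ 2)))).
    rewrite -subr_ge0 (_ : _ - _ = 3 * (u * (x - y) + 2^-1 * e * x) ^+ 2 +
      ((x - y) + 3 / 2 * e * w * x) ^+ 2); first by rewrite addr_ge0// mulr_ge0.
    by rewrite /e; field.
  have -> : (3 / 4 * W ^+ 2 + 9 / 4 * W ^+ 4) * e ^+ 2 =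
    3 / 4 * (e ^+ 2 * W ^+ 2) + 9 / 4 * (e ^+ 2 * W ^+ 4) by ring.
  by rewrite lerD// ler_wpM2l// divr_ge0.
(* One half of the dissipation nu d^2 absorbs 2 e d, the other half rho d. *)
have diss : - nu * d ^+ 2 - 2 * (e * d) + rho * d <= 2 / nu * e ^+ 2 + (2 * nu)^-1 * rho ^+ 2.
  rewrite -subr_ge0 (_ : _ - _ = nu / 2 * (d + 2 / nu * e) ^+ 2 + nu / 2 * (d - rho / nu) ^+ 2).
    by rewrite addr_ge0// mulr_ge0 ?sqr_ge0// divr_ge0// ltW.
  by field; rewrite gt_eqF.
have g1 := grad w1 u1 hw1; have g2 := grad w2 u2 hw2.
rewrite (_ : _ - _ - _ - _ = (- nu * d ^+ 2 - 2 * (e * d) + rho * d) +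
  (- ((3 * w ^+ 2 * w1 - 3 * u ^+ 2 * u1 + (w1 - u1)) * (w1 - u1))) +
  (- ((3 * w ^+ 2 * w2 - 3 * u ^+ 2 * u2 + (w2 - u2)) * (w2 - u2)))); last first.
  by rewrite /e; ring.
rewrite (le_trans (lerD (lerD diss g1) g2))// le_eqVlt; apply/orP; left; apply/eqP.
by rewrite /e; field; rewrite gt_eqF.
Qed.

(** All integrations by parts are made at once: (w - u) times the Laplacian of q equals, up to the
    divergence of a periodic flux, the left-hand side of [energy_pointwise], and the divergence
    integrates to 0. *)
Lemma energy_inequality (nu W : R) (w w1 w2 w11 w22 u u1 u2 u11 u22 q q1 q2 q11 q22 rho : R * R -> R) :
  0 < nu -> 0 <= W ->
  continuous w -> continuous w1 -> continuous w2 -> continuous w11 -> continuous w22 ->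
  continuous u -> continuous u1 -> continuous u2 -> continuous u11 -> continuous u22 ->
  continuous q -> continuous q1 -> continuous q2 -> continuous q11 -> continuous q22 ->
  cintegrable (fun z => rho z ^+ 2) ->
  (forall z, is_derive z (e1 R) w (w1 z)) -> (forall z, is_derive z (e2 R) w (w2 z)) ->
  (forall z, is_derive z (e1 R) w1 (w11 z)) -> (forall z, is_derive z (e2 R) w2 (w22 z)) ->
  (forall z, is_derive z (e1 R) u (u1 z)) -> (forall z, is_derive z (e2 R) u (u2 z)) ->
  (forall z, is_derive z (e1 R) u1 (u11 z)) -> (forall z, is_derive z (e2 R) u2 (u22 z)) ->
  (forall z, is_derive z (e1 R) q (q1 z)) -> (forall z, is_derive z (e2 R) q (q2 z)) ->
  (forall z, is_derive z (e1 R) q1 (q11 z)) -> (forall z, is_derive z (e2 R) q2 (q22 z)) ->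
  periodic2 w -> periodic2 w1 -> periodic2 w2 ->
  periodic2 u -> periodic2 u1 -> periodic2 u2 ->
  periodic2 q -> periodic2 q1 -> periodic2 q2 ->
  (forall z, `|w z| <= W) -> (forall z, `|w1 z| <= W) -> (forall z, `|w2 z| <= W) ->
  (forall z, cell z -> q z = - nu * ((w11 z - u11 z) + (w22 z - u22 z)) +
     (w z ^+ 3 - w z) - (u z ^+ 3 - u z) + rho z) ->
  cint (fun z => (w z - u z) * (q11 z + q22 z)) <=
  (3 / 2 * W ^+ 2 + 9 / 2 * W ^+ 4 + 2 / nu) * cint (fun z => (w z - u z) ^+ 2) +
  (2 * nu)^-1 * cint (fun z => rho z ^+ 2).
Proof.
move=> nu0 W0 cw cw1 cw2 cw11 cw22 cu cu1 cu2 cu11 cu22 cq cq1 cq2 cq11 cq22 irho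
  dw1 dw2 dw11 dw22 du1 du2 du11 du22 dq1 dq2 dq11 dq22 pw pw1 pw2 pu pu1 pu2 pq pq1 pq2
  hw hw1 hw2 qE.
(* With e = w - u and F = w^3 - u^3 + e, this is one component of the flux e grad q - q grad e + F
   grad e. Its divergence is e Delta q - q Delta e + F Delta e + grad F . grad e, and [DX] is the
   matching summand. *)
pose X (wi ui qi : R * R -> R) z := (w z - u z) * qi z - q z * (wi z - ui z) +
  (w z ^+ 3 - u z ^+ 3 + (w z - u z)) * (wi z - ui z).
pose DX (wi ui wii uii qi qii : R * R -> R) z :=
  ((wi z - ui z) * qi z + (w z - u z) * qii z) -
  (qi z * (wi z - ui z) + q z * (wii z - uii z)) +
  ((3 * w z ^+ 2 * wi z - 3 * u z ^+ 2 * ui z + (wi z - ui z)) * (wi z - ui z) +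
   (w z ^+ 3 - u z ^+ 3 + (w z - u z)) * (wii z - uii z)).
have dX v wi ui wii uii qi qii : (forall z, is_derive z v w (wi z)) ->
    (forall z, is_derive z v u (ui z)) -> (forall z, is_derive z v wi (wii z)) ->
    (forall z, is_derive z v ui (uii z)) -> (forall z, is_derive z v q (qi z)) ->
    (forall z, is_derive z v qi (qii z)) ->
    forall z, is_derive z v (X wi ui qi) (DX wi ui wii uii qi qii z).
  move=> h1 h2 h3 h4 h5 h6 z.
  have he := is_derive_sub (h1 z) (h2 z); have hei := is_derive_sub (h3 z) (h4 z).
  apply: is_derive_add.
    by apply: is_derive_sub; apply: is_derive_mul.
  apply: is_derive_mul => //; apply: is_derive_add => //.
  by apply: is_derive_sub; exact: is_derive_cube.
have cM f g : continuous f -> continuous g -> continuous (fun z => f z * g z).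
  by move=> cf cg z; apply: cvgM; [exact: cf|exact: cg].
have cD f g : continuous f -> continuous g -> continuous (fun z => f z + g z).
  by move=> cf cg z; apply: cvgD; [exact: cf|exact: cg].
have cB f g : continuous f -> continuous g -> continuous (fun z => f z - g z).
  by move=> cf cg z; apply: cvgB; [exact: cf|exact: cg].
have cX f n : continuous f -> continuous (fun z => f z ^+ n).
  move=> cf; elim: n => [|n IH]; first by under eq_fun do rewrite expr0; move=> z; exact: cvg_cst.
  by under eq_fun do rewrite exprS; exact: cM.
have cc (c : R) : continuous (fun _ : R * R => c) by move=> z; exact: cvg_cst.
have cDX wi ui wii uii qi qii : continuous wi -> continuous ui -> continuous wii ->
    continuous uii -> continuous qi -> continuous qii -> continuous (DX wi ui wii uii qi qii).
  move=> h1 h2 h3 h4 h5 h6.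
  have e := cB _ _ cw cu; have ei := cB _ _ h1 h2; have eii := cB _ _ h3 h4.
  have t1 := cD _ _ (cM _ _ ei h5) (cM _ _ e h6).
  have t2 := cD _ _ (cM _ _ h5 ei) (cM _ _ cq eii).
  have sq f fi (cf : continuous f) (cfi : continuous fi) :=
    cM _ _ (cM _ _ (cc 3) (cX f 2%N cf)) cfi.
  have t3 := cM _ _ (cD _ _ (cB _ _ (sq w wi cw h1) (sq u ui cu h2)) ei) ei.
  have t4 := cM _ _ (cD _ _ (cB _ _ (cX w 3%N cw) (cX u 3%N cu)) e) eii.
  exact: (cD _ _ (cB _ _ t1 t2) (cD _ _ t3 t4)).
have pX wi ui qi : periodic2 wi -> periodic2 ui -> periodic2 qi -> periodic2 (X wi ui qi).
  move=> h1 h2 h3; have e := periodic2B pw pu; have ei := periodic2B h1 h2.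
  have t := periodic2D (periodic2B (periodic2X 3 pw) (periodic2X 3 pu)) e.
  exact: (periodic2D (periodic2B (periodic2M e h3) (periodic2M pq ei)) (periodic2M t ei)).
have I1 : cint (DX w1 u1 w11 u11 q1 q11) = 0.
  exact: (cint_D1 (dX _ _ _ _ _ _ _ dw1 du1 dw11 du11 dq1 dq11)
    (cDX _ _ _ _ _ _ cw1 cu1 cw11 cu11 cq1 cq11) (pX _ _ _ pw1 pu1 pq1)).
have I2 : cint (DX w2 u2 w22 u22 q2 q22) = 0.
  exact: (cint_D2 (dX _ _ _ _ _ _ _ dw2 du2 dw22 du22 dq2 dq22)
    (cDX _ _ _ _ _ _ cw2 cu2 cw22 cu22 cq2 cq22) (pX _ _ _ pw2 pu2 pq2)).
pose K := 3 / 2 * W ^+ 2 + 9 / 2 * W ^+ 4 + 2 / nu.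
have i1 : cintegrable (DX w1 u1 w11 u11 q1 q11) by apply: continuous_cintegrable; exact: cDX.
have i2 : cintegrable (DX w2 u2 w22 u22 q2 q22) by apply: continuous_cintegrable; exact: cDX.
have i3 : cintegrable (fun z => (w z - u z) ^+ 2).
  by apply: continuous_cintegrable; apply: cX; exact: cB.
have i4 : cintegrable (fun z => (w z - u z) * (q11 z + q22 z)).
  by apply: continuous_cintegrable; apply: cM; [exact: cB|exact: cD].
rewrite (@le_trans _ _ (cint (fun z => (DX w1 u1 w11 u11 q1 q11 z + DX w2 u2 w22 u22 q2 q22 z) +
   (K * (w z - u z) ^+ 2 + (2 * nu)^-1 * rho z ^+ 2))))//.
  apply: le_cint => //.
    by apply: cintegrableD; apply: cintegrableD => //; exact: cintegrableZ.
  move=> z cz.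
  have := @energy_pointwise nu W (w z) (u z) (w1 z) (u1 z) (w2 z) (u2 z) _ _ _
    nu0 W0 (hw z) (hw1 z) (hw2 z) (qE z cz).
  by rewrite -/K /DX; lra.
rewrite cintD; [|exact: cintegrableD|by apply: cintegrableD; exact: cintegrableZ].
rewrite cintD// I1 I2 !add0r cintD; [|exact: cintegrableZ..].
by rewrite !cintZ.
Qed.

End EnergyInequality.

(** * Calculus of smooth functions of the space variable *)

Section Smooth.
Context (R : realType).
Implicit Types (f g : R * R -> R) (z : R * R).
Local Notation cell := (@cell R).

(* All derivatives up to order n exist and are continuous; an inductive predicate
   does not unfold during unification, unlike a fixpoint on a literal order. *)
Inductive smooth : nat -> (R * R -> R) -> Prop :=
| smooth0 f : continuous f -> smooth 0 f
| smooth_succ n f : continuous f ->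
    (forall z, derivable f z (e1 R) /\ derivable f z (e2 R)) ->
    smooth n ('D_(e1 R) f) -> smooth n ('D_(e2 R) f) -> smooth n.+1 f.

Lemma smooth_continuous n f : smooth n f -> continuous f.
Proof. by case. Qed.

Lemma smooth_inv n f : smooth n.+1 f ->
  [/\ forall z, derivable f z (e1 R) /\ derivable f z (e2 R),
      smooth n ('D_(e1 R) f) & smooth n ('D_(e2 R) f)].
Proof. by move=> h; inversion h. Qed.

Lemma smoothS n f : smooth n.+1 f -> smooth n f.
Proof.
elim: n f => [|n IH] f sf; first by apply: smooth0; exact: smooth_continuous sf.
have [df s1 s2] := smooth_inv sf.
exact: (smooth_succ (smooth_continuous sf) df (IH _ s1) (IH _ s2)).
Qed.

Lemma smooth_le m n f : (m <= n)%N -> smooth n f -> smooth m f.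
Proof.
move=> /subnK <-; elim: (n - m)%N => // k IH; rewrite addSn => /smoothS; exact: IH.
Qed.

Lemma smooth_D1 n f : smooth n.+1 f -> smooth n ('D_(e1 R) f).
Proof. by case/smooth_inv. Qed.

Lemma smooth_D2 n f : smooth n.+1 f -> smooth n ('D_(e2 R) f).
Proof. by case/smooth_inv. Qed.

Lemma smooth_is_derive1 n f z : smooth n.+1 f -> is_derive z (e1 R) f ('D_(e1 R) f z).
Proof. by case/smooth_inv => /(_ z)[d _] _ _; apply: DeriveDef. Qed.

Lemma smooth_is_derive2 n f z : smooth n.+1 f -> is_derive z (e2 R) f ('D_(e2 R) f z).
Proof. by case/smooth_inv => /(_ z)[_ d] _ _; apply: DeriveDef. Qed.

Lemma derive_is_derive f f' v : (forall z, is_derive z v f (f' z)) -> 'D_v f = f'.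
Proof. by move=> h; apply/funext => z; have [_] := h z. Qed.

Lemma smooth_intro n f f1 f2 : continuous f ->
  (forall z, is_derive z (e1 R) f (f1 z)) -> (forall z, is_derive z (e2 R) f (f2 z)) ->
  smooth n f1 -> smooth n f2 -> smooth n.+1 f.
Proof.
move=> cf d1 d2 s1 s2.
have df z : derivable f z (e1 R) /\ derivable f z (e2 R).
  by split; [have [] := d1 z|have [] := d2 z].
have E1 := derive_is_derive d1; have E2 := derive_is_derive d2.
by apply: smooth_succ; rewrite ?E1 ?E2.
Qed.

Lemma smooth_cst n (c : R) : smooth n (fun=> c).
Proof.
elim: n c => [|n IH] c; first by apply: smooth0 => z; exact: cvg_cst.
have d v z : is_derive z v (fun=> c : R) 0 by exact: is_derive_cst.
have cc : continuous (fun _ : R * R => c) by move=> z; exact: cvg_cst.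
exact: (smooth_intro cc (d (e1 R)) (d (e2 R)) (IH 0) (IH 0)).
Qed.

Lemma smoothD n f g : smooth n f -> smooth n g -> smooth n (fun z => f z + g z).
Proof.
elim: n f g => [|n IH] f g sf sg.
  by apply: smooth0 => z; apply: cvgD; [exact: (smooth_continuous sf)|exact: (smooth_continuous sg)].
have cfg : continuous (fun z => f z + g z).
  by move=> z; apply: cvgD; [exact: (smooth_continuous sf)|exact: (smooth_continuous sg)].
have d1 z := is_derive_add (smooth_is_derive1 z sf) (smooth_is_derive1 z sg).
have d2 z := is_derive_add (smooth_is_derive2 z sf) (smooth_is_derive2 z sg).
have s1 := IH _ _ (smooth_D1 sf) (smooth_D1 sg).
have s2 := IH _ _ (smooth_D2 sf) (smooth_D2 sg).
exact: (smooth_intro cfg d1 d2 s1 s2).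
Qed.

Lemma smoothM n f g : smooth n f -> smooth n g -> smooth n (fun z => f z * g z).
Proof.
elim: n f g => [|n IH] f g sf sg.
  by apply: smooth0 => z; apply: cvgM; [exact: (smooth_continuous sf)|exact: (smooth_continuous sg)].
have cfg : continuous (fun z => f z * g z).
  by move=> z; apply: cvgM; [exact: (smooth_continuous sf)|exact: (smooth_continuous sg)].
have d1 z := is_derive_mul (smooth_is_derive1 z sf) (smooth_is_derive1 z sg).
have d2 z := is_derive_mul (smooth_is_derive2 z sf) (smooth_is_derive2 z sg).
have s1 := smoothD (IH _ _ (smooth_D1 sf) (smoothS sg)) (IH _ _ (smoothS sf) (smooth_D1 sg)).
have s2 := smoothD (IH _ _ (smooth_D2 sf) (smoothS sg)) (IH _ _ (smoothS sf) (smooth_D2 sg)).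
exact: (smooth_intro cfg d1 d2 s1 s2).
Qed.

Lemma smoothZ n f (c : R) : smooth n f -> smooth n (fun z => c * f z).
Proof. by move=> sf; apply: smoothM; [exact: smooth_cst|exact: sf]. Qed.

Lemma smoothB n f g : smooth n f -> smooth n g -> smooth n (fun z => f z - g z).
Proof.
move=> sf sg; have := smoothD sf (smoothZ (-1) sg).
by under [in X in X -> _]eq_fun do rewrite mulN1r.
Qed.

Lemma smooth_cube n f : smooth n f -> smooth n (fun z => f z ^+ 3).
Proof.
by move=> sf; under eq_fun do rewrite !exprS expr0 mulr1; apply: smoothM; [exact: sf|apply: smoothM; exact: sf].
Qed.

Lemma smooth_laplacian n f : smooth n.+2 f -> smooth n (laplacian f).
Proof.
move=> sf; apply: smoothD.
  exact/smooth_D1/smooth_D1.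
exact/smooth_D2/smooth_D2.
Qed.

Lemma pos_time_continuous (v : R -> R * R -> R) t : 0 < t -> continuous_pos_time v ->
  continuous (v t).
Proof.
move=> t0 cv z; have cp : {for z, continuous (fun z : R * R => (t, z))}.
  by apply: (@cvg_pair _ _ _ (nbhs z) (nbhs t) (nbhs z)); [exact: cvg_cst|exact: cvg_id].
exact: (@continuous_comp _ _ _ (fun z => (t, z)) (fun p => v p.1 p.2) z cp (cv t z t0)).
Qed.

Lemma space_C_smooth n (v : R -> R * R -> R) t : 0 < t -> space_C n v -> smooth n (v t).
Proof.
move=> t0; elim: n v => [|n IH] v.
  by move=> [cv _]; apply: smooth0; exact: (pos_time_continuous t0 cv).
move=> [cv [dv s1 s2]]; apply: smooth_succ; first exact: (pos_time_continuous t0 cv).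
- by move=> z; exact: dv.
- exact: (IH _ s1).
- exact: (IH _ s2).
Qed.

Lemma periodic2_derive f v : periodic2 f -> periodic2 ('D_v f).
Proof.
move=> pf x y.
have per1 (a : R * R) : f (a.1 + pi *+ 2, a.2) = f a by case: a => a b; exact: (pf a b).1.
have per2 (a : R * R) : f (a.1, a.2 + pi *+ 2) = f a by case: a => a b; exact: (pf a b).2.
have E1 : (fun h => h^-1 *: ((f \o shift (x + pi *+ 2, y)) (h *: v) - f (x + pi *+ 2, y))) =
    (fun h : R => h^-1 *: ((f \o shift (x, y)) (h *: v) - f (x, y))).
  apply/funext => h; rewrite (per1 (x, y)) /=; congr (_ *: (_ - _)).
  by rewrite -[RHS]per1; congr f; apply: injective_projections; rewrite //= addrA.
have E2 : (fun h => h^-1 *: ((f \o shift (x, y + pi *+ 2)) (h *: v) - f (x, y + pi *+ 2))) =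
    (fun h : R => h^-1 *: ((f \o shift (x, y)) (h *: v) - f (x, y))).
  apply/funext => h; rewrite (per2 (x, y)) /=; congr (_ *: (_ - _)).
  by rewrite -[RHS]per2; congr f; apply: injective_projections; rewrite //= addrA.
by split; rewrite /derive ?E1 ?E2.
Qed.

Lemma periodic2_laplacian f : periodic2 f -> periodic2 (laplacian f).
Proof.
move=> pf.
exact: (periodic2D (periodic2_derive _ (periodic2_derive _ pf)) (periodic2_derive _ (periodic2_derive _ pf))).
Qed.

Lemma periodic2Z (c : R) f : periodic2 f -> periodic2 (fun z => c * f z).
Proof. by move=> pf x y; rewrite !(pf x y).1 !(pf x y).2. Qed.

(** The function q of [energy_inequality] is the difference of the two chemical potentials, and the
    residual is the amount by which G fails to be the nonlinearity evaluated at w. *)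
Lemma energy_smooth (nu W : R) w u G : 0 < nu -> 0 <= W ->
  smooth 4 w -> smooth 4 u -> smooth 2 G -> periodic2 w -> periodic2 u -> periodic2 G ->
  (forall z, `|w z| <= W) -> (forall z, `|'D_(e1 R) w z| <= W) ->
  (forall z, `|'D_(e2 R) w z| <= W) ->
  cint (fun z => (w z - u z) *
    (laplacian (fun x => - nu * laplacian w x + G x) z -
     laplacian (fun x => - nu * laplacian u x + u x ^+ 3 - u x) z)) <=
  (3 / 2 * W ^+ 2 + 9 / 2 * W ^+ 4 + 2 / nu) * cint (fun z => (w z - u z) ^+ 2) +
  (2 * nu)^-1 * cint (fun z => (G z - (w z ^+ 3 - w z)) ^+ 2).
Proof.
move=> nu0 W0 sw su sG pw pu pG hw hw1 hw2.
set A := fun x => - nu * laplacian w x + G x.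
set B := fun x => - nu * laplacian u x + u x ^+ 3 - u x.
have sw2 : smooth 2 w by exact: (@smooth_le 2 4 w isT sw).
have su2 : smooth 2 u by exact: (@smooth_le 2 4 u isT su).
have sA : smooth 2 A by exact: (smoothD (smoothZ (- nu) (smooth_laplacian sw)) sG).
have sB : smooth 2 B.
  exact: (smoothB (smoothD (smoothZ (- nu) (smooth_laplacian su)) (smooth_cube su2)) su2).
have pA : periodic2 A by exact: (periodic2D (periodic2Z (- nu) (periodic2_laplacian pw)) pG).
have pB : periodic2 B.
  exact: (periodic2B (periodic2D (periodic2Z (- nu) (periodic2_laplacian pu)) (periodic2X 3 pu)) pu).
have s11 f n : smooth n.+2 f -> continuous ('D_(e1 R) ('D_(e1 R) f)).
  by move=> sf; apply: (@smooth_continuous n); do 2 apply: smooth_D1.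
have s22 f n : smooth n.+2 f -> continuous ('D_(e2 R) ('D_(e2 R) f)).
  by move=> sf; apply: (@smooth_continuous n); do 2 apply: smooth_D2.
have s1 f n : smooth n.+1 f -> continuous ('D_(e1 R) f).
  by move=> sf; apply: (@smooth_continuous n); apply: smooth_D1.
have s2 f n : smooth n.+1 f -> continuous ('D_(e2 R) f).
  by move=> sf; apply: (@smooth_continuous n); apply: smooth_D2.
have cB f g : continuous f -> continuous g -> continuous (fun z => f z - g z).
  by move=> cf cg z; apply: cvgB; [exact: cf|exact: cg].
have irho : cintegrable (fun z => (G z - (w z ^+ 3 - w z)) ^+ 2).
  apply: continuous_cintegrable; apply: (@smooth_continuous 2).
  under eq_fun do rewrite expr2.
  have sr : smooth 2 (fun z => G z - (w z ^+ 3 - w z)).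
    exact: (smoothB sG (smoothB (smooth_cube sw2) sw2)).
  exact: (smoothM sr sr).
have -> : (fun z => (w z - u z) * (laplacian A z - laplacian B z)) =
   (fun z => (w z - u z) * (('D_(e1 R) ('D_(e1 R) A) z - 'D_(e1 R) ('D_(e1 R) B) z) +
     ('D_(e2 R) ('D_(e2 R) A) z - 'D_(e2 R) ('D_(e2 R) B) z))).
  by apply/funext => z; congr (_ * _); rewrite /laplacian opprD addrACA.
have qE z : cell z -> A z - B z =
    - nu * (('D_(e1 R) ('D_(e1 R) w) z - 'D_(e1 R) ('D_(e1 R) u) z) +
            ('D_(e2 R) ('D_(e2 R) w) z - 'D_(e2 R) ('D_(e2 R) u) z)) +
    (w z ^+ 3 - w z) - (u z ^+ 3 - u z) + (G z - (w z ^+ 3 - w z)).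
  move=> _; rewrite /A /B /laplacian.
  move: ('D_(e1 R) ('D_(e1 R) w) z) ('D_(e2 R) ('D_(e2 R) w) z) ('D_(e1 R) ('D_(e1 R) u) z)
    ('D_(e2 R) ('D_(e2 R) u) z) (w z) (u z) (G z) => a b c d x y g.
  by ring.
have dAB1 z := is_derive_sub (smooth_is_derive1 z sA) (smooth_is_derive1 z sB).
have dAB2 z := is_derive_sub (smooth_is_derive2 z sA) (smooth_is_derive2 z sB).
have dAB11 z := is_derive_sub (smooth_is_derive1 z (smooth_D1 sA)) (smooth_is_derive1 z (smooth_D1 sB)).
have dAB22 z := is_derive_sub (smooth_is_derive2 z (smooth_D2 sA)) (smooth_is_derive2 z (smooth_D2 sB)).
exact: (@energy_inequality R nu W _ _ _ _ _ _ _ _ _ _ _ _ _ _ _ _ nu0 W0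
  (smooth_continuous sw) (s1 _ _ sw) (s2 _ _ sw) (s11 _ _ sw) (s22 _ _ sw)
  (smooth_continuous su) (s1 _ _ su) (s2 _ _ su) (s11 _ _ su) (s22 _ _ su)
  (cB _ _ (smooth_continuous sA) (smooth_continuous sB))
  (cB _ _ (s1 _ _ sA) (s1 _ _ sB)) (cB _ _ (s2 _ _ sA) (s2 _ _ sB))
  (cB _ _ (s11 _ _ sA) (s11 _ _ sB)) (cB _ _ (s22 _ _ sA) (s22 _ _ sB))
  irho
  (fun z => smooth_is_derive1 z sw) (fun z => smooth_is_derive2 z sw)
  (fun z => smooth_is_derive1 z (smooth_D1 sw)) (fun z => smooth_is_derive2 z (smooth_D2 sw))
  (fun z => smooth_is_derive1 z su) (fun z => smooth_is_derive2 z su)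
  (fun z => smooth_is_derive1 z (smooth_D1 su)) (fun z => smooth_is_derive2 z (smooth_D2 su))
  dAB1 dAB2 dAB11 dAB22
  pw (periodic2_derive _ pw) (periodic2_derive _ pw) pu (periodic2_derive _ pu)
  (periodic2_derive _ pu) (periodic2B pA pB)
  (periodic2B (periodic2_derive _ pA) (periodic2_derive _ pB))
  (periodic2B (periodic2_derive _ pA) (periodic2_derive _ pB)) hw hw1 hw2 qE).
Qed.

End Smooth.

(** * Time derivative of the energy and Gronwall's inequality *)

Section TimeDerivative.
Context (R : realType).
Implicit Types (z : R * R).
Local Notation cell := (@cell R).

Lemma energy_is_derive (v dv : R -> R * R -> R) (t p q B : R) : p < t < q ->
  (forall s, p < s < q -> continuous (v s)) ->
  (forall s z, p < s < q -> is_derive s 1 (v ^~ z) (dv s z)) ->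
  (forall s z, p < s < q -> cell z -> `|v s z| <= B) ->
  (forall s z, p < s < q -> cell z -> `|dv s z| <= B) ->
  is_derive t 1 (fun s => cint (fun z => v s z ^+ 2)) 
    (cint (fun z => 2 * (v t z * dv t z))).
Proof.
move=> ptq cv dvE vB dvB.
have B0 : 0 <= B by apply: le_trans (vB t (0, 0) ptq _); rewrite // /cell/= !in_itv/=;
  have := pi_ge0 R; lra.
have Ipq s : `]p, q[%classic s <-> p < s < q by rewrite /= in_itv.
have It : `]p, q[%classic t by apply/Ipq.
pose f s z := v s z ^+ 2.
have intf s : `]p, q[%classic s -> cintegrable (f s).
  move=> /Ipq hs; apply: continuous_cintegrable; rewrite /f; under eq_fun do rewrite expr2.
  by move=> z; apply: cvgM; exact: cv.
have dfE s z : `]p, q[%classic s -> is_derive s 1 (f ^~ z) (2 * (v s z * dv s z)).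
  move=> /Ipq hs; have d := dvE s z hs; rewrite /f.
  have -> : (fun x => v x z ^+ 2) = (fun x => v x z * v x z) by apply/funext => x; rewrite expr2.
  by refine (is_derive_eq (is_deriveM d d) _); rewrite /GRing.scale/=; ring.
have df s z : `]p, q[%classic s -> cell z -> derivable (f ^~ z) s 1.
  by move=> hs _; have [] := dfE s z hs.
have dfE' s z : `]p, q[%classic s -> partial1of2 f s z = 2 * (v s z * dv s z).
  by move=> hs; rewrite partial1of2E; have [_] := dfE s z hs.
have G0 z : 0 <= (fun _ : R * R => 2 * (B * B)) z by rewrite /= !mulr_ge0.
have iG : cintegrable (fun _ : R * R => 2 * (B * B)).
  by apply: continuous_cintegrable => z; exact: cvg_cst.
have dG s z : `]p, q[%classic s -> cell z -> `|partial1of2 f s z| <= 2 * (B * B).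
  move=> hs cz; rewrite dfE'// !normrM ger0_norm// ler_wpM2l// ler_pM//.
    by apply: vB => //; exact/Ipq.
  by apply: dvB => //; exact/Ipq.
have der := derivable_under_integral (@measurable_cell R) It intf df G0 iG dG.
have E := differentiation_under_integral (@measurable_cell R) It intf df G0 iG dG.
apply: DeriveDef; first exact: der.
rewrite -derive1E E; apply: eq_cint => z _; exact: dfE'.
Qed.

Lemma energy_continuous (v : R -> R * R -> R) (t p q B : R) : p < t < q ->
  (forall s, p < s < q -> continuous (v s)) ->
  (forall s z, p < s < q -> {for s, continuous (v ^~ z)}) ->
  (forall s z, p < s < q -> cell z -> `|v s z| <= B) ->
  {for t, continuous (fun s => cint (fun z => v s z ^+ 2))}.
Proof.
move=> ptq cv cvt vB.
have Ipq s : `]p, q[%classic s <-> p < s < q by rewrite /= in_itv.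
pose f s z := v s z ^+ 2.
have intf s : `]p, q[%classic s -> cintegrable (f s).
  move=> /Ipq hs; apply: continuous_cintegrable; rewrite /f; under eq_fun do rewrite expr2.
  by move=> z; apply: cvgM; exact: cv.
have iG : cintegrable (fun _ : R * R => B * B).
  by apply: continuous_cintegrable => z; exact: cvg_cst.
apply: (@continuity_under_integral _ _ _ (lebesgue2 R) f _ (@measurable_cell R) p q intf _ _ iG).
- apply: aeW => z cz s /set_mem /Ipq hs; rewrite /f.
  have -> : (fun x => v x z ^+ 2) = (fun x => v x z * v x z) by apply/funext => x; rewrite expr2.
  by apply: cvgM; exact: cvt.
- move=> s /Ipq hs; apply: aeW => z cz; rewrite /f normrX expr2.
  by have := vB s z hs cz => h; exact: ler_pM.
- by apply/mem_set/Ipq.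
Qed.

(** The function exp(-K t) E - P t has derivative exp(-K t) (E' - K E) - P <= (exp(-K t) - 1) P <=
    0, since t >= a >= 0. Written with absolute times, the inequality telescopes over consecutive
    steps. *)
Lemma gronwall_step (E dE : R -> R) (a b K P : R) : 0 <= a -> a <= b -> 0 <= K -> 0 <= P ->
  {within `[a, b], continuous E} ->
  (forall t, a < t < b -> is_derive t 1 E (dE t)) ->
  (forall t, a < t < b -> dE t <= K * E t + P) ->
  expR (- (K * b)) * E b - P * b <= expR (- (K * a)) * E a - P * a.
Proof.
move=> a0 ab K0 P0 cE dEE hE.
pose H t := expR (- (K * t)) * E t - P * t.
pose dH t := (expR (- (K * t)) * (- K)) * E t + expR (- (K * t)) * dE t - P.
have dexp (t : R) : is_derive t 1 (fun s => expR (- (K * s))) (expR (- (K * t)) * (- K)).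
  have d1 : is_derive t 1 (fun s : R => - (K * s)) (- K).
    apply: is_derive_eq; rewrite ?scaler0 ?add0r ?addr0 /GRing.scale/=; ring.
  exact: is_derive1_comp.
have dlin (t : R) : is_derive t 1 (fun s => P * s) P.
  by apply: is_derive_eq; rewrite ?scaler0 ?add0r ?addr0 /GRing.scale/=; ring.
have dHE t : a < t < b -> is_derive t 1 H (dH t).
  move=> h; have d := is_deriveB (is_deriveM (dexp t) (dEE t h)) (dlin t).
  by refine (is_derive_eq d _); rewrite /dH /GRing.scale/=; ring.
have cexp : continuous (fun t : R => expR (- (K * t))).
  by move=> t; apply: differentiable_continuous; apply/derivable1_diffP; have [] := dexp t.
have clin : continuous (fun t : R => P * t).
  by move=> t; apply: differentiable_continuous; apply/derivable1_diffP; have [] := dlin t.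
have cH : {within `[a, b], continuous H}.
  move=> t; apply: cvgB; last exact: (continuous_subspaceT clin).
  apply: cvgM; last exact: cE.
  exact: (continuous_subspaceT cexp).
have [ab'|] := ltP a b; last first.
  by move=> ba; have -> : a = b by apply/eqP; rewrite eq_le ab ba.
apply: (@ler0_derive1_le_cc R H a b) => //.
- by move=> t; rewrite in_itv/= => h; have [] := dHE t h.
- move=> t; rewrite in_itv/= => h; rewrite derive1E; have [_ ->] := dHE t h.
  have t0 : 0 <= t by case/andP: h => h1 _; rewrite (le_trans a0)// ltW.
  have e0 := expR_gt0 (- (K * t)).
  have e1 : expR (- (K * t)) <= 1.
    by rewrite -expR0 ler_expR oppr_le0 mulr_ge0.
  have := hE t h; rewrite /dH; move: (expR _) e0 e1 (E t) (dE t) => x x0 x1 y dy hy.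
  have : x * dy <= x * (K * y + P) by rewrite ler_wpM2l// ltW.
  have : x * P <= P by rewrite ler_piMl.
  lra.
- by rewrite in_itv/= lexx ltW.
- by rewrite in_itv/= lexx ltW.
Qed.

Lemma compact_bounded_fun (T : topologicalType) (K : set T) (f : T -> R) : compact K ->
  (forall x, K x -> {for x, continuous f}) -> exists2 M, 0 <= M & forall x, K x -> `|f x| <= M.
Proof.
move=> cK cf.
have cf' : {within K, continuous f} by apply: continuous_in_subspaceT => x /set_mem; exact: cf.
have /compact_bounded[M [_ fM]] := continuous_compact cf' cK.
exists (`|M| + 1) => [|x Kx]; first by rewrite addr_ge0.
apply: (fM (`|M| + 1)); first by rewrite ltr_pwDr// ler_norm.
by exists x.
Qed.

(** Freezing u at its initial value for negative times gives a function continuous on the whole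
    space, so that two-sided neighbourhoods of t = 0 cause no trouble when a step starts there. *)
Lemma continuous_clip_time (u : R -> R * R -> R) :
  {within [set p : R * (R * R) | 0 <= p.1], continuous (fun p : R * (R * R) => u p.1 p.2)} ->
  continuous (fun p : R * (R * R) => u (Num.max p.1 0) p.2).
Proof.
move=> /subspace_continuousP cu p.
pose g (p : R * (R * R)) : R * (R * R) := (Num.max p.1 0, p.2).
have cg : g @ p --> g p.
  apply: (@cvg_pair _ _ _ (nbhs p) (nbhs (Num.max p.1 0)) (nbhs p.2)); last exact: cvg_snd.
  apply: (@continuous_comp _ _ _ fst (fun x : R => Num.max x 0)); first exact: cvg_fst.
  by apply: (@continuous_max R R id (fun=> 0)); [exact: cvg_id|exact: cvg_cst].
have gp : [set p : R * (R * R) | 0 <= p.1] (g p) by rewrite /= le_max lexx orbT.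
move=> V /(cu _ gp); rewrite /fmap /= /within /= => hV.
have h : nbhs p [set y | 0 <= (g y).1 -> V (u (g y).1 (g y).2)] := cg _ hV.
apply: (@filterS _ (nbhs p) _ _ _ _ h) => y /=; apply.
by rewrite le_max lexx orbT.
Qed.

End TimeDerivative.

(** * Growth of the error over one step, for an abstract interpolant *)

Section SolutionStep.
Context (R : realType).
Implicit Types (z : R * R).
Local Notation cell := (@cell R).

(** The energy inequality is applied at each interior time, then [gronwall_step] on [a, a + tau].
    The bound M on the time derivative of w serves to differentiate under the integral sign, so the
    conclusion involves only W and Q. The factor 2 in K comes from differentiating the square. *)
Lemma solution_step (nu W Q M a tau K : R) (u0 : R * R -> R) (u w G : R -> R * R -> R) :
  0 < nu -> 0 <= W -> 0 <= Q -> 0 <= a -> 0 < tau -> CH_solution nu u0 u ->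
  (forall s, continuous (w s)) -> (forall z, continuous (w ^~ z)) ->
  (forall s z, `|w s z| <= W) ->
  (forall s, 0 < s < tau -> smooth 4 (w s)) -> (forall s, 0 < s < tau -> smooth 2 (G s)) ->
  (forall s, 0 < s < tau -> periodic2 (w s)) -> (forall s, 0 < s < tau -> periodic2 (G s)) ->
  (forall s z, 0 < s < tau -> `|'D_(e1 R) (w s) z| <= W) ->
  (forall s z, 0 < s < tau -> `|'D_(e2 R) (w s) z| <= W) ->
  (forall s z, 0 < s < tau ->
     is_derive s 1 (w ^~ z) (laplacian (fun x => - nu * laplacian (w s) x + G s x) z)) ->
  (forall s z, 0 < s < tau ->
     `|laplacian (fun x => - nu * laplacian (w s) x + G s x) z| <= M) ->
  (forall s, 0 < s < tau -> cint (fun z => (G s z - (w s z ^+ 3 - w s z)) ^+ 2) <= Q) ->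
  K = 2 * (3 / 2 * W ^+ 2 + 9 / 2 * W ^+ 4 + 2 / nu) ->
  expR (- (K * (a + tau))) * cint (fun z => (w tau z - u (a + tau) z) ^+ 2) - Q / nu * (a + tau) <=
  expR (- (K * a)) * cint (fun z => (w 0 z - u a z) ^+ 2) - Q / nu * a.
Proof.
move=> nu0 W0 Q0 a0 tau0 [[pu cu su [du cdu]] eqn _] cw cwt hW sw sG pw pG hw1 hw2 dw hM hQ KE.
pose ut (t : R) z := u (Num.max t 0) z.
have cut : continuous (fun p : R * (R * R) => ut p.1 p.2) by exact: continuous_clip_time.
have utE t : 0 <= t -> ut t = u t by move=> t0; rewrite /ut max_l.
have cutz t : continuous (ut t).
  move=> z; have cp : {for z, continuous (fun z : R * R => (t, z))}.
    by apply: (@cvg_pair _ _ _ (nbhs z) (nbhs t) (nbhs z)); [exact: cvg_cst|exact: cvg_id].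
  exact: (@continuous_comp _ _ _ (fun z => (t, z)) (fun p => ut p.1 p.2) z cp (cut _)).
have cutt z : continuous (ut ^~ z).
  move=> t; have cp : {for t, continuous (fun t : R => (t, z))}.
    by apply: (@cvg_pair _ _ _ (nbhs t) (nbhs t) (nbhs z)); [exact: cvg_id|exact: cvg_cst].
  exact: (@continuous_comp _ _ _ (fun t => (t, z)) (fun p => ut p.1 p.2) t cp (cut _)).
have compact_box (x y : R) : compact (`[x, y]%classic `*` cell).
  by apply: compact_setX; [exact: segment_compact|exact: compact_cell].
pose v t z := w (t - a) z - ut t z.
have cv t : continuous (v t).
  by move=> z; apply: cvgB; [exact: cw|exact: cutz].
have cshift : continuous (fun t : R => t - a).
  by move=> t; apply: cvgB; [exact: cvg_id|exact: cvg_cst].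
have cvt z : continuous (v ^~ z).
  move=> t; apply: cvgB; last exact: cutt.
  exact: (@continuous_comp _ _ _ (fun t => t - a) (w ^~ z) t (cshift t) (cwt z _)).
(* The margin 1 on both sides makes the endpoints of the step interior, as [energy_continuous]
   requires. *)
have [U U0 hU] := compact_bounded_fun (compact_box (a - 1) (a + tau + 1)) (fun x _ => cut x).
have vB t z : a - 1 < t < a + tau + 1 -> cell z -> `|v t z| <= W + U.
  move=> /andP[t1 t2] cz; rewrite (le_trans (ler_normB _ _))// lerD//.
  apply: (hU (t, z)); split => //=; rewrite in_itv/=.
  by rewrite !ltW.
pose E t := cint (fun z => v t z ^+ 2).
have cE : {within `[a, a + tau], continuous E}.
  apply: continuous_in_subspaceT => t /set_mem; rewrite /= in_itv /= => /andP[t1 t2].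
  apply: (@energy_continuous R v t (a - 1) (a + tau + 1) (W + U)) => //; first by lra.
  by move=> s z _; exact: cvt.
pose A t := fun x => - nu * laplacian (w (t - a)) x + G (t - a) x.
pose B t := fun x => - nu * laplacian (u t) x + u t x ^+ 3 - u t x.
pose dv t z := laplacian (A t) z - laplacian (B t) z.
have sub t : a < t < a + tau -> 0 < t - a < tau by lra.
have dvE t z : a < t < a + tau -> is_derive t 1 (v ^~ z) (dv t z).
  move=> /[dup] ht /andP[t1 t2]; have t0 : 0 < t by rewrite (le_lt_trans a0).
  apply: is_deriveB.
    have ds : is_derive t 1 (fun t : R => t - a) 1.
      by apply: is_derive_eq; rewrite subr0.
    have d := @is_derive1_comp R (w ^~ z) (fun t => t - a) t _ _ (dw (t - a) z (sub t ht)) ds.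
    by refine (is_derive_eq d _); rewrite mulr1.
  apply: (@near_eq_is_derive _ _ _ (u ^~ z)).
    near=> s; rewrite utE//; near: s.
    by exists t => //= s; rewrite /ball/= ltr_norml; lra.
  by apply: DeriveDef; [exact: (du t z t0)|rewrite -derive1E; exact: eqn].
have dEE t : a < t < a + tau -> is_derive t 1 E (cint (fun z => 2 * (v t z * dv t z))).
  move=> /[dup] ht /andP[t1 t2].
  (* If a = 0, the time derivative of u may be unbounded near the start of the step; to the right of
     [al] > 0 it is bounded by compactness. *)
  pose al := (a + t) / 2.
  have al0 : 0 < al by rewrite /al; lra.
  have cf (x : R * (R * R)) : (`[al, a + tau]%classic `*` cell) x ->
      {for x, continuous (fun p => derive1 (fun s => u s p.2) p.1)}.
    case: x => s z [/=]; rewrite in_itv/= => /andP[h _] _.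
    exact: (cdu s z (lt_le_trans al0 h)).
  have [N N0 hN] := compact_bounded_fun (compact_box al (a + tau)) cf.
  apply: (@energy_is_derive R v dv t al (a + tau) (W + U + (M + N))).
  - by rewrite /al; lra.
  - by move=> s _; exact: cv.
  - by move=> s z hs; apply: dvE; move: hs; rewrite /al; lra.
  - move=> s z hs cz; rewrite (le_trans (vB s z _ cz))//; first by move: hs; rewrite /al; lra.
    rewrite lerDl addr_ge0//.
    (* An arbitrary time inside the step, from which M >= 0 follows. *)
    have hs' : 0 < tau / 2 < tau by lra.
    by rewrite (le_trans _ (hM _ z hs')).
  - move=> s z hs cz; have hs1 : a < s < a + tau by move: hs; rewrite /al; lra.
    have s0 : 0 < s by lra.
    rewrite (@le_trans _ _ (M + N))//; last by rewrite lerDr addr_ge0.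
    rewrite (le_trans (ler_normB _ _))// lerD//; first exact: (hM _ z (sub s hs1)).
    rewrite /B -eqn//; apply: (hN (s, z)); split => //=; rewrite in_itv/=; lra.
have hE t : a < t < a + tau -> cint (fun z => 2 * (v t z * dv t z)) <= K * E t + Q / nu.
  move=> /[dup] ht /andP[t1 t2]; have t0 : 0 < t by rewrite (le_lt_trans a0).
  have hs := sub t ht.
  have sut : smooth 4 (u t) by exact: (space_C_smooth t0 su).
  have vE z : v t z = w (t - a) z - u t z by rewrite /v utE// ltW.
  have en := @energy_smooth R nu W (w (t - a)) (u t) (G (t - a)) nu0 W0 (sw _ hs) sut (sG _ hs)
    (pw _ hs) (pu t (ltW t0)) (pG _ hs) (hW _) (fun z => hw1 _ z hs) (fun z => hw2 _ z hs).
  have sA : smooth 2 (A t).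
    exact: (smoothD (smoothZ (- nu) (smooth_laplacian (sw _ hs))) (sG _ hs)).
  have su2 : smooth 2 (u t) by exact: (@smooth_le R 2 4 _ isT sut).
  have sB : smooth 2 (B t).
    exact: (smoothB (smoothD (smoothZ (- nu) (smooth_laplacian sut)) (smooth_cube su2)) su2).
  have cdv : continuous (dv t).
    exact: (smooth_continuous (smoothB (smooth_laplacian sA) (smooth_laplacian sB))).
  rewrite cintZ; last first.
    by apply: continuous_cintegrable => z; apply: cvgM; [exact: cv|exact: cdv].
  have -> : E t = cint (fun z => (w (t - a) z - u t z) ^+ 2).
    by apply: eq_cint => z _; rewrite vE.
  have -> : cint (fun z => v t z * dv t z) = cint (fun z => (w (t - a) z - u t z) *
      (laplacian (A t) z - laplacian (B t) z)).
    by apply: eq_cint => z _; rewrite vE.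
  have hq := hQ _ hs.
  rewrite (le_trans (ler_wpM2l _ en))// KE.
  rewrite mulrDr mulrA lerD2l mulrA (_ : 2 * (2 * nu)^-1 = nu^-1); last first.
    by field; rewrite gt_eqF.
  by rewrite (mulrC Q) ler_wpM2l// invr_ge0 ltW.
have K0 : 0 <= K.
  rewrite KE mulr_ge0// !addr_ge0// ?mulr_ge0 ?exprn_ge0//.
  by rewrite invr_ge0 ltW.
have Qn : 0 <= Q / nu by rewrite divr_ge0// ltW.
have at' : a <= a + tau by rewrite lerDl ltW.
have := gronwall_step a0 at' K0 Qn cE dEE hE.
have -> : E (a + tau) = cint (fun z => (w tau z - u (a + tau) z) ^+ 2).
  by apply: eq_cint => z _; rewrite /v addrAC subrr add0r utE// addr_ge0// ltW.
have -> // : E a = cint (fun z => (w 0 z - u a z) ^+ 2).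
by apply: eq_cint => z _; rewrite /v subrr utE.
Unshelve. all: by end_near. Qed.

End SolutionStep.

(** * Numerical solution *)

Section SobolevBound.
Context (R : realType).
Local Notation weight := (@weight R).
Local Open Scope ereal_scope.

Let c (n : nat) : R := ((1 + n%:R ^+ 2)^-1)%R.

(** Telescoping comparison 1 / (1 + n^2) <= 4 / ((n + 1) (n + 2)), which amounts to 3 n^2 - 3 n + 2
    >= 0. *)
Lemma sum_inv_sqr_le (N : nat) : (\sum_(0 <= n < N) (1 + n%:R ^+ 2)^-1 <= 4 - 4 / N.+1%:R :> R)%R.
Proof.
elim: N => [|N IH]; first by rewrite big_nil divr1 subrr.
rewrite big_nat_recr//= (le_trans (lerD IH (lexx _)))//.
have n0 : (0 <= N%:R :> R)%R by [].
rewrite -(natr1 N.+1) -(natr1 N); move: (N%:R : R)%R n0 => x x0.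
have p1 : (0 < x + 1)%R by lra.
have p2 : (0 < x + 1 + 1)%R by lra.
have p3 : (0 < 1 + x ^+ 2)%R by rewrite ltr_pwDl// sqr_ge0.
rewrite -subr_ge0 (_ : _ - _ =
  (3 * x ^+ 2 - 3 * x + 2) / ((x + 1) * (x + 1 + 1) * (1 + x ^+ 2)))%R; last first.
  by field; rewrite !gt_eqF.
rewrite divr_ge0 ?mulr_ge0// ?(ltW p1) ?(ltW p2) ?(ltW p3)//.
by have := sqr_ge0 (2 * x - 1)%R; have := sqr_ge0 x; nra.
Qed.

Lemma esum_nat_inv_sqr_le : \esum_(n in [set: nat]) (c n)%:E <= 4%:E.
Proof.
have c0 n : 0 <= (c n)%:E by rewrite lee_fin invr_ge0 addr_ge0// sqr_ge0.
rewrite -nneseries_esumT//; apply: lime_le; first exact: is_cvg_nneseries.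
apply: nearW => N; rewrite sumEFin lee_fin (le_trans (sum_inv_sqr_le N))//.
by rewrite lerBlDr lerDl divr_ge0.
Qed.

Let ci (m : int) : R := ((1 + m%:~R ^+ 2)^-1)%R.

(** The nonnegative and the negative integers contribute at most 4 each: [Negz n] is -(n + 1), whose
    square dominates n^2. *)
Lemma esum_int_inv_sqr_le : \esum_(m in [set: int]) (ci m)%:E <= 8%:E.
Proof.
have c0 m : 0 <= (ci m)%:E by rewrite lee_fin invr_ge0 addr_ge0// sqr_ge0.
rewrite (esumID (range Posz))// !setTI.
rewrite (_ : ~` range Posz = range Negz); last first.
  apply/seteqP; split=> [[n /= h|n _ /=]|_ [n _ <-] [m _]//]; last by exists n.
  by case: h; exists n.
rewrite !esum_image//; try by move=> x y _ _ [].
rewrite [leRHS](_ : _ = 4%:E + 4%:E); last by rewrite -EFinD; congr EFin; ring.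
apply: leeD; first exact: esum_nat_inv_sqr_le.
apply: le_trans esum_nat_inv_sqr_le; apply: le_esum => n _; rewrite lee_fin /ci /c.
rewrite lef_pV2 ?posrE ?ltr_pwDl ?sqr_ge0// lerD2l NegzE mulrNz sqrrN -pmulrn.
by rewrite lerXn2r ?nnegrE// ler_nat.
Qed.

(** Since (1 + x^2 + y^2)^2 >= (1 + x^2) (1 + y^2), the double sum is bounded by a product of two
    one-dimensional sums, whence 64 = 8 * 8. *)
Lemma lnorm_weightN2_le : lnorm (fun k => weight k ^- 2)%R <= 64%:E.
Proof.
have c0 m : (0 <= ci m)%R by rewrite invr_ge0 addr_ge0// sqr_ge0.
apply: (@le_trans _ _ (\esum_(k in [set: int] `*`` (fun=> [set: int]))
    ((ci k.1)%:E * (ci k.2)%:E))).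
  rewrite (_ : _ `*`` _ = setT); last by apply/seteqP; split.
  apply: le_esum => k _; rewrite -EFinM lee_fin.
  rewrite ger0_norm ?invr_ge0 ?exprn_ge0 ?(ltW (weight_gt0 _ _))//.
  rewrite /ci -invfM lef_pV2 ?posrE ?exprn_gt0 ?weight_gt0//.
    rewrite !weightE /sqnorm; move: (k.1%:~R : R)%R (k.2%:~R : R)%R => x y.
    have := sqr_ge0 x; have := sqr_ge0 y; have := sqr_ge0 (x * y)%R.
    have := sqr_ge0 (x * x)%R; have := sqr_ge0 (y * y)%R; nra.
  by rewrite mulr_gt0// ltr_pwDl// sqr_ge0.
rewrite -(@esum_esum R int int [set: int] (fun=> [set: int]) (fun i j => (ci i)%:E * (ci j)%:E)); last first.
  by move=> i j _ _; rewrite -EFinM lee_fin mulr_ge0.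
have cfin (d : R) : (0 <= d)%R ->
    \esum_(j in [set: int]) (d%:E * (ci j)%:E) <= (d * 8)%:E.
  move=> d0.
  apply: ge_ereal_sup => _ [X [finX _] <-].
  rewrite -ge0_mule_fsumr; last by move=> j; rewrite lee_fin.
  rewrite EFinM lee_wpmul2l ?lee_fin//; apply: le_trans esum_int_inv_sqr_le.
  by apply: ereal_sup_ubound; exists X.
apply: (@le_trans _ _ (\esum_(i in [set: int]) (8%:E * (ci i)%:E))).
  by apply: le_esum => i _; rewrite -EFinM mulrC; exact: cfin.
by rewrite (le_trans (cfin 8%R _))// lee_fin -natrM.
Qed.

Lemma fourierE (f : R * R -> R) k : fourier f k = Complex (fcos f k) (- fsin f k)%R.
Proof.
rewrite /fourier /fcos /fsin -/(cint _) -/(cint _).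
by apply/eqP; rewrite eq_complex /=; apply/andP; split; apply/eqP; ring.
Qed.

(** Termwise, w^3 |x| <= (w^8 x^2 + w^(-2)) / 2; the exponent 8 = 2 * 3 + 2 leaves the summable
    w^(-2). Adding the inequalities for the cosine and sine coefficients gives the constant 64 in
    full and one half of the Sobolev sum. *)
Lemma sobolev_wnorm_le (f : R * R -> R) (M : R) : (sobolev_sqnorm 8 f <= M%:E) ->
  wnorm 3 (fcoef f) <= ((2 * (pi *+ 2) ^+ 2)^-1 * M + 64)%:E.
Proof.
move=> hM.
have P0 : (0 < (pi *+ 2) ^+ 2 :> R)%R by rewrite exprn_gt0// mulrn_wgt0// pi_gt0.
pose T k := ((pi *+ 2) ^+ 2 * weight k ^+ 8 * (fcos f k ^+ 2 + fsin f k ^+ 2))%R.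
have T0 k : (0 <= T k)%R.
  rewrite /T mulr_ge0 ?addr_ge0 ?sqr_ge0// mulr_ge0 ?(ltW P0)// exprn_ge0//.
  exact/ltW/weight_gt0.
have sT : (lnorm T <= M%:E).
  apply: le_trans hM; apply: le_esum => k _; rewrite lee_fin ger0_norm// /T.
  rewrite fourierE /ComplexField.Normc.normc /= sqr_sqrtr ?addr_ge0 ?sqr_ge0//.
  by rewrite sqrrN.
have fT : lsummable T by rewrite /lsummable (le_lt_trans sT)// ltry.
have s64 := lnorm_weightN2_le.
have fW : lsummable (fun k => weight k ^- 2)%R by rewrite /lsummable (le_lt_trans s64)// ltry.
have W0 k : (0 <= weight k ^- 2)%R by rewrite invr_ge0 exprn_ge0// ltW// weight_gt0.
pose B k := ((2 * (pi *+ 2) ^+ 2)^-1 * T k + weight k ^- 2)%R.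
have q0 : (0 <= (2 * (pi *+ 2) ^+ 2)^-1 :> R)%R by rewrite invr_ge0 mulr_ge0// ltW.
have B0 k : (0 <= B k)%R by rewrite addr_ge0// mulr_ge0.
have fB : lsummable B by apply: lsummableD => //; exact: lsummableZ.
apply: (@le_trans _ _ (lnorm B)).
  apply: le_lnorm => k.
  have w0 := weight_gt0 R k.
  have wB : (weight k ^+ 3 * fcoef f k <= B k)%R.
    rewrite /B /T /fcoef; move: (weight k) w0 (fcos f k) (fsin f k) => w w0 x y.
    rewrite -(real_normK (num_real x)) -(real_normK (num_real y)).
    move: (normr_ge0 x) (normr_ge0 y); move: `|x|%R `|y|%R => {}x {}y x0 y0.
    rewrite -subr_ge0 (_ : _ - _ = 2^-1 * ((w ^+ 4 * x - w ^- 1) ^+ 2 + (w ^+ 4 * y - w ^- 1) ^+ 2))%R.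
      by rewrite mulr_ge0// addr_ge0// sqr_ge0.
    move: ((pi *+ 2) ^+ 2)%R P0 => P P0.
    by field; rewrite !gt_eqF.
  rewrite ger0_norm ?(ger0_norm (B0 k))// mulr_ge0// ?weight_expr_ge0//.
  exact: fcoef_ge0.
rewrite -fine_lnorm// -lsum_abs lee_fin (@eq_lsum _ _ B); last first.
  by move=> k; rewrite ger0_norm.
rewrite lsumD//; last exact: lsummableZ.
have T1 : (lsum T <= M)%R.
  rewrite -lee_fin (le_trans _ sT)// -fine_lnorm// -lsum_abs lee_fin le_eqVlt.
  by apply/orP; left; apply/eqP; apply: eq_lsum => k; rewrite ger0_norm.
have W1 : (lsum (fun k => weight k ^- 2) <= 64)%R.
  rewrite -lee_fin (le_trans _ s64)// -fine_lnorm// -lsum_abs lee_fin le_eqVlt.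
  by apply/orP; left; apply/eqP; apply: eq_lsum => k; rewrite ger0_norm.
by rewrite lerD// lsumZ// ler_wpM2l.
Qed.

End SobolevBound.

(** * Smoothness and derivatives of Fourier series *)

Section SynthesisSmooth.
Context (R : realType).
Implicit Types (a b : int * int -> R) (z : R * R).
Local Notation weight := (@weight R).

(* Square root of [weight], up to a constant: a derivative costs one factor. *)
Definition rweight (k : int * int) : R := 1 + `|k.1%:~R| + `|k.2%:~R|.

Lemma rweight_ge1 k : 1 <= rweight k.
Proof. by rewrite /rweight -addrA lerDl addr_ge0. Qed.

Lemma rweight_sqr_le k : rweight k ^+ 2 <= 3 * weight k.
Proof.
rewrite /rweight !weightE /sqnorm -(real_normK (num_real k.1%:~R)).
rewrite -(real_normK (num_real k.2%:~R)); move: `|k.1%:~R : R| `|k.2%:~R : R| => x y.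
by have := sqr_ge0 (x - y); have := sqr_ge0 (x - 1); have := sqr_ge0 (y - 1); nra.
Qed.

Lemma wsummable_rweight p a : wsummable p a -> lsummable (fun k => rweight k ^+ (2 * p) * a k).
Proof.
move=> sa; apply: (le_lsummable _ (lsummableZ (3 ^+ p) sa)) => k.
have r0 : 0 <= rweight k by rewrite (le_trans _ (rweight_ge1 k)).
rewrite !normrM mulrA ler_wpM2r// ger0_norm ?exprn_ge0//.
rewrite (ger0_norm (exprn_ge0 p (ltW (weight_gt0 R k)))) ger0_norm ?exprn_ge0//.
rewrite exprM -exprMn lerXn2r ?nnegrE ?exprn_ge0//; last exact: rweight_sqr_le.
by rewrite mulr_ge0// ltW// weight_gt0.
Qed.

(** Induction on the order: a derivative multiplies the coefficients by k.1 or k.2, both bounded by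
    [rweight k], and exchanges the two families. *)
Lemma synth_smooth n a b : lsummable (fun k => rweight k ^+ n * a k) ->
  lsummable (fun k => rweight k ^+ n * b k) -> smooth n (synth a b).
Proof.
have dom m c (x : int * int -> R) : (forall k, `|x k| <= rweight k) ->
    lsummable (fun k => rweight k ^+ m.+1 * c k) ->
    lsummable (fun k => rweight k ^+ m * (x k * c k)).
  move=> hx; apply: le_lsummable => k.
  have r0 : 0 <= rweight k by rewrite (le_trans _ (rweight_ge1 k)).
  by rewrite !normrM exprSr normrM -!mulrA ler_wpM2l// ler_wpM2r// (le_trans (hx k))// ler_norm.
have low m c : lsummable (fun k => rweight k ^+ m * c k) -> lsummable c.
  apply: le_lsummable => k; rewrite normrM ler_peMl// ger0_norm ?exprn_ege1 ?rweight_ge1//.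
  by rewrite exprn_ge0// (le_trans _ (rweight_ge1 k)).
have x1 k : `|k.1%:~R| <= rweight k by rewrite /rweight -addrA addrCA lerDl addr_ge0.
have x2 k : `|k.2%:~R| <= rweight k by rewrite /rweight addrC lerDl addr_ge0.
have neg m c : lsummable (fun k => rweight k ^+ m * c k) ->
    lsummable (fun k => rweight k ^+ m * - c k).
  by apply: le_lsummable => k; rewrite mulrN normrN.
have one c m (x : int * int -> R) : (forall k, `|x k| <= rweight k) ->
    lsummable (fun k => rweight k ^+ m.+1 * c k) -> lsummable (fun k => x k * c k).
  by move=> hx h; apply: (low m); exact: dom.
elim: n a b => [|n IH] a b sa sb.
  by apply: smooth0; apply: synth_continuous; [exact: low sa|exact: low sb].
have la := low _ _ sa; have lb := low _ _ sb.
have d1 z := synth_is_derive1 z la lb (one _ _ _ x1 sa) (one _ _ _ x1 sb).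
have d2 z := synth_is_derive2 z la lb (one _ _ _ x2 sa) (one _ _ _ x2 sb).
apply: (smooth_intro (synth_continuous la lb) d1 d2); apply: IH.
- exact: dom.
- by apply: neg; exact: dom.
- exact: dom.
- by apply: neg; exact: dom.
Qed.

Lemma derive1_synth a b : wsummable 1 a -> wsummable 1 b ->
  'D_(e1 R) (synth a b) = synth (fun k => k.1%:~R * b k) (fun k => - (k.1%:~R * a k)).
Proof.
move=> sa sb.
have h (c : int * int -> R) : wsummable 1 c -> lsummable (fun k => k.1%:~R * c k).
  move=> sc; have hm k : weight k ^+ 0 * `|k.1%:~R| <= weight k ^+ 1.
    by rewrite expr0 mul1r expr1 normr_fst_le_weight.
  exact: (wsummable0 (wsummable_dom hm sc)).
apply: derive_is_derive => z; apply: synth_is_derive1; [| |exact: h|exact: h].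
  exact: wsummable_lsummable sa.
exact: wsummable_lsummable sb.
Qed.

Lemma derive2_synth a b : wsummable 1 a -> wsummable 1 b ->
  'D_(e2 R) (synth a b) = synth (fun k => k.2%:~R * b k) (fun k => - (k.2%:~R * a k)).
Proof.
move=> sa sb.
have h (c : int * int -> R) : wsummable 1 c -> lsummable (fun k => k.2%:~R * c k).
  move=> sc; have hm k : weight k ^+ 0 * `|k.2%:~R| <= weight k ^+ 1.
    by rewrite expr0 mul1r expr1 normr_snd_le_weight.
  exact: (wsummable0 (wsummable_dom hm sc)).
apply: derive_is_derive => z; apply: synth_is_derive2; [| |exact: h|exact: h].
  exact: wsummable_lsummable sa.
exact: wsummable_lsummable sb.
Qed.

Lemma synth_lin (c : R) a b a' b' z : lsummable a -> lsummable b -> lsummable a' -> lsummable b' ->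
  c * synth a b z + synth a' b' z = synth (fun k => c * a k + a' k) (fun k => c * b k + b' k) z.
Proof.
move=> sa sb sa' sb'; rewrite /synth -lsumZ; last exact: synth_summable.
rewrite -lsumD; [|by apply: lsummableZ; exact: synth_summable|exact: synth_summable].
by apply: eq_lsum => k; ring.
Qed.

Lemma laplacian_synth a b z : wsummable 1 a -> wsummable 1 b ->
  laplacian (synth a b) z = synth (fun k => - sqnorm R k * a k) (fun k => - sqnorm R k * b k) z.
Proof.
move=> sa sb; have la := wsummable_lsummable sa; have lb := wsummable_lsummable sb.
have one (x c : int * int -> R) : (forall k, `|x k| <= weight k) -> wsummable 1 c ->
    lsummable (fun k => x k * c k).
  move=> hx sc; have hm k : weight k ^+ 0 * `|x k| <= weight k ^+ 1.
    by rewrite expr0 mul1r expr1.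
  exact: (wsummable0 (wsummable_dom hm sc)).
have two (x c : int * int -> R) : (forall k, `|x k * x k| <= weight k) -> wsummable 1 c ->
    lsummable (fun k => x k * (x k * c k)).
  move=> hx sc; have := one _ _ hx sc; apply: le_lsummable => k.
  by rewrite !normrM !mulrA.
have x1 := @normr_fst_le_weight R; have x2 := @normr_snd_le_weight R.
have y1 k : `|k.1%:~R * k.1%:~R| <= weight k.
  rewrite -expr2 ger0_norm ?sqr_ge0// !weightE /sqnorm.
  by have := sqr_ge0 (k.2%:~R : R); lra.
have y2 k : `|k.2%:~R * k.2%:~R| <= weight k.
  rewrite -expr2 ger0_norm ?sqr_ge0// !weightE /sqnorm.
  by have := sqr_ge0 (k.1%:~R : R); lra.
have n1 (x c : int * int -> R) : lsummable (fun k => x k * c k) ->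
    lsummable (fun k => x k * - c k).
  by apply: le_lsummable => k; rewrite mulrN normrN.
have d1 := synth_is_derive1 z (one _ _ x1 sb) (lsummableN (one _ _ x1 sa))
  (two _ _ y1 sb) (n1 _ _ (two _ _ y1 sa)).
have d2 := synth_is_derive2 z (one _ _ x2 sb) (lsummableN (one _ _ x2 sa))
  (two _ _ y2 sb) (n1 _ _ (two _ _ y2 sa)).
transitivity (synth (fun k => k.1%:~R * - (k.1%:~R * a k)) (fun k => - (k.1%:~R * (k.1%:~R * b k))) z +
    synth (fun k => k.2%:~R * - (k.2%:~R * a k)) (fun k => - (k.2%:~R * (k.2%:~R * b k))) z).
  congr (_ + _).
    have := congr1 (fun f => 'D_(e1 R) f z) (derive1_synth sa sb).
    by case: d1 => _ E1 E2; exact: (etrans E2 E1).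
  have := congr1 (fun f => 'D_(e2 R) f z) (derive2_synth sa sb).
  by case: d2 => _ E1 E2; exact: (etrans E2 E1).
rewrite /synth -lsumD.
- by apply: eq_lsum => k; rewrite /sqnorm; ring.
- apply: synth_summable; first exact: n1 (two _ _ y1 sa).
  exact: lsummableN (two _ _ y1 sb).
- apply: synth_summable; first exact: n1 (two _ _ y2 sa).
  exact: lsummableN (two _ _ y2 sb).
Qed.

End SynthesisSmooth.

(** * The interpolant of one step and its consistency error *)

Section Interpolant.
Context (R : realType) (nu tau T A B : R) (a b g h : int * int -> R).
Implicit Types (k : int * int) (s : R) (z : R * R) (c d : int * int -> R).
Local Notation weight := (@weight R).
Local Notation q := (@sqnorm R).

Hypothesis nu_gt0 : 0 < nu.
Hypothesis tau_gt0 : 0 < tau.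
Hypothesis tau_le : tau <= T.
Hypothesis abA : (wnorm 3 (fun k => `|a k| + `|b k|)%R <= A%:E)%E.
Hypothesis ghB : (wnorm 3 (fun k => `|g k| + `|h k|)%R <= B%:E)%E.

Definition decay s k : R := expR (- (s * nu * q k ^+ 2)).
Definition duhamel s c d k : R := decay s k * (c k - s * (q k * d k)).
(** The derivative of [duhamel] in s. Differentiating the factor [decay] reproduces -nu Delta^2 w,
    while the explicit s leaves Delta applied to S_L(s) f(u^n); this is why [numforce] carries the
    factor [decay]. *)
Definition dduhamel s c d k : R :=
  - (nu * q k ^+ 2) * duhamel s c d k - q k * (decay s k * d k).

(* [numflow s] is S_L(s) S_N(s) applied to the function with coefficients
   (a, b), when (g, h) are the coefficients of its nonlinear term. *)
Definition numflow s : R * R -> R := synth (duhamel s a g) (duhamel s b h).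
Definition numforce s : R * R -> R :=
  synth (fun k => decay s k * g k) (fun k => decay s k * h k).

Let N1 k : R := `|a k| + `|b k|.
Let N2 k : R := `|g k| + `|h k|.
(** Majorant of the coefficients of the interpolant, uniform over the step. The Laplacian in S_N
    costs one weight, so three weights on the nonlinear term leave two on S: enough for four space
    derivatives. *)
Let S k : R := N1 k + T * (weight k * N2 k).

Let T_gt0 : 0 < T. Proof. exact: lt_le_trans tau_gt0 tau_le. Qed.

Lemma decay_gt0 s k : 0 < decay s k. Proof. exact: expR_gt0. Qed.

Lemma decay_le1 s k : 0 <= s -> decay s k <= 1.
Proof.
move=> s0; rewrite -expR0 ler_expR oppr_le0 mulr_ge0//; last exact: sqr_ge0.
by apply: mulr_ge0 => //; exact: ltW.
Qed.

Lemma onem_decay_le s k : 0 <= s -> 1 - decay s k <= s * (nu * weight k ^+ 2).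
Proof.
move=> s0; have := expR_ge1Dx (- (s * nu * q k ^+ 2)); rewrite -/(decay s k) => h1.
have : q k ^+ 2 <= weight k ^+ 2.
  by rewrite lerXn2r ?nnegrE ?sqnorm_ge0 ?(ltW (weight_gt0 _ _))// lerDr.
move=> h2; have : s * (nu * q k ^+ 2) <= s * (nu * weight k ^+ 2).
  by rewrite ler_wpM2l// ler_wpM2l// ltW.
by move: h1; rewrite mulrA; lra.
Qed.

Lemma sqnorm_le_weight k : q k <= weight k. Proof. by rewrite lerDr. Qed.

Lemma weight_ge0 k : 0 <= weight k. Proof. exact/ltW/weight_gt0. Qed.

Lemma duhamel_le s c d k : 0 <= s <= tau ->
  `|duhamel s c d k| <= `|c k| + T * (weight k * `|d k|).
Proof.
move=> /andP[s0 st]; rewrite normrM (ger0_norm (ltW (decay_gt0 s k))).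
rewrite (le_trans (ler_piMl _ (decay_le1 k s0)))// (le_trans (ler_normB _ _))// lerD//.
rewrite !normrM (ger0_norm s0) (ger0_norm (sqnorm_ge0 R k)).
apply: ler_pM => //; first by rewrite mulr_ge0// sqnorm_ge0.
  exact: le_trans st tau_le.
by rewrite ler_wpM2r// sqnorm_le_weight.
Qed.

Lemma duhamel_pair_le s k : 0 <= s <= tau -> `|duhamel s a g k| + `|duhamel s b h k| <= S k.
Proof.
move=> hs; rewrite (le_trans (lerD (duhamel_le a g k hs) (duhamel_le b h k hs)))//.
by rewrite /S /N1 /N2 !mulrDr; lra.
Qed.

Lemma wsummable_N1 : wsummable 3 N1. Proof. exact: le_lt_trans abA (ltry _). Qed.
Lemma wsummable_N2 : wsummable 3 N2. Proof. exact: le_lt_trans ghB (ltry _). Qed.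

Lemma N1_ge0 k : 0 <= N1 k. Proof. by rewrite addr_ge0. Qed.
Lemma N2_ge0 k : 0 <= N2 k. Proof. by rewrite addr_ge0. Qed.

Lemma lsum_weighted_le p c (C : R) : (p <= 3)%N -> (forall k, 0 <= c k) ->
  (wnorm 3 c <= C%:E)%E ->
  lsummable (fun k => weight k ^+ p * c k) /\ lsum (fun k => weight k ^+ p * c k) <= C.
Proof.
move=> p3 c0 hC; have s3 : wsummable 3 c by exact: le_lt_trans hC (ltry _).
have sp := wsummableW p3 s3; split => //.
rewrite (@le_trans _ _ (lsum (fun k => weight k ^+ 3 * c k)))//.
  by apply: le_lsum => // k; rewrite ler_wpM2r// ler_weXn2l// weight_ge1.
rewrite -lee_fin; apply: le_trans hC; rewrite /wnorm -(fine_lnorm s3) -lsum_abs lee_fin.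
by apply: le_lsum => //; [exact: lsummable_abs | move=> k; exact: ler_norm].
Qed.

Lemma S_weighted p : (p <= 2)%N ->
  lsummable (fun k => weight k ^+ p * S k) /\ lsum (fun k => weight k ^+ p * S k) <= A + T * B.
Proof.
move=> p2; have [s1 e1] := lsum_weighted_le (leq_trans p2 (isT : (2 <= 3)%N)) N1_ge0 abA.
have [s2 e2] := @lsum_weighted_le p.+1 N2 B p2 N2_ge0 ghB.
have E : (fun k => weight k ^+ p * S k) =
    fun k => weight k ^+ p * N1 k + T * (weight k ^+ p.+1 * N2 k).
  by apply/funext => k; rewrite /S exprSr; ring.
rewrite E; split; first by apply: lsummableD => //; exact: lsummableZ.
rewrite lsumD//; last exact: lsummableZ.
by rewrite lsumZ// lerD// ler_wpM2l// ltW.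
Qed.

Lemma S_ge0 k : 0 <= S k.
Proof.
by rewrite /S addr_ge0 ?N1_ge0// mulr_ge0 ?(ltW T_gt0)// mulr_ge0 ?N2_ge0// weight_ge0.
Qed.

Lemma wsummable_S p : (p <= 2)%N -> wsummable p S.
Proof. by move=> p2; have [] := S_weighted p2. Qed.

Lemma wsummable_le p c d : (forall k, `|c k| <= d k) -> wsummable p d -> wsummable p c.
Proof.
move=> cd; apply: le_lsummable => k; rewrite !normrM ler_wpM2l// (le_trans (cd k))//.
exact: ler_norm.
Qed.

Lemma wsummable_duhamel p s : (p <= 2)%N -> 0 <= s <= tau ->
  wsummable p (duhamel s a g) /\ wsummable p (duhamel s b h).
Proof.
move=> p2 hs; split; apply: wsummable_le (wsummable_S p2) => k;
  by apply: le_trans (duhamel_pair_le k hs); rewrite ?lerDl ?lerDr.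
Qed.

Lemma wsummable_force p s : (p <= 3)%N -> 0 <= s ->
  wsummable p (fun k => decay s k * g k) /\ wsummable p (fun k => decay s k * h k).
Proof.
move=> p3 s0; have s2 := wsummableW p3 wsummable_N2.
split; apply: wsummable_le s2 => k; rewrite normrM (ger0_norm (ltW (decay_gt0 s k)));
  by rewrite (le_trans (ler_piMl _ (decay_le1 k s0)))// ?lerDl ?lerDr.
Qed.

Let W : R := A + T * B.

Lemma W_ge0 : 0 <= W.
Proof.
have [_] := @S_weighted 0 isT; apply: le_trans; apply: lsum_ge0 => k.
by rewrite expr0 mul1r S_ge0.
Qed.

Lemma numflow_le s z : 0 <= s <= tau -> `|numflow s z| <= W.
Proof.
move=> hs; have [s0 e0] := @S_weighted 0 isT.
apply: le_trans e0; apply: normr_synth_le => // k.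
by rewrite expr0 mul1r duhamel_pair_le.
Qed.

Let derive_bound (x c d : int * int -> R) z : (forall k, `|x k| <= weight k) ->
  (forall k, `|c k| + `|d k| <= S k) ->
  `|synth (fun k => x k * d k) (fun k => - (x k * c k)) z| <= W.
Proof.
move=> hx hcd; have [s1 e1] := @S_weighted 1 isT.
apply: le_trans e1; apply: normr_synth_le => // k.
by rewrite normrN !normrM -mulrDr addrC expr1 ler_pM.
Qed.

Lemma derive1_numflow_le s z : 0 <= s <= tau -> `|'D_(e1 R) (numflow s) z| <= W.
Proof.
move=> hs; have [sa sb] := @wsummable_duhamel 1 s isT hs.
have -> := congr1 (fun f => f z) (derive1_synth sa sb).
apply: derive_bound => k; first exact: normr_fst_le_weight.
exact: duhamel_pair_le.
Qed.

Lemma derive2_numflow_le s z : 0 <= s <= tau -> `|'D_(e2 R) (numflow s) z| <= W.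
Proof.
move=> hs; have [sa sb] := @wsummable_duhamel 1 s isT hs.
have -> := congr1 (fun f => f z) (derive2_synth sa sb).
apply: derive_bound => k; first exact: normr_snd_le_weight.
exact: duhamel_pair_le.
Qed.

Lemma numflow_smooth s : 0 <= s <= tau -> smooth 4 (numflow s).
Proof.
move=> hs; have [sa sb] := @wsummable_duhamel 2 s isT hs.
exact: (@synth_smooth R 4 _ _ (wsummable_rweight sa) (wsummable_rweight sb)).
Qed.

Lemma numforce_smooth s : 0 <= s -> smooth 2 (numforce s).
Proof.
move=> hs; have [sa sb] := @wsummable_force 1 s isT hs.
exact: (@synth_smooth R 2 _ _ (wsummable_rweight sa) (wsummable_rweight sb)).
Qed.

(** Majorant of the coefficients of the time derivative. Delta^2 costs two weights on S, that is,
    three on the nonlinear term, the maximum that the hypotheses provide. *)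
Let dbound k : R := nu * (weight k ^+ 2 * S k) + weight k ^+ 3 * N2 k.

Lemma dduhamel_le s k : 0 <= s <= tau ->
  `|dduhamel s a g k| + `|dduhamel s b h k| <= dbound k.
Proof.
move=> hs; have s0 : 0 <= s by case/andP: hs.
have one c d : `|dduhamel s c d k| <=
    nu * (weight k ^+ 2 * `|duhamel s c d k|) + weight k ^+ 3 * `|d k|.
  rewrite /dduhamel; move: (duhamel s c d k) => D.
  rewrite (le_trans (ler_normB _ _))// !normrM normrN normrM (ger0_norm (ltW nu_gt0)).
  rewrite (ger0_norm (sqr_ge0 _)) (ger0_norm (sqnorm_ge0 R k)) (ger0_norm (ltW (decay_gt0 s k))).
  apply: lerD.
    rewrite -mulrA ler_wpM2l ?(ltW nu_gt0)// ler_wpM2r//.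
    by rewrite lerXn2r ?nnegrE ?sqnorm_ge0 ?weight_ge0// sqnorm_le_weight.
  rewrite ler_pM ?sqnorm_ge0 ?mulr_ge0 ?(ltW (decay_gt0 s k))//.
    rewrite (le_trans (sqnorm_le_weight k))// -[leLHS]expr1.
    by rewrite ler_weXn2l// weight_ge1.
  by rewrite ler_piMl// decay_le1.
rewrite (le_trans (lerD (one a g) (one b h)))// /dbound /N2 mulrDr.
have : nu * (weight k ^+ 2 * (`|duhamel s a g k| + `|duhamel s b h k|)) <=
    nu * (weight k ^+ 2 * S k).
  by rewrite ler_wpM2l ?(ltW nu_gt0)// ler_wpM2l ?sqr_ge0// duhamel_pair_le.
by rewrite !mulrDr; lra.
Qed.

Lemma dbound_summable : lsummable dbound.
Proof.
have [s2 _] := @S_weighted 2 isT; have [s3 _] := @lsum_weighted_le 3 N2 B isT N2_ge0 ghB.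
by apply: lsummableD => //; exact: lsummableZ.
Qed.

Lemma is_derive_duhamel s c d k :
  is_derive s 1 (fun s => duhamel s c d k) (dduhamel s c d k).
Proof.
have d1 : is_derive s 1 (fun s : R => - (s * nu * q k ^+ 2)) (- (nu * q k ^+ 2)).
  rewrite (_ : (fun s => _) = (fun s => (- (nu * q k ^+ 2)) * s)); last first.
    by apply/funext => x; ring.
  by apply: is_derive_eq; rewrite ?scaler0 ?add0r ?addr0 /GRing.scale/= mulr1.
have d2 : is_derive s 1 (fun s => decay s k) (decay s k * - (nu * q k ^+ 2)).
  exact: is_derive1_comp.
have d3 : is_derive s 1 (fun s : R => c k - s * (q k * d k)) (- (q k * d k)).
  have dc (m : R) : is_derive s 1 (cst m : R -> R) 0 by exact: is_derive_cst.
  have D := is_deriveB (dc (c k)) (is_deriveM (is_derive_id s 1) (dc (q k * d k))).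
  by refine (is_derive_eq D _); rewrite /GRing.scale/=; ring.
have D := is_deriveM d2 d3.
by refine (is_derive_eq D _); rewrite /dduhamel /duhamel /GRing.scale/=; ring.
Qed.

Let numflow_term_derive s k z :
  is_derive s 1 (fun s => duhamel s a g k * cos (dotk k z) + duhamel s b h k * sin (dotk k z))
    (dduhamel s a g k * cos (dotk k z) + dduhamel s b h k * sin (dotk k z)).
Proof.
have dc (m : R) : is_derive s 1 (cst m : R -> R) 0 by exact: is_derive_cst.
have D := is_deriveD (is_deriveM (is_derive_duhamel s a g k) (dc (cos (dotk k z))))
  (is_deriveM (is_derive_duhamel s b h k) (dc (sin (dotk k z)))).
by refine (is_derive_eq D _); rewrite /GRing.scale/=; ring.
Qed.

(** Together with [is_derive_numflow], this says that the interpolant solves a Cahn-Hilliard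
    equation whose nonlinear term is frozen at the start of the step and smoothed by S_L(s). *)
Lemma laplacian_numflow s z : 0 <= s <= tau ->
  laplacian (fun x => - nu * laplacian (numflow s) x + numforce s x) z =
  synth (dduhamel s a g) (dduhamel s b h) z.
Proof.
move=> hs; have s0 : 0 <= s by case/andP: hs.
have [sa sb] := @wsummable_duhamel 2 s isT hs.
have [sf sg] := @wsummable_force 1 s isT s0.
have qs c : wsummable 2 c -> wsummable 1 (fun k => - q k * c k).
  move=> sc; have hm k : weight k ^+ 1 * `|- q k| <= weight k ^+ 2.
    by rewrite expr1 expr2 normrN (ger0_norm (sqnorm_ge0 R k)) ler_wpM2l ?weight_ge0 ?sqnorm_le_weight.
  exact: (wsummable_dom hm sc).
have nus c : wsummable 1 c -> wsummable 1 (fun k => - nu * c k).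
  by move=> sc; apply: (le_lsummable _ (lsummableZ (- nu) sc)) => k; rewrite mulrCA.
have sa1 := wsummableW (isT : (1 <= 2)%N) sa; have sb1 := wsummableW (isT : (1 <= 2)%N) sb.
have -> : (fun x => - nu * laplacian (numflow s) x + numforce s x) =
    synth (fun k => - nu * (- q k * duhamel s a g k) + decay s k * g k)
          (fun k => - nu * (- q k * duhamel s b h k) + decay s k * h k).
  apply/funext => x; have -> := laplacian_synth x sa1 sb1.
  have := synth_lin (- nu) x (wsummable_lsummable (qs _ sa)) (wsummable_lsummable (qs _ sb))
    (wsummable_lsummable sf) (wsummable_lsummable sg).
  exact.
have E := laplacian_synth z (wsummableD (nus _ (qs _ sa)) sf) (wsummableD (nus _ (qs _ sb)) sg).
rewrite {}E; congr (synth _ _ z); apply/funext => k; rewrite /dduhamel; ring.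
Qed.

Lemma is_derive_numflow s z : 0 < s < tau ->
  is_derive s 1 (fun s => numflow s z) (synth (dduhamel s a g) (dduhamel s b h) z).
Proof.
move=> hs; pose F s k := duhamel s a g k * cos (dotk k z) + duhamel s b h k * sin (dotk k z).
pose dF s k := dduhamel s a g k * cos (dotk k z) + dduhamel s b h k * sin (dotk k z).
apply: (@lsum_is_derive R F dF dbound s 0 tau hs _ _ dbound_summable).
- move=> x /andP[x0 xt]; have hx : 0 <= x <= tau by rewrite !ltW.
  have [sa sb] := @wsummable_duhamel 0 x isT hx.
  by apply: synth_summable; exact: wsummable0.
- by move=> x k _; exact: numflow_term_derive.
- move=> x k /andP[x0 xt]; have hx : 0 <= x <= tau by rewrite !ltW.
  by rewrite (le_trans (synth_term_le _ _ _ _))// dduhamel_le.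
Qed.

Lemma dnumflow_le s z : 0 <= s <= tau ->
  `|synth (dduhamel s a g) (dduhamel s b h) z| <= lsum dbound.
Proof.
move=> hs; apply: normr_synth_le dbound_summable => k; exact: dduhamel_le.
Qed.

Lemma numforce_sub_le s z : 0 <= s <= tau ->
  `|numforce s z - synth g h z| <= s * (nu * B).
Proof.
move=> /andP[s0 st]; have [sf sg] := @wsummable_force 0 s isT s0.
have [s2 e2] := @lsum_weighted_le 2 N2 B isT N2_ge0 ghB.
have sN2 := wsummable_lsummable wsummable_N2.
have lg : lsummable g by apply: (lsummable_le _ sN2) => k; rewrite lerDl.
have lh : lsummable h by apply: (lsummable_le _ sN2) => k; rewrite lerDr.
rewrite /numforce synthB//; [|exact: wsummable0|exact: wsummable0].
apply: (@le_trans _ _ (lsum (fun k => s * nu * (weight k ^+ 2 * N2 k)))).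
  apply: normr_synth_le => [k|]; last exact: lsummableZ.
  have e1 (c : R) : `|decay s k * c - c| <= s * nu * (weight k ^+ 2 * `|c|).
    rewrite -[X in _ - X]mul1r -mulrBl normrM distrC (@ger0_norm _ (1 - decay s k)) ?subr_ge0 ?decay_le1//.
    by rewrite (le_trans (ler_wpM2r _ (onem_decay_le k s0)))// -!mulrA.
  by rewrite /N2 !mulrDr lerD// ?e1.
rewrite lsumZ// -mulrA ler_wpM2l// ler_wpM2l// ltW//.
Qed.

(** The displacement from the start of the step has two parts: the linear decay of the initial
    coefficients, of size s nu A, and the explicit nonlinear increment, of size s B. *)
Lemma numflow_sub_le s z : 0 <= s <= tau ->
  `|numflow s z - synth a b z| <= s * (nu * A + B).
Proof.
move=> hs; have /andP[s0 st] := hs; have [sa sb] := @wsummable_duhamel 0 s isT hs.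
have [s1 e1] := @lsum_weighted_le 2 N1 A isT N1_ge0 abA.
have [s2 e2] := @lsum_weighted_le 1 N2 B isT N2_ge0 ghB.
have sN1 := wsummable_lsummable wsummable_N1.
have la : lsummable a by apply: (lsummable_le _ sN1) => k; rewrite lerDl.
have lb : lsummable b by apply: (lsummable_le _ sN1) => k; rewrite lerDr.
rewrite /numflow synthB//; [|exact: wsummable0|exact: wsummable0].
apply: (@le_trans _ _ (lsum (fun k => s * (nu * (weight k ^+ 2 * N1 k) + weight k ^+ 1 * N2 k)))).
  apply: normr_synth_le => [k|]; last first.
    by apply: lsummableZ; apply: lsummableD => //; exact: lsummableZ.
  have e c d : `|duhamel s c d k - c k| <=
      s * (nu * (weight k ^+ 2 * `|c k|) + weight k ^+ 1 * `|d k|).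
    rewrite (_ : _ - _ = - ((1 - decay s k) * c k) - decay s k * (s * (q k * d k))); last first.
      by rewrite /duhamel; ring.
    rewrite (le_trans (ler_normB _ _))// normrN !normrM mulrDr lerD//.
      rewrite (@ger0_norm _ (1 - decay s k)) ?subr_ge0 ?decay_le1//.
      by rewrite (le_trans (ler_wpM2r _ (onem_decay_le k s0)))// -!mulrA.
    rewrite (ger0_norm (ltW (decay_gt0 s k))) (ger0_norm s0) (ger0_norm (sqnorm_ge0 R k)).
    rewrite (le_trans (ler_piMl _ (decay_le1 k s0)))//; first by rewrite !mulr_ge0 ?sqnorm_ge0.
    by rewrite ler_wpM2l// expr1 ler_wpM2r// sqnorm_le_weight.
  rewrite (le_trans (lerD (e a g) (e b h)))// -mulrDr ler_wpM2l// /N1 /N2 !mulrDr.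
  by rewrite le_eqVlt; apply/orP; left; apply/eqP; rewrite addrACA.
rewrite lsumZ ?lsumD ?lsumZ//; [|exact: lsummableZ|by apply: lsummableD => //; exact: lsummableZ].
by rewrite ler_wpM2l// lerD// ler_wpM2l// ltW.
Qed.

Lemma numflow0 : numflow 0 = synth a b.
Proof.
rewrite /numflow; congr synth; apply/funext => k;
  by rewrite /duhamel /decay !mul0r oppr0 expR0 mul1r addr0.
Qed.

Lemma numflow_periodic s : periodic2 (numflow s). Proof. exact: synth_periodic. Qed.
Lemma numforce_periodic s : periodic2 (numforce s). Proof. exact: synth_periodic. Qed.

Lemma numflow_continuous s : 0 <= s <= tau -> continuous (numflow s).
Proof. by move=> hs; exact: smooth_continuous (numflow_smooth hs). Qed.

(** Extends the interpolant by constants outside the step, so that it is defined, bounded and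
    continuous for all real times, as [solution_step] demands; the open step itself is
    unaffected. *)
Definition clip s : R := Num.max 0 (Num.min s tau).

Lemma clip_itv s : 0 <= clip s <= tau.
Proof. by rewrite /clip le_max lexx /= ge_max (ltW tau_gt0) ge_min lexx orbT. Qed.

Lemma clip_id s : 0 <= s <= tau -> clip s = s.
Proof. by move=> /andP[s0 st]; rewrite /clip min_l// max_r. Qed.

Lemma clip_continuous : continuous clip.
Proof.
move=> s; apply: (@continuous_max R R (fun=> 0) (fun s => Num.min s tau)); first exact: cvg_cst.
by apply: (@continuous_min R R id (fun=> tau)); [exact: cvg_id|exact: cvg_cst].
Qed.

Lemma numflow_clip_continuous z : continuous (fun s => numflow (clip s) z).
Proof.
move=> s; apply: (@lsum_continuous R (fun s k => duhamel (clip s) a g k * cos (dotk k z) +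
  duhamel (clip s) b h k * sin (dotk k z)) S s (s - 1) (s + 1)); first by lra.
- move=> x k _; rewrite (le_trans (synth_term_le _ _ _ _))// duhamel_pair_le//.
  exact: clip_itv.
- exact: wsummable_lsummable (@wsummable_S 0 isT).
- move=> x k _; apply: (@continuous_comp _ _ _ clip (fun s => duhamel s a g k * cos (dotk k z) +
    duhamel s b h k * sin (dotk k z))); first exact: clip_continuous.
  apply: differentiable_continuous; apply/derivable1_diffP.
  by have [] := numflow_term_derive (clip x) k z.
Qed.

End Interpolant.

(** * The nonlinear term and continuous representatives *)

Section Convergence.
Context (R : realType).
Implicit Types (k : int * int) (z : R * R) (f F : R * R -> R) (c d : int * int -> R).
Local Notation leb2 := (lebesgue2 R).
Local Notation cell := (@cell R).
Local Notation RR := (measurableTypeR R * measurableTypeR R)%type.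

Lemma wnormD_le p c d (A B : R) : (wnorm p c <= A%:E)%E -> (wnorm p d <= B%:E)%E ->
  (wnorm p (fun k => `|c k| + `|d k|)%R <= (A + B)%:E)%E.
Proof.
move=> hA hB; have sc : wsummable p c by exact: le_lt_trans hA (ltry _).
have sd : wsummable p d by exact: le_lt_trans hB (ltry _).
pose wc k := `|@weight R k ^+ p * c k|; pose wd k := `|@weight R k ^+ p * d k|.
have sD : lsummable (fun k => wc k + wd k) by apply: lsummableD; exact: lsummable_abs.
apply: (@le_trans _ _ (lnorm (fun k => wc k + wd k))).
  apply: le_lnorm => k; rewrite /wc /wd !normrM -mulrDr normrM normr_id.
  by rewrite (ger0_norm (addr_ge0 (normr_ge0 _) (normr_ge0 _))).
rewrite -(fine_lnorm sD) -lsum_abs.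
rewrite (@eq_lsum _ _ (fun k => wc k + wd k)); last first.
  by move=> k; apply: ger0_norm; rewrite /wc /wd addr_ge0.
rewrite lsumD; [|exact: lsummable_abs..].
by rewrite !lsum_abs lee_fin lerD// -lee_fin fine_lnorm.
Qed.

Lemma le_wnorm p c d : (forall k, `|c k| <= `|d k|) -> (wnorm p c <= wnorm p d)%E.
Proof. by move=> cd; apply: le_lnorm => k; rewrite !normrM ler_wpM2l. Qed.

Lemma continuous_cell_measurable f : continuous f -> measurable_fun (cell : set RR) f.
Proof. by move=> cf; apply: measurable_funTS; exact: (continuous_measurable2 cf). Qed.

Lemma trig_cell_measurable k :
  measurable_fun (cell : set RR) (fun z => cos (dotk k z)) /\
  measurable_fun (cell : set RR) (fun z => sin (dotk k z)).
Proof.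
split; apply: continuous_cell_measurable; [exact: cosk_continuous|exact: sink_continuous].
Qed.

Lemma ae_fourier_eq f F : measurable_fun (cell : set RR) f -> measurable_fun (cell : set RR) F ->
  {ae leb2, forall z, cell z -> f z = F z} -> fcos f = fcos F /\ fsin f = fsin F.
Proof.
move=> mf mF fF; split; apply/funext => k; have [mc ms] := trig_cell_measurable k;
  rewrite /fcos /fsin; congr (_ * _); apply: ae_cell_eq.
- by refine (ae_impl _ fF) => z e cz /=; rewrite (e cz).
- exact: (measurable_funM mf mc).
- exact: (measurable_funM mF mc).
- by refine (ae_impl _ fF) => z e cz /=; rewrite (e cz).
- exact: (measurable_funM mf ms).
- exact: (measurable_funM mF ms).
Qed.

(** The cube is F (F F), so [wnorm_mul_le] is used twice with p = 3, each time with constant 2^4;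
    the last A accounts for the linear term. The continuous representative F has the same
    coefficients as f. *)
Lemma wnorm_cube_le f (A : R) : cintegrable f -> (wnorm 3 (fcoef f) <= A%:E)%E ->
  (wnorm 3 (fcoef (fun z => synth (fcos f) (fsin f) z ^+ 3 - synth (fcos f) (fsin f) z)%R)
    <= (2 ^+ 4 * A * (2 ^+ 4 * A * A) + A)%:E)%E.
Proof.
move=> jf fA; have s3 : wsummable 3 (fcoef f) by exact: le_lt_trans fA (ltry _).
have sf : lsummable (fcoef f) by exact: wsummable_lsummable s3.
have sc : lsummable (fcos f) by apply: (lsummable_le _ sf) => k; rewrite /fcoef lerDl.
have ss : lsummable (fsin f) by apply: (lsummable_le _ sf) => k; rewrite /fcoef lerDr.
set F := synth _ _.
have cF : continuous F by exact: synth_continuous.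
have EF : fcoef F = fcoef f.
  apply/funext => k; rewrite /fcoef /F fcos_synth ?fsin_synth//.
    by move=> l; exact: fsinN.
  by move=> l; exact: fcosN.
have FA : (wnorm 3 (fcoef F) <= A%:E)%E by rewrite EF.
have c2 : continuous (fun z => F z * F z) by move=> z; apply: cvgM; exact: cF.
have h2 : (wnorm 3 (fcoef (fun z => F z * F z)%R) <= (2 ^+ 4 * A * A)%:E)%E.
  exact: (wnorm_mul_le cF fA FA).
have h3 := wnorm_mul_le c2 fA h2; rewrite -/F in h3.
have jF : cintegrable F by exact: continuous_cintegrable.
have c3 : continuous (fun z => F z * (F z * F z)) by move=> z; apply: cvgM; [exact: cF|exact: c2].
have j3 : cintegrable (fun z => F z * (F z * F z)) by exact: continuous_cintegrable.
apply: (le_trans _ (wnormD_le h3 FA)); apply: le_wnorm => k.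
rewrite [leLHS]ger0_norm ?fcoef_ge0// [leRHS]ger0_norm ?addr_ge0//.
rewrite !(ger0_norm (fcoef_ge0 _ _)).
have -> : (fun z => F z ^+ 3 - F z) = (fun z => F z * (F z * F z) - F z).
  by apply/funext => z; ring.
have -> : fcoef (fun z => F z * (F z * F z) - F z) k =
    `|fcos (fun z => F z * (F z * F z)) k - fcos F k| +
    `|fsin (fun z => F z * (F z * F z)) k - fsin F k|.
  rewrite /fcoef /fcos /fsin -!mulrBr -!cintB; try exact: cintegrable_cosk; try exact: cintegrable_sink.
  by congr (`|_ * _| + `|_ * _|); apply: eq_cint => z _; rewrite mulrBl.
have := ler_normB (fcos (fun z => F z * (F z * F z)) k) (fcos F k).
have := ler_normB (fsin (fun z => F z * (F z * F z)) k) (fsin F k).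
by rewrite /fcoef; lra.
Qed.

Lemma fourier_synth_ae f (A : R) : cintegrable f -> (wnorm 3 (fcoef f) <= A%:E)%E ->
  continuous (synth (fcos f) (fsin f)) /\
  {ae leb2, forall z, cell z -> f z = synth (fcos f) (fsin f) z}.
Proof.
move=> jf fA; have s3 : wsummable 3 (fcoef f) by exact: le_lt_trans fA (ltry _).
have sf : lsummable (fcoef f) by exact: wsummable_lsummable s3.
have sc : lsummable (fcos f) by apply: (lsummable_le _ sf) => k; rewrite /fcoef lerDl.
have ss : lsummable (fsin f) by apply: (lsummable_le _ sf) => k; rewrite /fcoef lerDr.
by split; [exact: synth_continuous|exact: fourier_inversion].
Qed.

Lemma solution_continuous nu (u0 : R * R -> R) (u : R -> R * R -> R) (t : R) : 0 <= t ->
  CH_solution nu u0 u -> continuous (u t).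
Proof.
move=> t0 [[_ cu _ _] _ _]; have cc := continuous_clip_time cu.
have -> : u t = (fun p => u (Num.max p.1 0) p.2) \o (fun z => (t, z)).
  by apply/funext => z /=; rewrite max_l.
move=> z; apply: continuous_comp; last exact: cc.
by apply: (@cvg_pair _ _ _ (nbhs z) (nbhs t) (nbhs z)); [exact: cvg_cst|exact: cvg_id].
Qed.

End Convergence.

(** * One step of the splitting scheme *)

Section OneStep.
Context (R : realType).
Implicit Types (k : int * int) (z : R * R) (f F : R * R -> R).
Local Notation leb2 := (lebesgue2 R).
Local Notation cell := (@cell R).
Local Notation RR := (measurableTypeR R * measurableTypeR R)%type.

Lemma cint_sqr_ae_eq f F (v : R * R -> R) : measurable_fun (cell : set RR) f ->
  measurable_fun (cell : set RR) F -> measurable_fun (cell : set RR) v ->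
  {ae leb2, forall z, cell z -> f z = F z} ->
  cint (fun z => (f z - v z) ^+ 2) = cint (fun z => (F z - v z) ^+ 2).
Proof.
move=> mf mF mv fF; apply: ae_cell_eq.
- by apply: ae_impl fF => z e cz; rewrite (e cz).
- exact: measurable_funX (measurable_funB mf mv).
- exact: measurable_funX (measurable_funB mF mv).
Qed.

Lemma cubic_lipschitz (W x y : R) : `|x| <= W -> `|y| <= W ->
  `|(x ^+ 3 - x) - (y ^+ 3 - y)| <= (3 * W ^+ 2 + 1) * `|x - y|.
Proof.
move=> hx hy.
have -> : (x ^+ 3 - x) - (y ^+ 3 - y) = (x ^+ 2 + x * y + y ^+ 2 - 1) * (x - y) by ring.
rewrite normrM ler_wpM2r//.
move: hx hy; rewrite !ler_norml => /andP[x1 x2] /andP[y1 y2].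
have W0 : 0 <= W by lra.
have xx : x ^+ 2 <= W ^+ 2 by nra.
have yy : y ^+ 2 <= W ^+ 2 by nra.
have := sqr_ge0 (x + y); have := sqr_ge0 (x - y).
by move=> q1 q2; apply/andP; split; nra.
Qed.

Lemma splitting_fourier (nu tau : R) f F : fourier F = SL nu tau (SN tau f) ->
  fcos F = duhamel nu tau (fcos f) (fcos (fun z => f z ^+ 3 - f z)) /\
  fsin F = duhamel nu tau (fsin f) (fsin (fun z => f z ^+ 3 - f z)).
Proof.
move=> E; split; apply/funext => k; have := congr1 (fun c => c k) E;
  rewrite /SL /SN /lap_mult !fourierE /duhamel /decay.
  move/(congr1 (@complex.Re R)) => /= ->; ring.
move/(congr1 (@complex.Im R)) => /= h; apply: oppr_inj; rewrite h; ring.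
Qed.

(** The classes f and f' are replaced by their Fourier series, which are the values of one
    interpolant at s = 0 and s = tau. The constant L bounds the residual divided by tau: nu B comes
    from smoothing the nonlinear term, and the Lipschitz constant 3 W^2 + 1 multiplies the
    displacement nu A + B of the interpolant. *)
Lemma splitting_step (nu tau T A B W L K a : R) (u0 : R * R -> R) (u : R -> R * R -> R) f f' :
  0 < nu -> 0 < tau -> tau <= T -> 0 <= a ->
  B = 2 ^+ 4 * A * (2 ^+ 4 * A * A) + A -> W = A + T * B ->
  L = nu * B + (3 * W ^+ 2 + 1) * (nu * A + B) ->
  K = 2 * (3 / 2 * W ^+ 2 + 9 / 2 * W ^+ 4 + 2 / nu) ->
  L2torus f -> (wnorm 3 (fcoef f) <= A%:E)%E ->
  L2torus f' -> (wnorm 3 (fcoef f') <= A%:E)%E ->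
  fourier f' = SL nu tau (SN tau f) -> CH_solution nu u0 u ->
  expR (- (K * (a + tau))) * cint (fun z => (f' z - u (a + tau) z) ^+ 2)
    - (tau * L) ^+ 2 * (pi *+ 2) ^+ 2 / nu * (a + tau) <=
  expR (- (K * a)) * cint (fun z => (f z - u a z) ^+ 2)
    - (tau * L) ^+ 2 * (pi *+ 2) ^+ 2 / nu * a.
Proof.
move=> nu0 tau0 tauT a0 BE WE LE KE Lf fA Lf' fA' fE sol.
have [_ mf0 _] := Lf; have [_ mf0' _] := Lf'.
have mf : measurable_fun (cell : set RR) f by exact: measurable_funTS mf0.
have mf' : measurable_fun (cell : set RR) f' by exact: measurable_funTS mf0'.
have [cF aeF] := fourier_synth_ae (L2torus_cintegrable Lf) fA.
have [cF' aeF'] := fourier_synth_ae (L2torus_cintegrable Lf') fA'.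
have mF := continuous_cell_measurable cF; have mF' := continuous_cell_measurable cF'.
have hB := wnorm_cube_le (L2torus_cintegrable Lf) fA.
rewrite -BE in hB.
set F := synth (fcos f) (fsin f) in cF aeF mF hB.
set F' := synth (fcos f') (fsin f') in cF' aeF' mF'.
pose N z := F z ^+ 3 - F z.
rewrite -[fun z => (F z ^+ 3 - F z)%R]/N in hB.
have cN : continuous N.
  move=> z; apply: cvgB; last exact: cF.
  have -> : (fun z => F z ^+ 3) = (fun z => F z * (F z * F z)) by apply/funext => x; ring.
  by apply: cvgM; [exact: cF|apply: cvgM; exact: cF].
have jN : cintegrable N by exact: continuous_cintegrable.
have [cSN aeN] := fourier_synth_ae jN hB.
have mN := continuous_cell_measurable cN.
have mn : measurable_fun (cell : set RR) (fun z => f z ^+ 3 - f z).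
  exact: measurable_funB (measurable_funX _ mf) mf.
have aen : {ae leb2, forall z, cell z -> f z ^+ 3 - f z = N z}.
  by apply: ae_impl aeF => z e cz; rewrite (e cz).
(* The scheme evaluates the nonlinear term on the class f; its coefficients are those of the
   continuous function N. *)
have [EN1 EN2] := ae_fourier_eq mn mN aen.
have [] := splitting_fourier fE; rewrite EN1 EN2.
have hA := fA; rewrite -[fcoef f]/(fun k => `|fcos f k| + `|fsin f k|) in hA.
rewrite -[fcoef N]/(fun k => `|fcos N k| + `|fsin N k|) in hB.
move=> E1 E2.
have FE' : F' = numflow nu (fcos f) (fsin f) (fcos N) (fsin N) tau by rewrite /F' E1 E2.
have FE : F = numflow nu (fcos f) (fsin f) (fcos N) (fsin N) 0 by rewrite numflow0.
have W0 : 0 <= W by rewrite WE; exact: W_ge0 tau0 tauT hA hB.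
have cu t : 0 <= t -> continuous (u t) by move=> t0; exact: solution_continuous t0 sol.
have tau_itv : 0 <= tau <= tau by rewrite ltW//=.
have o_itv : 0 <= (0 : R) <= tau by rewrite lexx ltW.
have cut : continuous (u (a + tau)) by apply: cu; rewrite addr_ge0// ltW.
rewrite (cint_sqr_ae_eq mf' mF' (continuous_cell_measurable cut) aeF').
rewrite (cint_sqr_ae_eq mf mF (continuous_cell_measurable (cu _ a0)) aeF).
pose w s := numflow nu (fcos f) (fsin f) (fcos N) (fsin N) (clip tau s).
have w0 : F = w 0 by rewrite /w clip_id.
have wt : F' = w tau by rewrite /w clip_id.
rewrite w0 wt.
have cid s : 0 < s < tau -> clip tau s = s.
  by move=> /andP[s0 st]; apply: clip_id; rewrite !ltW.
have itv s : 0 < s < tau -> 0 <= s <= tau by move=> /andP[s0 st]; rewrite !ltW.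
(* The sum of [dbound], with the section variables written out. *)
pose M := lsum (fun k => nu * (@weight R k ^+ 2 *
   (`|fcos f k| + `|fsin f k| + T * (@weight R k * (`|fcos N k| + `|fsin N k|)))) +
   @weight R k ^+ 3 * (`|fcos N k| + `|fsin N k|)).
apply: (@solution_step R nu W ((tau * L) ^+ 2 * (pi *+ 2) ^+ 2) M a tau K u0 u w
  (numforce nu (fcos N) (fsin N))) => //.
- by apply: mulr_ge0; exact: sqr_ge0.
- by move=> s; exact: (numflow_continuous nu0 tau0 tauT hA hB (clip_itv tau0 s)).
- by move=> z; exact: (numflow_clip_continuous nu0 tau0 tauT hA hB).
- by move=> s z; rewrite WE; exact: (numflow_le nu0 tau0 tauT hA hB z (clip_itv tau0 s)).
- by move=> s hs; exact: (numflow_smooth nu0 tau0 tauT hA hB (clip_itv tau0 s)).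
- by move=> s /itv/andP[s0 _]; exact: (numforce_smooth nu0 hB s0).
- move=> s _; exact: numflow_periodic.
- move=> s _; exact: numforce_periodic.
- by move=> s z _; rewrite WE; exact: (derive1_numflow_le nu0 tau0 tauT hA hB z (clip_itv tau0 s)).
- by move=> s z _; rewrite WE; exact: (derive2_numflow_le nu0 tau0 tauT hA hB z (clip_itv tau0 s)).
- move=> s z hs; rewrite /w cid//.
  have -> := laplacian_numflow nu0 tau0 tauT hA hB z (itv _ hs).
  apply: near_eq_is_derive (is_derive_numflow nu0 tau0 tauT hA hB z hs).
  have : \forall x \near s, x \in `]0, tau[ by apply: near_in_itvoo; rewrite in_itv.
  by apply: filterS => x; rewrite in_itv /= => hx; rewrite cid.
- move=> s z hs; rewrite /w cid//.
  have -> := laplacian_numflow nu0 tau0 tauT hA hB z (itv _ hs).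
  exact: (dnumflow_le nu0 tau0 tauT hA hB z (itv _ hs)).
- move=> s hs; rewrite /w cid//.
  have hs' := itv _ hs; have /andP[s0 st] := hs'.
  have cw : continuous (numflow nu (fcos f) (fsin f) (fcos N) (fsin N) s).
    exact: (numflow_continuous nu0 tau0 tauT hA hB hs').
  have cG : continuous (numforce nu (fcos N) (fsin N) s).
    exact: smooth_continuous (numforce_smooth nu0 hB s0).
  set ws := numflow nu (fcos f) (fsin f) (fcos N) (fsin N) s in cw *.
  set G := numforce nu (fcos N) (fsin N) s in cG *.
  (* The residual splits into the effect of smoothing and the motion of the interpolant. The series
     of N equals N only almost everywhere, so r represents the residual up to a null set, which
     suffices under the integral. *)
  pose r z := (G z - synth (fcos N) (fsin N) z) + (N z - (ws z ^+ 3 - ws z)).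
  have cwn : continuous (fun z => ws z ^+ 3 - ws z).
    move=> z; apply: cvgB; last exact: cw.
    have -> : (fun z => ws z ^+ 3) = (fun z => ws z * (ws z * ws z)) by apply/funext => x; ring.
    by apply: cvgM; [exact: cw|apply: cvgM; exact: cw].
  have cr : continuous r.
    move=> z; apply: cvgD; apply: cvgB; [exact: cG|exact: cSN|exact: cN|exact: cwn].
  have mG := continuous_cell_measurable cG; have mw := continuous_cell_measurable cwn.
  have mr := continuous_cell_measurable cr.
  rewrite (@ae_cell_eq _ _ (fun z => r z ^+ 2)); first last.
  + exact: measurable_funX mr.
  + exact: measurable_funX (measurable_funB mG mw).
  + apply: ae_impl aeN => z e cz; rewrite /r (e cz); congr (_ ^+ 2); ring.
  have rL z : `|r z| <= tau * L.
    have h1 := numforce_sub_le nu0 hB z hs'.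
    have h2 := numflow_sub_le nu0 tau0 tauT hA hB z hs'.
    have h3 := numflow_le nu0 tau0 tauT hA hB z hs'.
    have h4 := numflow_le nu0 tau0 tauT hA hB z o_itv.
    rewrite -/ws -WE in h3; rewrite -FE -WE in h4; rewrite -/ws -/F distrC in h2.
    have h5 := cubic_lipschitz h4 h3; rewrite -/(N z) in h5.
    have p0 : 0 <= 3 * W ^+ 2 + 1 by have := sqr_ge0 W; lra.
    have h6 := le_trans h5 (ler_wpM2l p0 h2).
    have h7 := le_trans (ler_normD _ _) (lerD h1 h6); rewrite -/(r z) in h7.
    have sL : `|r z| <= s * L.
      by rewrite (le_trans h7)// LE le_eqVlt; apply/orP; left; apply/eqP; ring.
    have sp : 0 < s by case/andP: hs.
    (* Nonnegativity of L is read off from 0 <= |r z| <= s L with s > 0. *)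
    have L0 : 0 <= L by rewrite -(pmulr_rge0 _ sp); exact: le_trans sL.
    by rewrite (le_trans sL)// ler_wpM2r.
  rewrite -cint_cst; apply: le_cint.
  + apply: continuous_cintegrable.
    have -> : (fun z => r z ^+ 2) = (fun z => r z * r z) by apply/funext => z; rewrite expr2.
    by move=> z; apply: cvgM; exact: cr.
  + by apply: continuous_cintegrable => z; exact: cvg_cst.
  + move=> z _; rewrite -(real_normK (num_real (r z))) lerXn2r// nnegrE.
    exact: le_trans (rL z).
Qed.

End OneStep.

(** * Error bound *)

Section MainTheorem.
Context (R : realType).
Implicit Types (k : int * int) (z : R * R) (f F d : R * R -> R).
Local Notation cell := (@cell R).
Local Notation RR := (measurableTypeR R * measurableTypeR R)%type.

Lemma L2norm_le d (e : R) : 0 <= e -> cintegrable (fun z => d z ^+ 2) ->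
  cint (fun z => d z ^+ 2) <= e ^+ 2 -> (L2norm d <= e%:E)%E.
Proof.
move=> e0 jd hd.
have E : (L2norm d `^ 2 = (cint (fun z => d z ^+ 2)%R)%:E)%E.
  rewrite /L2norm poweR_Lnorm// /cint /Rintegral fineK; last first.
    by apply: integrable_fin_num jd; exact: measurable_cell.
  rewrite [RHS]integral_mkcond.
  apply: eq_integral => z _; rewrite /= !patchE; case: ifP => // _.
    by rewrite powR_mulrn// real_normK ?num_real.
  by rewrite [in LHS]/point/= normr0 powR0.
have N0 : (0 <= L2norm d)%E by exact: Lnorm_ge0.
have -> : L2norm d = ((L2norm d `^ 2) `^ 2^-1)%E by rewrite -poweRrM mulfV// poweRe1.
have -> : e%:E = (((e ^+ 2)%:E) `^ 2^-1)%E.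
  by rewrite poweR_EFin -powR_mulrn// -powRrM mulfV// powRr1.
apply: gt0_ler_poweR; rewrite ?E ?lee_fin//.
  by rewrite in_itv/= leey andbT -E poweR_ge0.
by rewrite in_itv/= leey andbT lee_fin sqr_ge0.
Qed.

Lemma sub_sqr_cintegrable f (v : R * R -> R) : L2torus f -> continuous v ->
  cintegrable (fun z => (f z - v z) ^+ 2).
Proof.
move=> Lf cv; have [_ mf _] := Lf.
have jv : cintegrable (fun z => v z ^+ 2).
  apply: continuous_cintegrable => z.
  have -> : (fun z => v z ^+ 2) = (fun z => v z * v z) by apply/funext => x; rewrite expr2.
  by apply: cvgM; exact: cv.
have mv : measurable_fun (cell : set RR) v by exact: continuous_cell_measurable.
have mf' : measurable_fun (cell : set RR) f by exact: measurable_funTS mf.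
have j2 := cintegrableZ 2 (cintegrableD (sqr_cintegrable Lf) jv).
apply: (le_integrable _ _ _ j2); first exact: measurable_cell.
  by apply/measurable_EFinP; exact: measurable_funX (measurable_funB mf' mv).
move=> z _ /=; rewrite lee_fin ger0_norm ?sqr_ge0// ger0_norm; last first.
  by apply: mulr_ge0 => //; apply: addr_ge0; exact: sqr_ge0.
have := sqr_ge0 (f z + v z); nra.
Qed.

Lemma sobolev_sqnorm_le f (M : R) : sobolev 8 f -> sobolev_norm 8 f <= M ->
  (sobolev_sqnorm 8 f <= (M ^+ 2)%:E)%E.
Proof.
move=> [_ fin] hM; have S0 : (0 <= sobolev_sqnorm 8 f)%E.
  apply: esum_ge0 => k _; rewrite lee_fin; apply: mulr_ge0; last exact: sqr_ge0.
  apply: mulr_ge0; first exact: sqr_ge0.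
  exact: exprn_ge0 (ltW (weight_gt0 _ _)).
have F0 := fine_ge0 S0; rewrite -[leLHS]fineK ?ge0_fin_numE// lee_fin.
rewrite -(sqr_sqrtr F0) lerXn2r ?nnegrE ?sqrtr_ge0//.
exact: le_trans (sqrtr_ge0 _) hM.
Qed.

Section Constants.
Variables (A1 : R -> R -> nat -> R) (nu h T : R).
(** The constant A of the one-step estimate: [sobolev_wnorm_le] at the square of the stability bound
    in H^8. This constant and the following ones depend on nu, h and T, but neither on tau nor on
    the step index. *)
Definition coef_bound : R := (2 * (pi *+ 2) ^+ 2)^-1 * A1 h nu 8 ^+ 2 + 64.
Definition nonlin_bound : R :=
  2 ^+ 4 * coef_bound * (2 ^+ 4 * coef_bound * coef_bound) + coef_bound.
Definition flow_bound : R := coef_bound + T * nonlin_bound.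
Definition residual_bound : R := nu * nonlin_bound +
  (3 * flow_bound ^+ 2 + 1) * (nu * coef_bound + nonlin_bound).
Definition growth_rate : R :=
  2 * (3 / 2 * flow_bound ^+ 2 + 9 / 2 * flow_bound ^+ 4 + 2 / nu).
(** The square root of the final energy bound divided by tau^2. The summand 1 makes the constant
    positive for all real parameters. *)
Definition error_const : R :=
  Num.sqrt (expR (growth_rate * T) * (residual_bound ^+ 2 * (pi *+ 2) ^+ 2 / nu * T)) + 1.

Lemma error_const_gt0 : 0 < error_const.
Proof. by rewrite ltr_wpDl// sqrtr_ge0. Qed.
End Constants.

(** The stability bound is the same for every iterate, so all steps share K and P and the discounted
    squared error telescopes from its initial value 0. As P is a multiple of tau^2, the square root
    is of order tau. *)
Lemma error_bound (tau_star : R -> R -> R) (A1 : R -> R -> nat -> R)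
    (nu tau T : R) (u0 : R * R -> R) (U : nat -> R * R -> R) (u : R -> R * R -> R) (n : nat) :
  uniform_stability tau_star A1 -> 0 < nu -> sobolev 8 u0 -> mean_zero u0 ->
  0 < tau -> tau < tau_star (sobolev_norm 1 u0) nu ->
  splitting_iterates nu tau u0 U -> CH_solution nu u0 u ->
  (1 <= n)%N -> n%:R * tau <= T ->
  (L2norm (fun z => U n z - u (n%:R * tau) z)%R
     <= (error_const A1 nu (sobolev_norm 8 u0) T * tau)%:E)%E.
Proof.
move=> [_ stab] nu0 u0S mz tau0 ts it sol n1 nT.
have hU m := stab nu 8%N u0 tau U nu0 isT u0S mz tau0 ts it m.
have [U0 Urec] := it; have [_ _ ae0] := sol.
have LU m : L2torus (U m) by have [[]] := hU m.
set H := sobolev_norm 8 u0; rewrite -/H in hU.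
have UA m : (wnorm 3 (fcoef (U m)) <= (coef_bound A1 nu H)%:E)%E.
  by have [Sm Am] := hU m; exact: sobolev_wnorm_le (sobolev_sqnorm_le Sm Am).
(* Here n >= 1 enters: it yields tau <= T, so that the one-step constants can be expressed through
   T. *)
have tauT : tau <= T.
  by rewrite (le_trans _ nT)// ler_peMl ?(ltW tau0)// ler1n.
set K := growth_rate A1 nu H T; set L := residual_bound A1 nu H T.
pose E m := cint (fun z => (U m z - u (m%:R * tau) z) ^+ 2).
pose P := (tau * L) ^+ 2 * (pi *+ 2) ^+ 2 / nu.
have cu t : 0 <= t -> continuous (u t) by move=> t0; exact: solution_continuous t0 sol.
have mU m : measurable_fun (cell : set RR) (U m).
  by have [_ mm _] := LU m; exact: measurable_funTS mm.
have nt0 m : 0 <= m%:R * tau by rewrite mulr_ge0 ?ler0n// ltW.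
have E0 : E 0%N = 0.
  rewrite /E mul0r; have cu0 := continuous_cell_measurable (cu _ (lexx 0)).
  rewrite (@cint_sqr_ae_eq _ (U 0%N) (u 0) (u 0))//.
    rewrite (@eq_cint _ _ (fun=> 0)) ?cint_cst ?mul0r// => z _.
    by rewrite subrr expr0n.
  by rewrite U0; apply: ae_impl ae0 => z -> _.
have step m : expR (- (K * (m%:R * tau))) * E m - P * (m%:R * tau) <= 0.
  elim: m => [|m IH]; first by rewrite E0 mulr0 mul0r mulr0 subrr.
  apply: le_trans IH.
  have [Lm Fm] := Urec m.
  have -> : m.+1%:R * tau = m%:R * tau + tau by rewrite -natr1 mulrDl mul1r.
  have := @splitting_step R nu tau T _ _ _ L K (m%:R * tau) u0 u (U m) (U m.+1) nu0 tau0 tauT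
    (nt0 m) erefl erefl erefl erefl (LU m) (UA m) (LU m.+1) (UA m.+1) Fm sol.
  by rewrite /E -natr1 mulrDl mul1r.
have K0 : 0 <= K.
  have q : 0 <= 2 / nu by rewrite divr_ge0// ltW.
  rewrite /K /growth_rate; set W := flow_bound _ _ _ _.
  have := sqr_ge0 W; have := sqr_ge0 (W ^+ 2); rewrite -exprM => w4 w2.
  by apply: mulr_ge0 => //; lra.
have EnT : E n <= expR (K * T) * (P * T).
  have P0 : 0 <= P by rewrite divr_ge0 ?(ltW nu0)// mulr_ge0 ?sqr_ge0.
  have := step n; rewrite subr_le0 expRN => h1.
  have h2 : E n <= expR (K * (n%:R * tau)) * (P * (n%:R * tau)).
    by rewrite mulrC -ler_pdivrMr ?expR_gt0// mulrC.
  apply: (le_trans h2); apply: ler_pM.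
  - exact: expR_ge0.
  - exact: mulr_ge0 P0 (nt0 n).
  - by rewrite ler_expR ler_wpM2l.
  - by rewrite ler_wpM2l.
have jd := sub_sqr_cintegrable (LU n) (cu _ (nt0 n)).
apply: L2norm_le => //; first by rewrite mulr_ge0 ?(ltW tau0)// ltW// error_const_gt0.
apply: (le_trans EnT).
set D := expR (K * T) * (L ^+ 2 * (pi *+ 2) ^+ 2 / nu * T).
have T0 : 0 <= T by exact: le_trans (ltW tau0) tauT.
have D0 : 0 <= D.
  by rewrite mulr_ge0 ?expR_ge0// mulr_ge0// divr_ge0 ?(ltW nu0)// mulr_ge0 ?sqr_ge0.
have -> : expR (K * T) * (P * T) = D * tau ^+ 2 by rewrite /D /P; ring.
rewrite exprMn ler_wpM2r ?sqr_ge0// -[leLHS](sqr_sqrtr D0).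
rewrite lerXn2r ?nnegrE ?sqrtr_ge0//; first exact/ltW/error_const_gt0.
by rewrite /error_const -/K -/L -/D lerDl.
Qed.

End MainTheorem.

Theorem theorem1p2 (R : realType) (tau_star : R -> R -> R)
    (A1 : R -> R -> nat -> R) (stab : uniform_stability tau_star A1) :
  exists C : R -> R -> R -> R,
    (forall nu h T : R, 0 < C nu h T) /\
    forall (nu : R) (u0 : R * R -> R) (tau : R) (U : nat -> R * R -> R)
           (u : R -> R * R -> R) (T : R),
      0 < nu -> sobolev 8 u0 -> mean_zero u0 ->
      0 < tau -> tau < tau_star (sobolev_norm 1 u0) nu ->
      splitting_iterates nu tau u0 U ->
      CH_solution nu u0 u ->
      0 < T ->
      forall n : nat, (1 <= n)%N -> n%:R * tau <= T ->
        (L2norm (fun z => U n z - u (n%:R * tau) z)%R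
           <= (C nu (sobolev_norm 8 u0) T * tau)%:E)%E.
Proof.
exists (error_const A1); split; first exact: error_const_gt0.
move=> nu u0 tau U u T nu0 u0S mz tau0 ts it sol _ n n1 nT.
exact: error_bound stab nu0 u0S mz tau0 ts it sol n1 nT.
Qed.
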